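(* Let $n\ge 3$ and let $YC$ be the flat $Y$-cone, i.e. the union of three half-unit disks joined along their diameters and meeting at equal angles of $120^\circ$. Suppose $u=(u_1,u_2,u_3):YC\to\mathbb{B}^n$ is a conformal minimal immersion such that $u(YC)$ meets $\partial\mathbb{B}^n$ orthogonally. Then $u(YC)$ is congruent to the flat $Y$-cone $YC$.
   Context: $\mathbb{B}^n\subset\mathbb{R}^n$ is the closed unit ball and $\mathbb{S}^{n-1}=\partial\mathbb{B}^n$. Flat $Y$-cone. Let $\hat D=\{(x,y)\in\mathbb{R}^2: x^2+y^2\le 1,\ x\ge 0\}$ be the half-disk, with diameter $\gamma=\{x=0,\ -1\le y\le 1\}$ and arc $\sigma=\{x^2+y^2=1,\ x\ge 0\}$. Regard $\hat D$ as contained in a 2-plane of $\mathbb{R}^3\subset\mathbb{R}^n$ and let $\hat D_\theta$ be its rotation by angle $\theta$ about the $y$-axis in $\mathbb{R}^3$. Then $YC=\hat D\cup\hat D_{120^\circ}\cup\hat D_{-120^\circ}$. Each of the three faces is identified isometrically with $\hat D$, with the common diameter identified with $\gamma$ in the same way for all three faces; each face carries its flat metric. Maps. A map $u=(u_1,u_2,u_3)$ on $YC$ consists of three maps $u_j:\hat D\to\mathbb{R}^n$ (one for each face), smooth up to the boundary. Conformal: each $u_j$ is conformal, and $u_1(p)=u_2(p)=u_3(p)$ for all $p\in\gamma$. Minimal immersion: (i) each $u_j$ is a smooth minimal immersion; (ii) $u_1=u_2=u_3$ on $\gamma$, so that the images of the three diameters coincide and form a common immersed curve $\Gamma=u(\gamma)$;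 (iii) if $\tau_j$ denotes the outward unit conormal of $u_j(\hat D)$ along $\Gamma$, then $\tau_1+\tau_2+\tau_3=0$ along $\Gamma$ (equivalently, the three faces meet along $\Gamma$ at pairwise angles $120^\circ$). ''$u(YC)$ meets $\partial\mathbb{B}^n$ orthogonally'' (free boundary condition): $u_j(\sigma)\subset\mathbb{S}^{n-1}$ for $j=1,2,3$, and each surface $u_j(\hat D)$ meets $\mathbb{S}^{n-1}$ orthogonally along $u_j(\sigma)$, i.e. its outward unit conormal along $u_j(\sigma)$ is normal to $\mathbb{S}^{n-1}$. *)

(* Defs.v *)
From mathcomp Require Import all_boot all_order all_algebra.
From mathcomp Require Import all_classical all_reals all_analysis.

Set Implicit Arguments.
Unset Strict Implicit.
Unset Printing Implicit Defensive.
Import Order.TTheory GRing.Theory Num.Theory.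
Import numFieldNormedType.Exports.
Local Open Scope classical_set_scope.
Local Open Scope ring_scope.

(* The norm `|x| that MathComp-Analysis puts on 'rV[R]_n is the sup norm, so
   the Euclidean structure is introduced separately.  Both norms induce the
   same topology and the same derivatives. *)
Definition dot (R : realType) (n : nat) (v w : 'rV[R]_n) : R :=
  \sum_(i < n) v 0 i * w 0 i.

Definition enorm (R : realType) (n : nat) (v : 'rV[R]_n) : R :=
  Num.sqrt (dot v v).

Definition closed_unit_ball (R : realType) (n : nat) : set 'rV[R]_n :=
  [set x | enorm x <= 1].

Definition unit_sphere (R : realType) (n : nat) : set 'rV[R]_n :=
  [set x | enorm x = 1].

Arguments closed_unit_ball {R n}.
Arguments unit_sphere {R n}.

(* Points of the parameter plane are p : 'rV[R]_2, with x = p 0 0 and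
   y = p 0 1. *)
Definition row2 (R : realType) (x y : R) : 'rV[R]_2 :=
  \row_(i < 2) (if i == 0 then x else y).

Definition half_disk (R : realType) : set 'rV[R]_2 :=
  [set p | p 0 0 ^+ 2 + p 0 1 ^+ 2 <= 1 /\ 0 <= p 0 0].

Definition diameter (R : realType) : set 'rV[R]_2 :=
  [set p | p 0 0 = 0 /\ -1 <= p 0 1 <= 1].

Definition half_circle (R : realType) : set 'rV[R]_2 :=
  [set p | p 0 0 ^+ 2 + p 0 1 ^+ 2 = 1 /\ 0 <= p 0 0].

Arguments half_disk {R}.
Arguments diameter {R}.
Arguments half_circle {R}.

(* The point (x, y, 0) rotated by theta about the y-axis of R^3, with R^3
   embedded in R^n as the first three coordinates (for n >= 3). *)
Definition rotated_face (R : realType) (n : nat) (theta : R) (p : 'rV[R]_2) :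
    'rV[R]_n :=
  \row_(i < n) [:: p 0 0 * cos theta; p 0 1; p 0 0 * sin theta]`_i.

Definition flat_Ycone (R : realType) (n : nat) : set 'rV[R]_n :=
  rotated_face n 0 @` half_disk
  `|` rotated_face n (2 * pi / 3) @` half_disk
  `|` rotated_face n (- (2 * pi / 3)) @` half_disk.

Arguments flat_Ycone : clear implicits.

(* On an open set U this is C^oo: all iterated directional derivatives exist
   and are differentiable on U. *)
Definition smooth_on (R : realType) (m n : nat) (U : set 'rV[R]_m)
    (f : 'rV[R]_m -> 'rV[R]_n) : Prop :=
  forall (vs : seq 'rV[R]_m) (p : 'rV[R]_m), U p ->
    differentiable (foldr (fun v g => 'D_v g) f vs) p.

(* Smooth up to the boundary on a closed set D: smooth on a neighbourhood of D.
   A map on the half-disk is represented by a total function; its values off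
   the half-disk play no role, because the half-disk is the closure of its
   interior, so that the derivatives at its points, boundary and corners
   included, are determined by the values on it. *)
Definition smooth_upto_boundary (R : realType) (m n : nat) (D : set 'rV[R]_m)
    (f : 'rV[R]_m -> 'rV[R]_n) : Prop :=
  exists U : set 'rV[R]_m, [/\ open U, D `<=` U & smooth_on U f].

Section Surface.
Context (R : realType) (n : nat).
Implicit Types (f : 'rV[R]_2 -> 'rV[R]_n) (p t nu : 'rV[R]_2).

Definition immersive_at f p : Prop := injective ('d f p).

(* The pullback of the Euclidean metric is a positive multiple of the flat
   metric. *)
Definition conformal_at f p : Prop :=
  exists2 lambda : R, 0 < lambda &
    forall v w : 'rV[R]_2,
      dot ('d f p v) ('d f p w) = lambda ^+ 2 * dot v w.

Definition basis_vec (a : 'I_2) : 'rV[R]_2 := delta_mx 0 a.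

Definition first_fundamental_form f p : 'M[R]_2 :=
  \matrix_(a, b) dot ('d f p (basis_vec a)) ('d f p (basis_vec b)).

(* v minus its orthogonal projection g^{ab} <v, d_a f> d_b f to the tangent
   plane. *)
Definition normal_part f p (v : 'rV[R]_n) : 'rV[R]_n :=
  v - \sum_(a < 2) \sum_(b < 2)
        (invmx (first_fundamental_form f p) a b * dot v ('d f p (basis_vec a)))
          *: 'd f p (basis_vec b).

Definition second_fundamental_form f p (a b : 'I_2) : 'rV[R]_n :=
  normal_part f p ('D_(basis_vec a) ('D_(basis_vec b) f) p).

Definition mean_curvature_vector f p : 'rV[R]_n :=
  \sum_(a < 2) \sum_(b < 2)
    invmx (first_fundamental_form f p) a b *: second_fundamental_form f p a b.

Definition minimal_immersion_on (D : set 'rV[R]_2) f : Prop :=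
  smooth_upto_boundary D f /\
  forall p, D p -> immersive_at f p /\ mean_curvature_vector f p = 0.

(* eta is the outward unit conormal of the surface f at the image of a boundary
   point p of the parameter domain, where t is tangent to the boundary at p and
   nu is its outward normal: eta is a unit vector, tangent to the surface,
   orthogonal to the image of the boundary, and the image of an outward pointing
   vector.  For an immersion, eta exists and is unique. *)
Definition outward_unit_conormal f p t nu (eta : 'rV[R]_n) : Prop :=
  [/\ enorm eta = 1,
      dot eta ('d f p t) = 0
    & exists2 w : 'rV[R]_2, 0 < dot w nu & eta = 'd f p w].

Definition diameter_conormal f p : 'rV[R]_n -> Prop :=
  outward_unit_conormal f p (row2 0 1) (row2 (-1) 0).

Definition half_circle_conormal f p : 'rV[R]_n -> Prop :=
  outward_unit_conormal f p (row2 (- p 0 1) (p 0 0)) p.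

(* The tangent space of the unit sphere at x is the orthogonal complement
   of x. *)
Definition normal_to_sphere_at (x eta : 'rV[R]_n) : Prop :=
  forall v : 'rV[R]_n, dot v x = 0 -> dot v eta = 0.

End Surface.

(* A map on the Y-cone is a triple of maps on the half-disk, one for each
   face. *)
Section Ymaps.
Context (R : realType) (n : nat).
Implicit Types u : 'I_3 -> 'rV[R]_2 -> 'rV[R]_n.

Definition agree_on_diameter u : Prop :=
  forall (j k : 'I_3) (p : 'rV[R]_2), diameter p -> u j p = u k p.

Definition conformal_Ymap u : Prop :=
  (forall (j : 'I_3) (p : 'rV[R]_2), half_disk p -> conformal_at (u j) p) /\
  agree_on_diameter u.

Definition minimal_immersion_Ymap u : Prop :=
  [/\ forall j : 'I_3, minimal_immersion_on half_disk (u j),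
      agree_on_diameter u
    & forall (p : 'rV[R]_2) (tau : 'I_3 -> 'rV[R]_n), diameter p ->
        (forall j, diameter_conormal (u j) p (tau j)) ->
        \sum_(j < 3) tau j = 0].

Definition maps_into u (B : set 'rV[R]_n) : Prop :=
  forall (j : 'I_3) (p : 'rV[R]_2), half_disk p -> B (u j p).

Definition meets_sphere_orthogonally u : Prop :=
  forall (j : 'I_3) (p : 'rV[R]_2), half_circle p ->
    unit_sphere (u j p) /\
    forall eta : 'rV[R]_n, half_circle_conormal (u j) p eta ->
      normal_to_sphere_at (u j p) eta.

Definition Yimage u : set 'rV[R]_n :=
  \bigcup_(j : 'I_3) (u j @` half_disk).

End Ymaps.

(* A distance-preserving self-map of R^n is automatically a bijective rigid
   motion. *)
Definition congruent (R : realType) (n : nat) (A B : set 'rV[R]_n) : Prop :=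
  exists2 Phi : 'rV[R]_n -> 'rV[R]_n,
    forall x y, enorm (Phi x - Phi y) = enorm (x - y) & Phi @` A = B.

(* Main.v *)
From HB Require Import structures.
Require Import Defs.
From mathcomp Require Import all_boot all_order all_algebra.
From mathcomp Require Import all_classical all_reals all_analysis.
From mathcomp Require Import complex ring lra.

(* For a face u with coordinates z = x + i y, put Y = u_x - i u_y.  Minimality and
   conformality make u harmonic, so Y is a holomorphic vector with Y.Y = 0.  On
   the arc the free boundary condition reads u_r = m u; differentiating it along
   the arc shows that z^2 Y' is a multiple of z Y = u_r - i u_t plus a real vector
   N, the normal part of u_rr, whence z^4 Y'.Y' = |N|^2 >= 0.  On the diameter the
   balancing of the conormals says that the u_x of the three faces add up to zero,
   and it makes the sum over the faces of the quartic differentials z^4 Y'.Y'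
   real.  This sum is therefore constant, and zero because it vanishes at the
   center; hence N = 0 on the arc, where Y and Y' are parallel.  A holomorphic
   function on the half-disk which vanishes on the arc is zero, so Y' is everywhere
   a multiple of Y: the direction of Y is constant, and u takes its values in a
   plane through 0, in which it is a holomorphic function f.

   The three planes contain the image of the diameter and meet pairwise in a
   line only, so f is purely imaginary on the diameter.  If f(0) = i a, the
   function (f - i a)(1 + i a f) / (z f') is real on the whole boundary, hence
   constant; integrating this differential equation gives
   f = (z + i a) / (1 - i a z), which maps the half-disk onto itself. *)

Set Implicit Arguments.
Unset Strict Implicit.
Unset Printing Implicit Defensive.
Import Order.TTheory GRing.Theory Num.Theory.
Import numFieldNormedType.Exports.
Local Open Scope classical_set_scope.
Local Open Scope ring_scope.

(** * Derivatives along lines *)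

(** Every rigidity statement comes from one maximum principle on the closed half-disk: a holomorphic
    function that is real on the whole boundary is real inside, hence has zero derivative. The
    difficulty is to find functions that are real on arc and diameter at once. For a single face the
    quartic differential need not be real on the diameter, because [u_xy] is not controlled there.
    The sum over the faces is, since [u_xx = - u_yy] is common to them and the [u_xy] add up to
    zero; and the sum is enough because on the arc each summand is nonnegative, so that nothing can
    cancel. The factor [z^4] yields both the reality on the arc and the zero at the center.

    The half-disk has a one-parameter family of conformal automorphisms fixing its corners, and [a]
    is that parameter. The quotient [(f - i a)(1 + i a f) / (z f')] compares the vector field
    [z d/dz] with the pullback by [f] of [(w - i a)(1 + i a w) d/dw]: both are normal to the arc and
    tangent to the diameter, which makes it real on the boundary. *)

Section Lines.
Context (R : realType) (V : normedModType R).
Implicit Types (g : V -> R) (p v : V).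

(** The two difference quotients are the same function of the increment; this is the passage from
    directional derivatives to one-variable calculus. *)
Lemma is_derive_line g p v (t d : R) :
  is_derive (t *: v + p) v g d -> is_derive t 1 (fun s => g (s *: v + p)) d.
Proof.
suff E : (fun h : R => h^-1 *: (((fun s => g (s *: v + p)) \o shift t) (h *: 1)
            - g (t *: v + p)))
       = (fun h : R => h^-1 *: ((g \o shift (t *: v + p)) (h *: v)
            - g (t *: v + p))).
  move=> [gd <-]; apply: DeriveDef.
    by move: gd; rewrite /derivable -E.
  by rewrite /derive -E.
apply/funext => h /=; congr (_ *: (g _ - _)).
by rewrite scalerDl addrA [h *: 1]mulr1.
Qed.

Lemma continuous_line p v (t : R) : {for t, continuous (fun s : R => s *: v + p)}.
Proof. by apply: cvgD; [apply: cvgZr_tmp; exact: cvg_id | exact: cvg_cst]. Qed.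

Lemma MVT_line g g' p v (a b : R) : a < b ->
  (forall s, a < s < b -> is_derive (s *: v + p) v g (g' (s *: v + p))) ->
  (forall s, a <= s <= b -> {for s *: v + p, continuous g}) ->
  exists2 c, a < c < b &
    g (b *: v + p) - g (a *: v + p) = g' (c *: v + p) * (b - a).
Proof.
move=> ab dg cg.
have [||c cab E] := @MVT R (fun s => g (s *: v + p)) (fun s => g' (s *: v + p)) a b ab.
- by move=> s; rewrite in_itv /= => sab; apply: is_derive_line; exact: dg.
- apply: continuous_in_subspaceT => s; rewrite inE /= in_itv /= => sab.
  apply: (@continuous_comp _ _ _ (fun s : R => s *: v + p) g).
    exact: continuous_line.
  exact: cg.
by exists c => //; move: cab; rewrite in_itv.
Qed.

Lemma nbhs_line p v (P : set V) : nbhs p P ->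
  exists2 r : R, 0 < r & forall s, `|s| < r -> P (s *: v + p).
Proof.
move=> nP.
have : \forall s \near (0 : R), P (s *: v + p).
  have E0 : 0 *: v + p = p by rewrite scale0r add0r.
  have := @continuous_line p v 0; rewrite /prop_for /continuous_at E0 => /(_ P nP).
  exact.
move=> /nbhs_ballP[r /= r0 br]; exists r => // s sr; apply: br.
by rewrite /ball /= sub0r normrN.
Qed.

(** If [L > 0], then [g'], which vanishes at [p] as at any extremum, is positive just after [p], and
    the mean value theorem makes [g] exceed [g p] there. *)
Lemma second_derivative_local_max g g' p v L :
  (\forall q \near p, is_derive q v g (g' q)) ->
  (\forall q \near p, {for q, continuous g}) ->
  (\forall q \near p, g q <= g p) ->
  is_derive p v g' L -> L <= 0.
Proof.
move=> dg cg mg dg'; rewrite leNgt; apply/negP => L0.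
have [r r0 near_r] : exists2 r : R, 0 < r & forall s, `|s| < r ->
    [/\ is_derive (s *: v + p) v g (g' (s *: v + p)),
        {for s *: v + p, continuous g} & g (s *: v + p) <= g p].
  apply: (@nbhs_line p v (fun q => [/\ is_derive q v g (g' q),
      {for q, continuous g} & g q <= g p])).
  by near=> q; split; near: q.
have g'p0 : g' p = 0.
  have r2 : - (r / 2) < r / 2 by lra.
  have d0 : is_derive (0 : R) 1 (fun s => g (s *: v + p)) 0.
    apply: (@derive1_at_max _ _ (- (r / 2)) (r / 2)); first exact: ltW.
    - move=> t; rewrite in_itv /= => /andP[t1 t2].
      have tr : `|t| < r by rewrite ltr_norml; apply/andP; split; lra.
      have [dt _ _] := near_r t tr.
      by have [] := is_derive_line dt.
    - by rewrite in_itv /=; apply/andP; split; lra.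
    - move=> t; rewrite in_itv /= => /andP[t1 t2].
      have tr : `|t| < r by rewrite ltr_norml; apply/andP; split; lra.
      by have [_ _] := near_r t tr; rewrite scale0r add0r.
  have [dp _ _] := near_r 0 ltac:(by rewrite normr0).
  have := is_derive_line dp; rewrite scale0r add0r => -[_ <-].
  by case: d0.
have [r' r'0 pos] : exists2 r' : R, 0 < r' &
    forall s, 0 < s < r' -> 0 < g' (s *: v + p).
  have [/derivable1P /derivable1_diffP dg0 _] := dg'.
  have := dg'; rewrite -[p in is_derive p]add0r -[X in is_derive (X + _)](scale0r v).
  move=> /is_derive_line[cvgL L_].
  have {}cvgL : (fun h : R => h^-1 *: (g' (h *: v + p) - 0)) @ 0^' --> L.
    rewrite -L_ /derive.
    rewrite [X in X @ _ --> _](_ : _ =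
      (fun h : R => h^-1 *: (((fun s => g' (s *: v + p)) \o shift 0) (h *: 1)
        - g' (0 *: v + p)))); first exact: cvgL.
    by apply/funext => h /=; rewrite scale0r add0r g'p0 addr0 [h *: 1]mulr1.
  have /cvgrPdist_lt /(_ _ L0) := cvgL.
  move=> /nbhs_ballP[r' /= r'0 br']; exists r' => // s /andP[s0 sr'].
  have := br' s; rewrite /ball /= sub0r normrN (gtr0_norm s0) => /(_ sr' (lt0r_neq0 s0)).
  rewrite subr0 => H.
  have : 0 < s^-1 *: g' (s *: v + p).
    by move: H; rewrite ltr_norml => /andP[_]; lra.
  by rewrite /GRing.scale /= pmulr_rgt0 // invr_gt0.
pose b := Num.min r r' / 2.
have b0 : 0 < b by rewrite divr_gt0 // lt_min r0.
have bm : b < Num.min r r' by rewrite /b ltr_pdivrMr // ltr_pMr ?ltr1n // lt_min r0.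
move: bm; rewrite lt_min => /andP[br br'].
have [||c /andP[c0 cb]] := @MVT_line g g' p v 0 b b0.
- move=> s /andP[s0 sb].
  by have [] := near_r s ltac:(rewrite ger0_norm; lra).
- move=> s /andP[s0 sb].
  by have [] := near_r s ltac:(rewrite ger0_norm; lra).
rewrite scale0r add0r subr0 => E.
have [_ _] := near_r b ltac:(rewrite gtr0_norm //).
apply/negP; rewrite -ltNge -subr_gt0 E mulr_gt0 //; apply: pos.
by rewrite c0 (lt_trans cb).
Unshelve. all: by end_near.
Qed.

Lemma near_neq0 p : p != 0 -> \forall q \near p, q != 0.
Proof. by move=> p0; apply: (@cvgr_neq0 _ _ _ _ _ id p) => //; exact: cvg_id. Qed.

Lemma continuous_at_dist g p l : g p = l ->
  (forall e : R, 0 < e -> \forall q \near p, `|g q - l| <= e) ->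
  {for p, continuous g}.
Proof.
move=> gp H; suff : g @ p --> g p by [].
apply/cvgrPdist_le => e e0; rewrite gp; near=> q; rewrite distrC.
by near: q; exact: H.
Unshelve. all: by end_near.
Qed.

(** * Symmetry of mixed second derivatives *)

Section Schwarz.
Context (f fv : V -> R) (p v w : V).

(** The mean value theorem along [v], applied to [q |-> f (q + h w) - f q], turns the second
    difference into [h] times a first difference of [fv], which differentiability of [fv] at the
    single point [p] controls. The limit is one-sided because it is only compared with another one
    of the same kind. *)
Lemma second_difference :
  (\forall q \near p, differentiable f q) ->
  (\forall q \near p, is_derive q v f (fv q)) ->
  differentiable fv p ->
  (fun h : R => h^-2 * (f (h *: (v + w) + p) - f (h *: v + p) - f (h *: w + p) + f p))
    @ 0^'+ --> 'D_w fv p.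
Proof.
move=> df dfv dg.
set g := fv.
set L := 'D_w g p.
have Lin q : 'd g p q = 'D_q g p by rewrite deriveE.
apply/cvgrPdist_le => e e0.
(* The two errors are bounded through [|h v + h w| + |h v| <= h (2 |v| + |w|) <= h K]; the summand 1
   makes [K] positive. *)
pose K := 2 * `|v| + `|w| + 1.
have K0 : 0 < K by rewrite /K; have := normr_ge0 v; have := normr_ge0 w; lra.
have eK : 0 < e / K by rewrite divr_gt0.
have [r1 r10 small] : exists2 r : R, 0 < r & forall q : V, `|q| < r ->
    [/\ differentiable f (q + p), is_derive (q + p) v f (g (q + p)) &
        `|g (q + p) - g p - 'd g p q| <= e / K * `|q|].
  have := diff_locally dg => /eqaddoP /(_ _ eK) H.
  have H2 : \forall q \near (0 : V), differentiable f (q + p).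
    by move: df; rewrite (near_shift 0 p) subr0.
  have H3 : \forall q \near (0 : V), is_derive (q + p) v f (g (q + p)).
    by move: dfv; rewrite (near_shift 0 p) subr0.
  have : \forall q \near (0 : V), [/\ differentiable f (q + p),
        is_derive (q + p) v f (g (q + p)) &
        `|g (q + p) - g p - 'd g p q| <= e / K * `|q|].
    near=> q; split; [by near: q|by near: q|].
    have -> : g (q + p) - g p - 'd g p q = (g \o shift p - (cst (g p) + 'd g p)) q.
      by rewrite /= !fctE /= opprD addrA.
    by near: q.
  move=> /nbhs_normP[r /= r0 br]; exists r => // q qr; apply: br.
  by rewrite /= sub0r normrN.
pose r := r1 / K.
have r0 : 0 < r by rewrite divr_gt0.
near=> h.
have h0 : 0 < h by near: h; exact: nbhs_right_gt.
have hr : h < r by near: h; exact: nbhs_right_lt.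
have hK : h * K < r1 by rewrite -ltr_pdivlMr.
have bnd s : 0 <= s <= h -> `|s *: v| <= h * `|v|.
  by move=> /andP[s0 sh]; rewrite normrZ ger0_norm // ler_wpM2r.
have bndw : `|h *: w| = h * `|w| by rewrite normrZ gtr0_norm.
have hKE : h * K = 2 * (h * `|v|) + h * `|w| + h by rewrite /K; ring.
have hv0 : 0 <= h * `|v| by rewrite mulr_ge0 ?normr_ge0 // ltW.
have hw0 : 0 <= h * `|w| by rewrite mulr_ge0 ?normr_ge0 // ltW.
have s1 s : 0 <= s <= h -> `|s *: v| < r1.
  by move=> sh; have := bnd s sh; lra.
have s2 s : 0 <= s <= h -> `|s *: v + h *: w| < r1.
  move=> sh; apply: le_lt_trans (ler_normD _ _) _; rewrite bndw.
  by have := bnd s sh; lra.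
pose F q := f (q + h *: w) - f q.
pose G q := g (q + h *: w) - g q.
have dF s : 0 <= s <= h -> is_derive (s *: v + p) v F (G (s *: v + p)) /\
     {for s *: v + p, continuous F}.
  move=> sh; have [d1 g1 _] := small _ (s1 s sh); have [d2 g2 _] := small _ (s2 s sh).
  have d2' : differentiable f (s *: v + p + h *: w).
    by rewrite addrAC.
  have d2'' : differentiable (fun q => f (q + h *: w)) (s *: v + p).
    by apply: (@differentiable_comp _ _ _ _ (fun q => q + h *: w) f).
  have dd : differentiable F (s *: v + p) by exact: differentiableB.
  split; last exact: differentiable_continuous.
  apply: DeriveDef; first exact: diff_derivable.
  rewrite deriveB; [|exact: diff_derivable|exact: diff_derivable].
  rewrite /G; congr (_ - _); last by case: g1.
  rewrite addrAC; case: g2 => _ <-.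
  rewrite /derive; apply: (congr1 (fun k : R -> R => lim (k @ 0^'))); apply/funext => t /=.
  have E : s *: v + p + h *: w = s *: v + h *: w + p by rewrite addrAC.
  by rewrite -[t *: v + _ + h *: w]addrA E.
have [||c /andP[c0 ch]] := @MVT_line F G p v 0 h h0.
- by move=> s /andP[sa sb]; have [] := dF s ltac:(by rewrite !ltW).
- by move=> s /andP[sa sb]; have [] := dF s ltac:(by rewrite sa sb).
rewrite scale0r add0r subr0 => E.
have -> : f (h *: (v + w) + p) - f (h *: v + p) - f (h *: w + p) + f p = G (c *: v + p) * h.
  rewrite -E /F scalerDr -!addrA [p + _]addrC; ring.
have ch' : 0 <= c <= h by rewrite !ltW.
have [_ _ e1] := small _ (s1 c ch'); have [_ _ e2] := small _ (s2 c ch').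
have GE : `|G (c *: v + p) - h * L| <= e * h.
  have -> : G (c *: v + p) - h * L =
     (g (c *: v + h *: w + p) - g p - 'd g p (c *: v + h *: w)) -
     (g (c *: v + p) - g p - 'd g p (c *: v)).
    have -> : L = 'd g p w by rewrite Lin.
    rewrite linearD !linearZ /=.
    rewrite /G [c *: v + p + _]addrAC /GRing.scale /=; ring.
  apply: le_trans (ler_normB _ _) _.
  have n2 : `|c *: v + h *: w| <= h * `|v| + h * `|w|.
    by apply: le_trans (ler_normD _ _) _; rewrite bndw lerD2r; exact: bnd.
  have n1 := bnd c ch'.
  apply: (@le_trans _ _ (e / K * (h * `|v| + h * `|w|) + e / K * (h * `|v|))).
    apply: lerD; first by apply: le_trans e2 _; rewrite ler_pM2l.
    by apply: le_trans e1 _; rewrite ler_pM2l.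
  rewrite -mulrDr -[leRHS](divfK (lt0r_neq0 K0)) [e * h / K]mulrAC -[leRHS]mulrA ler_pM2l //.
  by rewrite [h * K]hKE; lra.
have -> : L - h^-2 * (G (c *: v + p) * h) = - (h^-1 * (G (c *: v + p) - h * L)).
  by have := lt0r_neq0 h0 => ?; field.
rewrite normrN normrM gtr0_norm ?invr_gt0 // ler_pdivrMl //.
by rewrite [h * e]mulrC.
Unshelve. all: by end_near.
Qed.
End Schwarz.

(** The second difference is symmetric in [v] and [w], so both mixed derivatives are its limit. *)
Lemma derive_comm (f fv fw : V -> R) p v w d d' :
  (\forall q \near p, differentiable f q) ->
  (\forall q \near p, is_derive q v f (fv q)) ->
  (\forall q \near p, is_derive q w f (fw q)) ->
  differentiable fv p -> differentiable fw p ->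
  is_derive p w fv d -> is_derive p v fw d' -> d = d'.
Proof.
move=> df dv dw dfv dfw [_ <-] [_ <-].
have c1 := @second_difference f fv p v w df dv dfv.
have c2 : (fun h : R => h^-2 * (f (h *: (v + w) + p) - f (h *: v + p) - f (h *: w + p) + f p))
    @ 0^'+ --> 'D_v fw p.
  have := @second_difference f fw p w v df dw dfw.
  rewrite (_ : (fun h : R => _) = (fun h : R => h^-2 *
     (f (h *: (v + w) + p) - f (h *: v + p) - f (h *: w + p) + f p))) //.
  by apply/funext => h; rewrite [w + v]addrC; congr (_ * (_ + _)); rewrite addrAC.
by rewrite -(cvg_lim (@Rhausdorff R) c1); apply: (cvg_lim (@Rhausdorff R)).
Qed.

(** Agreement is asked on a segment only, which suits functions that coincide along the diameter but
    not around it. *)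
Lemma is_derive_unique_line g h p v d d' :
  is_derive p v g d -> is_derive p v h d' ->
  (\forall s \near (0 : R), g (s *: v + p) = h (s *: v + p)) -> d = d'.
Proof.
move=> dg dh gh.
have E0 : 0 *: v + p = p by rewrite scale0r add0r.
have dg' : is_derive (0 *: v + p) v g d by rewrite E0.
have dh' : is_derive (0 *: v + p) v h d' by rewrite E0.
have [_ <-] := near_eq_is_derive gh (is_derive_line dg').
by have [_ <-] := is_derive_line dh'.
Qed.

End Lines.

(** * Holomorphic functions on the half-disk *)

Lemma is_derive_coord (R : realType) (V : normedModType R) m n
    (f : V -> 'M[R]_(m, n)) p v d i j :
  is_derive p v f d -> is_derive p v (fun q => f q i j) (d i j).
Proof.
move=> [fd <-]; apply: DeriveDef; first exact: (derivable_mxP _ _ _).1.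
by rewrite derive_mx // mxE.
Qed.

Section HalfDisk.
Context (R : realType).
Local Notation pt := 'rV[R]_2.
Implicit Types (p q : pt).

Lemma row2K p : row2 (p 0 0) (p 0 1) = p.
Proof.
apply/rowP => i; rewrite mxE.
by case: i => [[|[|//]] Hi]; congr (p 0 _); apply/val_inj.
Qed.

Lemma row2E0 (x y : R) : row2 x y 0 0 = x. Proof. by rewrite mxE. Qed.
Lemma row2E1 (x y : R) : row2 x y 0 1 = y. Proof. by rewrite mxE. Qed.

Lemma basis_vec0E : basis_vec R 0 = row2 1 0.
Proof.
by apply/rowP => -[[|[|//]] Hi]; rewrite !mxE.
Qed.

Lemma basis_vec1E : basis_vec R 1 = row2 0 1.
Proof.
by apply/rowP => -[[|[|//]] Hi]; rewrite !mxE.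
Qed.

Lemma row2_basisE (x y : R) : row2 x y = x *: basis_vec R 0 + y *: basis_vec R 1.
Proof.
rewrite basis_vec0E basis_vec1E.
by apply/rowP => -[[|[|//]] Hi]; rewrite !mxE /=; ring.
Qed.

Definition open_half_disk : set pt :=
  [set p | p 0 0 ^+ 2 + p 0 1 ^+ 2 < 1 /\ 0 < p 0 0].

Lemma sqnorm_continuous : continuous (fun p : pt => p 0 0 ^+ 2 + p 0 1 ^+ 2).
Proof.
move=> p; apply: (@continuousD _ _ _ (fun p : pt => p 0 0 ^+ 2) (fun p : pt => p 0 1 ^+ 2)).
  by apply: continuousM; exact: coord_continuous.
by apply: continuousM; exact: coord_continuous.
Qed.

Lemma open_half_disk_open : open open_half_disk.
Proof.
rewrite (_ : open_half_disk =
  (fun p : pt => p 0 0 ^+ 2 + p 0 1 ^+ 2) @^-1` [set x | x < 1] `&`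
  (fun p : pt => p 0 0) @^-1` [set x | 0 < x]) //.
apply: openI.
  by apply: open_comp => [p _|]; [exact: sqnorm_continuous|exact: open_lt].
by apply: open_comp => [p _|]; [exact: coord_continuous|exact: open_gt].
Qed.

Lemma open_half_disk_sub : open_half_disk `<=` half_disk.
Proof. by move=> p [p1 p0]; split; exact: ltW. Qed.

Lemma half_disk_compact : compact (@half_disk R).
Proof.
apply: bounded_closed_compact.
  exists 1; split; first exact: num_real.
  move=> M M1 p [pn px].
  have x2 : p 0 0 ^+ 2 <= 1 by have := sqr_ge0 (p 0 1); lra.
  have y2 : p 0 1 ^+ 2 <= 1 by have := sqr_ge0 (p 0 0); lra.
  rewrite /Num.norm/= mx_normrE; apply: bigmax_le => [|[i j] _ /=]; first lra.
  apply: (@le_trans _ _ 1); last exact: ltW.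
  rewrite -(@expr_le1 _ 2) // real_normK ?num_real //.
  rewrite (ord1 i); case: j => [[|[|//]] Hj].
    by rewrite (_ : Ordinal Hj = 0) //; exact: val_inj.
  by rewrite (_ : Ordinal Hj = 1) //; exact: val_inj.
rewrite (_ : half_disk =
  (fun p : pt => p 0 0 ^+ 2 + p 0 1 ^+ 2) @^-1` [set x | x <= 1] `&`
  (fun p : pt => p 0 0) @^-1` [set x | 0 <= x]) //.
apply: closedI.
  by apply: closed_comp => [p _|]; [exact: sqnorm_continuous|exact: closed_le].
by apply: closed_comp => [p _|]; [exact: coord_continuous|exact: closed_ge].
Qed.

Lemma is_derive_coordE p v j : is_derive p v (fun q : pt => q 0 j) (v 0 j).
Proof. exact: is_derive_coord. Qed.

(** Adding [e |p|^2] to [h] makes the Laplacian [4 e > 0], which is incompatible with an interior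
    maximum, where both pure second derivatives are at most 0. *)
Lemma max_principle (h hx hy hxx hyy : pt -> R) (M : R) :
  (forall p, half_disk p -> {for p, continuous h}) ->
  (forall p, open_half_disk p ->
    [/\ is_derive p (basis_vec R 0) h (hx p),
        is_derive p (basis_vec R 1) h (hy p),
        is_derive p (basis_vec R 0) hx (hxx p),
        is_derive p (basis_vec R 1) hy (hyy p) & hxx p + hyy p = 0]) ->
  (forall p, half_disk p -> ~ open_half_disk p -> h p <= M) ->
  forall p, half_disk p -> h p <= M.
Proof.
move=> ch dh bh p0 Dp0; rewrite leNgt; apply/negP => Mh.
(* As [|p| <= 1], with this [e] the perturbed function is at most [M + e < h p0] on the boundary, so
   its maximum is interior. *)
pose e := (h p0 - M) / 2.
have e0 : 0 < e by rewrite /e; lra.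
pose N p : R := p 0 0 ^+ 2 + p 0 1 ^+ 2.
pose g p := h p + e * N p.
have cg p : half_disk p -> {for p, continuous g}.
  move=> Dp; apply: (@continuousD _ _ _ h (fun p => e * N p)); first exact: ch.
  by apply: continuousM; [exact: cst_continuous|exact: sqnorm_continuous].
have [||| q] := @compact_EVT_max _ R g half_disk.
- by exists p0.
- exact: half_disk_compact.
- by apply: continuous_in_subspaceT => p; rewrite inE; exact: cg.
rewrite inE => Dq maxq.
have N0 p : 0 <= N p by rewrite addr_ge0 // sqr_ge0.
have gq : g p0 <= g q by apply: maxq; rewrite inE.
have oq : open_half_disk q.
  apply: contrapT => nq; have := bh _ Dq nq => hq.
  move: gq; rewrite /g.
  have : e * N q <= e by rewrite ler_piMr //; [exact: ltW | case: Dq].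
  have : 0 <= e * N p0 by rewrite mulr_ge0 // ltW.
  rewrite /e; lra.
have nq : \forall p \near q, open_half_disk p.
  by apply: open_nbhs_nbhs; split => //; exact: open_half_disk_open.
have maxn : \forall p \near q, g p <= g q.
  by apply: filterS nq => p op; apply: maxq; rewrite inE; exact: open_half_disk_sub.
have cn : \forall p \near q, {for p, continuous g}.
  by apply: filterS nq => p op; apply: cg; exact: open_half_disk_sub.
have dN p i : is_derive p (basis_vec R i) N (2 * p 0 i).
  have d0 := is_derive_coordE p (basis_vec R i) 0.
  have d1 := is_derive_coordE p (basis_vec R i) 1.
  have := is_deriveD (is_deriveX 2 d0) (is_deriveX 2 d1).
  move=> H; apply: is_derive_eq H _.
  rewrite /GRing.scale /= !mxE /=.
  case: i {d0 d1} => [[|[|//]] Hi] /=.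
    by rewrite (_ : Ordinal Hi = 0); [ring|exact: val_inj].
  by rewrite (_ : Ordinal Hi = 1); [ring|exact: val_inj].
have dgi i (hi : pt -> R) p : is_derive p (basis_vec R i) h (hi p) ->
    is_derive p (basis_vec R i) g (hi p + e * (2 * p 0 i)).
  by move=> H; apply: is_deriveD; exact: (is_deriveZ e (dN p i)).
have ddg i (hi : pt -> R) p d : is_derive p (basis_vec R i) hi d ->
    is_derive p (basis_vec R i) (fun q : pt => hi q + e * (2 * q 0 i)) (d + e * 2).
  move=> H; have H2 := is_deriveZ (e * 2) (is_derive_coordE p (basis_vec R i) i).
  have := is_deriveD H H2; rewrite mxE eqxx /= eqxx /GRing.scale /= mulr1.
  congr is_derive; apply/funext => q' /=; rewrite mulrA //.
have [_ _ d3 d4 E] := dh q oq.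
have c1 : hxx q + e * 2 <= 0.
  apply: (@second_derivative_local_max _ _ g _ q (basis_vec R 0) _ _ cn maxn (ddg _ _ _ _ d3)).
  by apply: filterS nq => p op; apply: dgi; have [] := dh p op.
have c2 : hyy q + e * 2 <= 0.
  apply: (@second_derivative_local_max _ _ g _ q (basis_vec R 1) _ _ cn maxn (ddg _ _ _ _ d4)).
  by apply: filterS nq => p op; apply: dgi; have [] := dh p op.
lra.
Qed.

End HalfDisk.
Arguments open_half_disk {R}.

Section Holomorphic.
Context (R : realType).
Local Notation pt := 'rV[R]_2.
Local Notation C := R[i].
Local Notation re := (@complex.Re R).
Local Notation im := (@complex.Im R).
Implicit Types (p q : pt) (F G : pt -> C).

(** The Cauchy-Riemann equations are built in: the partial derivative in [x] is [d] and the one in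
    [y] is [i d]. Partial derivatives along the axes match the hypotheses of the maximum
    principle. *)
Definition cderiv F p (d : C) : Prop :=
  [/\ is_derive p (basis_vec R 0) (fun q => re (F q)) (re d),
      is_derive p (basis_vec R 0) (fun q => im (F q)) (im d),
      is_derive p (basis_vec R 1) (fun q => re (F q)) (- im d)
    & is_derive p (basis_vec R 1) (fun q => im (F q)) (re d)].

Definition ccont F p : Prop :=
  {for p, continuous (fun q => re (F q))} /\
  {for p, continuous (fun q => im (F q))}.

Definition zcoord p : C := Complex (p 0 0) (p 0 1).

Lemma reM (z w : C) : re (z * w) = re z * re w - im z * im w.
Proof. by case: z w => [a b] [c d]. Qed.

Lemma imM (z w : C) : im (z * w) = re z * im w + im z * re w.
Proof. by case: z w => [a b] [c d]. Qed.

Lemma reD (z w : C) : re (z + w) = re z + re w.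
Proof. by case: z w => [a b] [c d]. Qed.

Lemma imD (z w : C) : im (z + w) = im z + im w.
Proof. by case: z w => [a b] [c d]. Qed.

Lemma reN (z : C) : re (- z) = - re z. Proof. by case: z. Qed.
Lemma imN (z : C) : im (- z) = - im z. Proof. by case: z. Qed.

Lemma reV (z : C) : re z^-1 = re z / (re z ^+ 2 + im z ^+ 2).
Proof. by case: z. Qed.

Lemma imV (z : C) : im z^-1 = - (im z / (re z ^+ 2 + im z ^+ 2)).
Proof. by case: z. Qed.

Lemma complexP (z w : C) : re z = re w -> im z = im w -> z = w.
Proof. by case: z w => [a b] [c d] /= -> ->. Qed.

Lemma sqnormc_neq0 (z : C) : z != 0 -> re z ^+ 2 + im z ^+ 2 != 0.
Proof.
apply: contra; rewrite paddr_eq0 ?sqr_ge0 // !sqrf_eq0 => /andP[/eqP a /eqP b].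
by apply/eqP; apply: complexP.
Qed.

Lemma cderiv_cst (c : C) p : cderiv (fun=> c) p 0.
Proof. by split; rewrite /= ?oppr0; exact: is_derive_cst. Qed.

Lemma cderiv_zcoord p : cderiv zcoord p 1.
Proof.
by split; apply: is_derive_eq (is_derive_coordE _ _ _) _; rewrite mxE //= oppr0.
Qed.

Lemma cderiv_near F G p d : (\forall q \near p, F q = G q) ->
  cderiv F p d -> cderiv G p d.
Proof.
move=> FG [a b c e]; split.
- by apply: near_eq_is_derive a; apply: filterS FG => q ->.
- by apply: near_eq_is_derive b; apply: filterS FG => q ->.
- by apply: near_eq_is_derive c; apply: filterS FG => q ->.
- by apply: near_eq_is_derive e; apply: filterS FG => q ->.
Qed.

Lemma cderiv_eq F p d d' : cderiv F p d -> d = d' -> cderiv F p d'.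
Proof. by move=> ? <-. Qed.

Lemma cderivD F G p d e : cderiv F p d -> cderiv G p e ->
  cderiv (fun q => F q + G q) p (d + e).
Proof.
move=> [f1 f2 f3 f4] [g1 g2 g3 g4]; split.
- under [X in is_derive _ _ X]eq_fun do rewrite reD.
  by rewrite reD; exact: is_deriveD.
- under [X in is_derive _ _ X]eq_fun do rewrite imD.
  by rewrite imD; exact: is_deriveD.
- under [X in is_derive _ _ X]eq_fun do rewrite reD.
  by rewrite imD opprD; exact: is_deriveD.
- under [X in is_derive _ _ X]eq_fun do rewrite imD.
  by rewrite reD; exact: is_deriveD.
Qed.

Lemma cderivM F G p d e : cderiv F p d -> cderiv G p e ->
  cderiv (fun q => F q * G q) p (d * G p + F p * e).
Proof.
move=> [f1 f2 f3 f4] [g1 g2 g3 g4]; split.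
- under [X in is_derive _ _ X]eq_fun do rewrite reM.
  apply: is_derive_eq (is_deriveB (is_deriveM f1 g1) (is_deriveM f2 g2)) _.
  by rewrite reD !reM /GRing.scale /=; ring.
- under [X in is_derive _ _ X]eq_fun do rewrite imM.
  apply: is_derive_eq (is_deriveD (is_deriveM f1 g2) (is_deriveM f2 g1)) _.
  by rewrite imD !imM /GRing.scale /=; ring.
- under [X in is_derive _ _ X]eq_fun do rewrite reM.
  apply: is_derive_eq (is_deriveB (is_deriveM f3 g3) (is_deriveM f4 g4)) _.
  by rewrite imD !imM /GRing.scale /=; ring.
- under [X in is_derive _ _ X]eq_fun do rewrite imM.
  apply: is_derive_eq (is_deriveD (is_deriveM f3 g4) (is_deriveM f4 g3)) _.
  by rewrite reD !reM /GRing.scale /=; ring.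
Qed.

Lemma is_derive_inv (f : pt -> R) p v d : f p != 0 -> is_derive p v f d ->
  is_derive p v (fun q => (f q)^-1) (- (f p) ^- 2 * d).
Proof.
move=> f0 [fd <-]; apply: DeriveDef; first exact: derivableV.
by rewrite deriveV.
Qed.

Lemma cderivV F p d : F p != 0 -> cderiv F p d ->
  cderiv (fun q => (F q)^-1) p (- d * ((F p)^-1 * (F p)^-1)).
Proof.
move=> F0 [f1 f2 f3 f4].
have N0 := sqnormc_neq0 F0.
have n v a b : is_derive p v (fun q => re (F q)) a ->
    is_derive p v (fun q => im (F q)) b ->
    is_derive p v (fun q => (re (F q) ^+ 2 + im (F q) ^+ 2)^-1)
     (- (re (F p) ^+ 2 + im (F p) ^+ 2) ^- 2 * (2 * re (F p) * a + 2 * im (F p) * b)).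
  move=> ha hb; apply: is_derive_inv => //.
  by apply: is_derive_eq (is_deriveD (is_deriveX 2 ha) (is_deriveX 2 hb)) _.
split.
- under [X in is_derive _ _ X]eq_fun do rewrite reV.
  apply: is_derive_eq (is_deriveM f1 (n _ _ _ f1 f2)) _.
  rewrite reM reN imN reM imM !reV !imV /GRing.scale /=.
  by move: (re (F p)) (im (F p)) N0 => a b N0; field.
- under [X in is_derive _ _ X]eq_fun do rewrite imV.
  apply: is_derive_eq (is_deriveN (is_deriveM f2 (n _ _ _ f1 f2))) _.
  rewrite imM reN imN reM imM !reV !imV /GRing.scale /=.
  by move: (re (F p)) (im (F p)) N0 => a b N0; field.
- under [X in is_derive _ _ X]eq_fun do rewrite reV.
  apply: is_derive_eq (is_deriveM f3 (n _ _ _ f3 f4)) _.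
  rewrite imM reN imN reM imM !reV !imV /GRing.scale /=.
  by move: (re (F p)) (im (F p)) N0 => a b N0; field.
- under [X in is_derive _ _ X]eq_fun do rewrite imV.
  apply: is_derive_eq (is_deriveN (is_deriveM f4 (n _ _ _ f3 f4))) _.
  rewrite reM reN imN reM imM !reV !imV /GRing.scale /=.
  by move: (re (F p)) (im (F p)) N0 => a b N0; field.
Qed.

Lemma cderiv_sum (I : Type) (r : seq I) (F : I -> pt -> C) p (d : I -> C) :
  (forall i, cderiv (F i) p (d i)) ->
  cderiv (fun q => \sum_(i <- r) F i q) p (\sum_(i <- r) d i).
Proof.
move=> dF; elim: r => [|i r IHr].
  under [X in cderiv X]eq_fun do rewrite big_nil.
  by rewrite big_nil; exact: cderiv_cst.
under [X in cderiv X]eq_fun do rewrite big_cons.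
by rewrite big_cons; exact: cderivD.
Qed.

Lemma ccont_cst (c : C) p : ccont (fun=> c) p.
Proof. by split; exact: cst_continuous. Qed.

Lemma ccont_zcoord p : ccont zcoord p.
Proof. by split; exact: coord_continuous. Qed.

Lemma ccontD F G p : ccont F p -> ccont G p -> ccont (fun q => F q + G q) p.
Proof.
move=> [f1 f2] [g1 g2]; split.
- rewrite (_ : (fun q => re (F q + G q)) = (fun q => re (F q)) \+ (fun q => re (G q))).
    exact: continuousD.
  by apply/funext => q; rewrite reD.
- rewrite (_ : (fun q => im (F q + G q)) = (fun q => im (F q)) \+ (fun q => im (G q))).
    exact: continuousD.
  by apply/funext => q; rewrite imD.
Qed.

Lemma ccontM F G p : ccont F p -> ccont G p -> ccont (fun q => F q * G q) p.
Proof.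
move=> [f1 f2] [g1 g2]; split.
- rewrite (_ : (fun q => re (F q * G q)) = (fun q => re (F q)) \* (fun q => re (G q))
     \- (fun q => im (F q)) \* (fun q => im (G q))).
    by apply: continuousB; exact: continuousM.
  by apply/funext => q; rewrite reM.
- rewrite (_ : (fun q => im (F q * G q)) = (fun q => re (F q)) \* (fun q => im (G q))
     \+ (fun q => im (F q)) \* (fun q => re (G q))).
    by apply: continuousD; exact: continuousM.
  by apply/funext => q; rewrite imM.
Qed.

Lemma ccontV F p : F p != 0 -> ccont F p -> ccont (fun q => (F q)^-1) p.
Proof.
move=> F0 [f1 f2]; have N0 := sqnormc_neq0 F0.
have n : {for p, continuous (fun q => (re (F q) ^+ 2 + im (F q) ^+ 2)^-1)}.
  apply: continuousV => //.
  apply: (@continuousD _ _ _ (fun q => re (F q) ^+ 2) (fun q => im (F q) ^+ 2)).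
    exact: continuousM.
  exact: continuousM.
split.
- rewrite (_ : (fun q => re (F q)^-1) = (fun q => re (F q)) \*
      (fun q => (re (F q) ^+ 2 + im (F q) ^+ 2)^-1)).
    exact: continuousM.
  by apply/funext => q; rewrite reV.
- rewrite (_ : (fun q => im (F q)^-1) = \- ((fun q => im (F q)) \*
      (fun q => (re (F q) ^+ 2 + im (F q) ^+ 2)^-1))).
    by apply: continuousN; exact: continuousM.
  by apply/funext => q; rewrite imV.
Qed.

Lemma ccont_sum (I : Type) (r : seq I) (F : I -> pt -> C) p :
  (forall i, ccont (F i) p) -> ccont (fun q => \sum_(i <- r) F i q) p.
Proof.
move=> dF; elim: r => [|i r IHr].
  under [X in ccont X]eq_fun do rewrite big_nil.
  exact: ccont_cst.
under [X in ccont X]eq_fun do rewrite big_cons.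
exact: ccontD.
Qed.

(** Two complex derivatives are what it takes to write the Laplacian of the imaginary part. *)
Definition hol2 F : Prop := exists F' F'', forall p, open_half_disk p ->
  cderiv F p (F' p) /\ cderiv F' p (F'' p).

Lemma hol2_cst (c : C) : hol2 (fun=> c).
Proof. by exists (fun=> 0), (fun=> 0) => p _; split; exact: cderiv_cst. Qed.

Lemma hol2_zcoord : hol2 zcoord.
Proof.
by exists (fun=> 1), (fun=> 0) => p _; split; [exact: cderiv_zcoord|exact: cderiv_cst].
Qed.

Lemma hol2D F G : hol2 F -> hol2 G -> hol2 (fun q => F q + G q).
Proof.
move=> [F1 [F2 hF]] [G1 [G2 hG]].
exists (fun q => F1 q + G1 q), (fun q => F2 q + G2 q) => p op.
by have [? ?] := hF p op; have [? ?] := hG p op; split; exact: cderivD.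
Qed.

Lemma hol2M F G : hol2 F -> hol2 G -> hol2 (fun q => F q * G q).
Proof.
move=> [F1 [F2 hF]] [G1 [G2 hG]].
eexists (fun q => F1 q * G q + F q * G1 q), _ => p op.
have [f1 f2] := hF p op; have [g1 g2] := hG p op; split; first exact: cderivM.
apply: (cderivD (cderivM f2 g1) (cderivM f1 g2)).
Qed.

Lemma hol2V F : (forall p, open_half_disk p -> F p != 0) -> hol2 F ->
  hol2 (fun q => (F q)^-1).
Proof.
move=> F0 [F1 [F2 hF]].
eexists (fun q => (- 1 * F1 q) * ((F q)^-1 * (F q)^-1)), _ => p op.
have [f1 f2] := hF p op; have i1 := cderivV (F0 p op) f1; split.
  by apply: cderiv_eq i1 _; rewrite mulN1r.
exact: (cderivM (cderivM (cderiv_cst _ _) f2) (cderivM i1 i1)).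
Qed.

Lemma hol2_sum (I : Type) (r : seq I) (F : I -> pt -> C) :
  (forall i, hol2 (F i)) -> hol2 (fun q => \sum_(i <- r) F i q).
Proof.
move=> dF; elim: r => [|i r IHr].
  under [X in hol2 X]eq_fun do rewrite big_nil.
  exact: hol2_cst.
under [X in hol2 X]eq_fun do rewrite big_cons.
exact: hol2D.
Qed.

Lemma hol2X F n : hol2 F -> hol2 (fun q => F q ^+ n).
Proof.
move=> hF; elim: n => [|n IHn].
  by under [X in hol2 X]eq_fun do rewrite expr0; exact: hol2_cst.
under [X in hol2 X]eq_fun do rewrite exprS.
exact: hol2M.
Qed.

Lemma ccontX F n p : ccont F p -> ccont (fun q => F q ^+ n) p.
Proof.
move=> hF; elim: n => [|n IHn].
  by under [X in ccont X]eq_fun do rewrite expr0; exact: ccont_cst.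
under [X in ccont X]eq_fun do rewrite exprS.
exact: ccontM.
Qed.

(** The Cauchy-Riemann equations for [F] and for [F'] give [im F''] and [- im F''] as the pure
    second derivatives of [im F]. *)
Lemma max_principle_im F (M : R) : hol2 F ->
  (forall p, half_disk p -> {for p, continuous (fun q => im (F q))}) ->
  (forall p, half_disk p -> ~ open_half_disk p -> im (F p) <= M) ->
  forall p, half_disk p -> im (F p) <= M.
Proof.
move=> [F1 [F2 hF]] cF bF p Dp.
apply: (@max_principle R (fun q => im (F q)) (fun q => im (F1 q)) (fun q => re (F1 q))
  (fun q => im (F2 q)) (fun q => - im (F2 q)) M) => //.
move=> q oq; have [[a1 a2 a3 a4] [b1 b2 b3 b4]] := hF q oq.
by split => //; rewrite subrr.
Qed.

Lemma max_principle_im0 F : hol2 F ->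
  (forall p, half_disk p -> {for p, continuous (fun q => im (F q))}) ->
  (forall p, half_disk p -> ~ open_half_disk p -> im (F p) = 0) ->
  forall p, half_disk p -> im (F p) = 0.
Proof.
move=> hF cF bF p Dp; apply/eqP; rewrite eq_le; apply/andP; split.
  by apply: max_principle_im => // q Dq nq; rewrite bF.
rewrite -oppr_le0 -imN -mulN1r.
apply: (@max_principle_im (fun q => - 1 * F q)); last exact: Dp.
- by apply: hol2M => //; exact: hol2_cst.
- move=> q Dq; rewrite (_ : (fun q => im (- 1 * F q)) = \- (fun q => im (F q))).
    by apply: continuousN; exact: cF.
  by apply/funext => t; rewrite mulN1r imN.
- by move=> q Dq nq; rewrite mulN1r imN bF ?oppr0.
Qed.

(** Each point is joined to the real axis by a vertical chord, and then to the point 1 along the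
    axis; apart from endpoints, both segments run inside the open half-disk. *)
Lemma cderiv_const F : (forall p, open_half_disk p -> cderiv F p 0) ->
  (forall p, half_disk p -> 0 < p 0 0 -> ccont F p) ->
  forall p, half_disk p -> 0 < p 0 0 -> F p = F (row2 1 0).
Proof.
move=> dF cF.
have vert x y0 y1 : 0 < x -> x ^+ 2 + y0 ^+ 2 <= 1 -> x ^+ 2 + y1 ^+ 2 <= 1 ->
    y0 < y1 -> F (row2 x y0) = F (row2 x y1).
  move=> x0 h0 h1 y01.
  have E y : row2 x y = y *: basis_vec R 1 + row2 x 0.
    by rewrite basis_vec1E; apply/rowP => -[[|[|//]] Hi]; rewrite !mxE /=; ring.
  have inD y : y0 <= y <= y1 -> half_disk (row2 x y).
    move=> /andP[ya yb]; rewrite /half_disk /= row2E0 row2E1; split; last exact: ltW.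
    have : y ^+ 2 <= Num.max (y0 ^+ 2) (y1 ^+ 2); last first.
      by rewrite le_max => /orP[]; lra.
    rewrite le_max; apply/orP.
    case: (lerP 0 y) => yy; [right|left]; nra.
  have inD0 y : y0 < y < y1 -> open_half_disk (row2 x y).
    move=> /andP[ya yb]; rewrite /open_half_disk /= row2E0 row2E1; split => //.
    case: (lerP 0 y) => yy; nra.
  apply: complexP.
  - have [||c /andP[c0 c1] H] := @MVT_line _ _ (fun q => re (F q)) (fun=> 0) (row2 x 0) (basis_vec R 1) y0 y1 y01.
    + by move=> s sy; rewrite -E; have [_ _ + _] := dF _ (inD0 s sy); rewrite oppr0.
    + by move=> s sy; rewrite -E; have [] := cF _ (inD s sy) ltac:(by rewrite row2E0).
    by move: H; rewrite -!E mul0r; lra.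
  - have [||c /andP[c0 c1] H] := @MVT_line _ _ (fun q => im (F q)) (fun=> 0) (row2 x 0) (basis_vec R 1) y0 y1 y01.
    + by move=> s sy; rewrite -E; have [_ _ _ ] := dF _ (inD0 s sy).
    + by move=> s sy; rewrite -E; have [] := cF _ (inD s sy) ltac:(by rewrite row2E0).
    by move: H; rewrite -!E mul0r; lra.
have hor x : 0 < x -> x < 1 -> F (row2 x 0) = F (row2 1 0).
  move=> x0 x1.
  have E t : row2 t 0 = t *: basis_vec R 0 + 0.
    by rewrite basis_vec0E; apply/rowP => -[[|[|//]] Hi]; rewrite !mxE /=; ring.
  have inD t : x <= t <= 1 -> half_disk (row2 t 0).
    by move=> /andP[ya yb]; rewrite /half_disk /= row2E0 row2E1; split; nra.
  have inD0 t : x < t < 1 -> open_half_disk (row2 t 0).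
    by move=> /andP[ya yb]; rewrite /open_half_disk /= row2E0 row2E1; split; nra.
  apply: complexP.
  - have [||c /andP[c0 c1] H] := @MVT_line _ _ (fun q => re (F q)) (fun=> 0) 0 (basis_vec R 0) x 1 x1.
    + by move=> s sy; rewrite -E; have [] := dF _ (inD0 s sy).
    + move=> s sy; rewrite -E; have [] // := cF _ (inD s sy); rewrite row2E0.
      by case/andP: sy; lra.
    by move: H; rewrite -!E mul0r; lra.
  - have [||c /andP[c0 c1] H] := @MVT_line _ _ (fun q => im (F q)) (fun=> 0) 0 (basis_vec R 0) x 1 x1.
    + by move=> s sy; rewrite -E; have [] := dF _ (inD0 s sy).
    + move=> s sy; rewrite -E; have [] // := cF _ (inD s sy); rewrite row2E0.
      by case/andP: sy; lra.
    by move: H; rewrite -!E mul0r; lra.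
move=> p; rewrite -(row2K p); set x := p 0 0; set y := p 0 1.
rewrite /half_disk /= row2E0 row2E1 => -[xy _] x0.
have x1 : x ^+ 2 <= 1 by have := sqr_ge0 y; lra.
have -> : F (row2 x y) = F (row2 x 0).
  case: (ltgtP y 0) => [yl|yg|->] //.
    by apply: vert => //; rewrite expr0n addr0.
  by apply/esym; apply: vert => //; rewrite expr0n addr0.
have : x <= 1 by nra.
by rewrite le_eqVlt => /orP[/eqP -> //|]; exact: hor.
Qed.

(** Once the imaginary part vanishes identically, the Cauchy-Riemann equations annihilate the whole
    derivative. *)
Lemma hol2_real_boundary_const F : hol2 F ->
  (forall p, half_disk p -> {for p, continuous (fun q => im (F q))}) ->
  (forall p, half_disk p -> 0 < p 0 0 -> {for p, continuous (fun q => re (F q))}) ->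
  (forall p, half_disk p -> ~ open_half_disk p -> im (F p) = 0) ->
  forall p, half_disk p -> 0 < p 0 0 -> F p = F (row2 1 0).
Proof.
move=> hF ci cr bF.
have im0 := max_principle_im0 hF ci bF.
case: hF => [F1 [F2 hF]].
apply: cderiv_const => [p op|p Dp p0]; last by split; [exact: cr|exact: ci].
have [[a1 a2 a3 a4] _] := hF p op.
have nq : \forall q \near p, open_half_disk q.
  by apply: open_nbhs_nbhs; split => //; exact: open_half_disk_open.
have z v : is_derive p v (fun q => im (F q)) 0.
  apply: near_eq_is_derive (is_derive_cst 0 p v).
  by apply: filterS nq => q oq; rewrite im0 //; exact: open_half_disk_sub.
have i0 : im (F1 p) = 0 by case: a2 => _ <-; case: (z (basis_vec R 0)).
have r0 : re (F1 p) = 0 by case: a4 => _ <-; case: (z (basis_vec R 1)).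
by apply: (cderiv_eq (hF p op).1); apply: complexP.
Qed.

End Holomorphic.

(** * Rigidity of holomorphic functions on the half-disk *)

Section Density.
Context (R : realType).
Local Notation pt := 'rV[R]_2.

Lemma ray_eq0 (g : pt -> R) p v : {for p, continuous g} ->
  (forall s, 0 < s < 1 -> g (s *: v + p) = 0) -> g p = 0.
Proof.
move=> cg g0; apply/eqP; apply: contrapT => /negP gp.
have nz : \forall q \near p, g q != 0 by exact: cvgr_neq0 cg gp.
have [r r0 hr] := nbhs_line v nz.
pose s := Num.min r 1 / 2.
have m0 : 0 < Num.min r 1 by rewrite lt_min r0 ltr01.
have s0 : 0 < s by rewrite divr_gt0.
have : s < Num.min r 1 by rewrite /s ltr_pdivrMr // ltr_pMr ?ltr1n.
rewrite lt_min => /andP[sr s1].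
by have := hr s; rewrite gtr0_norm // => /(_ sr); rewrite g0 ?eqxx // s0.
Qed.

Lemma half_disk_toward_center (p : pt) s : half_disk p -> 0 < s < 1 ->
  open_half_disk (s *: (row2 (1 / 2) 0 - p) + p).
Proof.
move=> [pn p0] /andP[s0 s1]; rewrite /open_half_disk /= !mxE /=.
move: pn p0; move: (p 0 0) (p 0 1) => a b ab a0.
split; last by nra.
(* The identity [|(1 - s) p + s c|^2 = (1 - s) |p|^2 + s |c|^2 - s (1 - s) |p - c|^2] with
   [c = (1/2, 0)]. *)
have -> : (s * (1 / 2 - a) + a) ^+ 2 + (s * (0 - b) + b) ^+ 2 =
  (1 - s) * (a ^+ 2 + b ^+ 2) + s / 4 - s * (1 - s) * ((a - 1 / 2) ^+ 2 + b ^+ 2).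
  by field.
have : 0 <= s * (1 - s) * ((a - 1 / 2) ^+ 2 + b ^+ 2).
  by rewrite mulr_ge0 ?addr_ge0 ?sqr_ge0 // mulr_ge0 //; lra.
have : (1 - s) * (a ^+ 2 + b ^+ 2) <= 1 - s by rewrite ler_piMr //; lra.
by lra.
Qed.

(** Carries identities from the interior to the arc, the diameter and the corners: from every point
    of the half-disk, the open segment towards [(1/2, 0)] runs in the interior. *)
Lemma half_disk_dense (g : pt -> R) p : half_disk p -> {for p, continuous g} ->
  (forall q, open_half_disk q -> g q = 0) -> g p = 0.
Proof.
move=> Dp cg g0; apply: (@ray_eq0 g p (row2 (1 / 2) 0 - p) cg) => s s01.
by apply: g0; exact: half_disk_toward_center.
Qed.

Lemma half_disk_dense_eq (F G : pt -> R[i]) p : half_disk p ->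
  ccont F p -> ccont G p ->
  (forall q, open_half_disk q -> F q = G q) -> F p = G p.
Proof.
move=> Dp [f1 f2] [g1 g2] FG; apply: complexP; apply/eqP; rewrite -subr_eq0; apply/eqP.
- apply: (@half_disk_dense (fun q => complex.Re (F q) - complex.Re (G q))) => //.
    exact: continuousB.
  by move=> q oq; rewrite FG // subrr.
- apply: (@half_disk_dense (fun q => complex.Im (F q) - complex.Im (G q))) => //.
    exact: continuousB.
  by move=> q oq; rewrite FG // subrr.
Qed.

(** By Bernoulli's inequality [x ^+ k] grows at least linearly, which contradicts the bound for
    large [k] if [c > 0]. *)
Lemma bernoulli_unbounded (x c B : R) : 1 < x -> 0 <= c ->
  (forall k, c * x ^+ k <= B) -> c = 0.
Proof.
move=> x1 c0 hB; apply/eqP; rewrite eq_le c0 andbT leNgt; apply/negP => cp.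
have bern k : 1 + k%:R * (x - 1) <= x ^+ k.
  elim: k => [|k IH]; first by rewrite mul0r addr0 expr0.
  rewrite exprS -natr1; have k0 : (0 : R) <= k%:R by exact: ler0n.
  move: IH; move: (x ^+ k) (k%:R : R) k0 => X K K0 IH.
  have := mulr_ge0 K0 (sqr_ge0 (x - 1)).
  have : x * (1 + K * (x - 1)) <= x * X by rewrite ler_pM2l //; lra.
  by nra.
pose d := c * (x - 1).
have d0 : 0 < d by rewrite mulr_gt0 // subr_gt0.
have B0 : 0 <= B by apply: le_trans (hB 0%N); rewrite expr0 mulr1.
have := archi_boundP (divr_ge0 B0 (ltW d0)); set k := Num.bound _.
rewrite ltr_pdivrMr // => Bk.
have := hB k; have := bern k; rewrite -(ler_pM2l cp).
move: Bk; rewrite /d; move: (x ^+ k) (k%:R : R) => X K; nra.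
Qed.

End Density.

Section Unique.
Context (R : realType).
Local Notation pt := 'rV[R]_2.
Local Notation C := R[i].
Local Notation re := (@complex.Re R).
Local Notation im := (@complex.Im R).

Definition sqnormc (z : C) : R := re z ^+ 2 + im z ^+ 2.

Lemma sqnormcM (z w : C) : sqnormc (z * w) = sqnormc z * sqnormc w.
Proof. by rewrite /sqnormc reM imM; ring. Qed.

Lemma sqnormc_ge0 (z : C) : 0 <= sqnormc z.
Proof. by rewrite addr_ge0 // sqr_ge0. Qed.

Lemma sqnormc_eq0 (z : C) : sqnormc z = 0 -> z = 0.
Proof. by move=> z0; apply/eqP; apply: contraTT isT => /sqnormc_neq0; rewrite -/(sqnormc z) z0 eqxx. Qed.

Lemma sqnormc0 : sqnormc 0 = 0. Proof. by rewrite /sqnormc /= expr0n addr0. Qed.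
Lemma sqnormc1 : sqnormc 1 = 1. Proof. by rewrite /sqnormc /= expr0n addr0 expr1n. Qed.

Lemma sqnormcX (z : C) k : sqnormc (z ^+ k) = sqnormc z ^+ k.
Proof. by elim: k => [|k IH]; rewrite ?expr0 ?sqnormc1 // !exprS sqnormcM IH. Qed.

Lemma sqnormcV (z : C) : sqnormc z^-1 = (sqnormc z)^-1.
Proof.
have [->|z0] := eqVneq z 0; first by rewrite invr0 sqnormc0 invr0.
have n0 := sqnormc_neq0 z0; apply: (mulfI n0).
by rewrite -/(sqnormc z) -sqnormcM !mulfV ?sqnormc1.
Qed.

Lemma continuous_sqnormc (F : pt -> C) p : ccont F p ->
  {for p, continuous (fun q => sqnormc (F q))}.
Proof.
move=> [f1 f2].
by apply: (@continuousD _ _ _ (fun q => re (F q) ^+ 2) (fun q => im (F q) ^+ 2));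
  exact: continuousM.
Qed.

Lemma half_disk_x_le1 (p : pt) : half_disk p -> p 0 0 <= 1.
Proof. by move=> [pn p0]; have := sqr_ge0 (p 0 1); nra. Qed.

(* Multiplying by powers of [(2 + z) / (2 - z)], which has modulus 1 on the
   diameter and modulus > 1 elsewhere, does not change the maximum. *)
Lemma hol2_arc_unique (F : pt -> C) : hol2 F ->
  (forall p, half_disk p -> ccont F p) ->
  (forall p, half_circle p -> 0 < p 0 0 -> F p = 0) ->
  forall p, open_half_disk p -> F p = 0.
Proof.
move=> hF cF F0.
pose den (p : pt) : C := Complex 2 0 + - 1 * zcoord p.
pose quo p : C := (Complex 2 0 + zcoord p) * (den p)^-1.
have den0 p : half_disk p -> den p != 0.
  move=> Dp; apply/negP => /eqP /(congr1 re).
  rewrite /den reD mulN1r reN /=.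
  by have := half_disk_x_le1 Dp; lra.
have hquo : hol2 quo.
  apply: hol2M; first by apply: hol2D; [exact: hol2_cst|exact: hol2_zcoord].
  apply: hol2V => [p op|]; first by apply: den0; exact: open_half_disk_sub.
  apply: hol2D; first exact: hol2_cst.
  by apply: hol2M; [exact: hol2_cst|exact: hol2_zcoord].
have cquo p : half_disk p -> ccont quo p.
  move=> Dp; apply: ccontM; first by apply: ccontD; [exact: ccont_cst|exact: ccont_zcoord].
  apply: ccontV; first exact: den0.
  apply: ccontD; first exact: ccont_cst.
  by apply: ccontM; [exact: ccont_cst|exact: ccont_zcoord].
have Nq p : sqnormc (quo p) =
    ((2 + p 0 0) ^+ 2 + p 0 1 ^+ 2) / ((2 - p 0 0) ^+ 2 + p 0 1 ^+ 2).
  rewrite /quo sqnormcM sqnormcV /sqnormc /den !reD !imD mulN1r reN imN /=.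
  by rewrite !add0r sqrrN.
have [c cD maxc] : exists2 c, c \in half_disk &
   forall p, p \in half_disk -> sqnormc (F p) <= sqnormc (F c).
  apply: (@compact_EVT_max _ R (fun p => sqnormc (F p)) half_disk).
  - by exists 0; rewrite /half_disk /= !mxE expr0n /= addr0; split; lra.
  - exact: half_disk_compact.
  - apply: continuous_in_subspaceT => p; rewrite inE => Dp.
    exact/continuous_sqnormc/cF.
(* Adding 1 avoids square roots: [x ^+ 2 <= B - 1] and [B >= 1] already give [x <= B]. *)
pose B := sqnormc (F c) + 1.
have B1 : 1 <= B by rewrite /B lerDr sqnormc_ge0.
(* The maximum principle controls imaginary parts, so the value is rotated by a unit [w]; the
   choices 1, -1, i and -i bound both parts from both sides, whence the constant [2 * B ^+ 2]
   below. *)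
have bound (w : C) k p : sqnormc w = 1 -> half_disk p ->
    im (w * (F p * quo p ^+ k)) <= B.
  move=> w1 Dp.
  apply: (@max_principle_im R (fun p => w * (F p * quo p ^+ k))) => //.
  - by apply: hol2M; [exact: hol2_cst|apply: hol2M => //; exact: hol2X].
  - move=> q Dq; suff [] : ccont (fun p => w * (F p * quo p ^+ k)) q by [].
    apply: ccontM; first exact: ccont_cst.
    by apply: ccontM; [exact: cF|apply: ccontX; exact: cquo].
  - move=> q [qn q0] nq.
    have [q00|q00] := eqVneq (q 0 0) 0; last first.
      have qx : 0 < q 0 0 by rewrite lt_neqAle eq_sym q00.
      rewrite F0 //; first by rewrite mul0r mulr0 /= (le_trans ler01).
      split => //; apply/eqP; rewrite eq_le qn /= leNgt; apply/negP => q1.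
      exact: nq.
    have Nq1 : sqnormc (quo q) = 1.
      rewrite Nq q00 addr0 subr0 mulfV //.
      by rewrite lt0r_neq0 // ltr_wpDr ?sqr_ge0 // exprn_gt0.
    have : im (w * (F q * quo q ^+ k)) ^+ 2 <= sqnormc (F c).
      apply: (@le_trans _ _ (sqnormc (w * (F q * quo q ^+ k)))).
        by rewrite /sqnormc lerDr sqr_ge0.
      rewrite !sqnormcM sqnormcX Nq1 w1 expr1n mulr1 mul1r.
      by apply: maxc; rewrite inE; split.
    rewrite /B; have := sqnormc_ge0 (F c); nra.
move=> p op; have Dp := open_half_disk_sub op.
apply: sqnormc_eq0.
apply: (@bernoulli_unbounded R (sqnormc (quo p)) _ (2 * B ^+ 2)).
- case: op => pn p0; rewrite Nq ltr_pdivlMr; first nra.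
  have := half_disk_x_le1 Dp; have := sqr_ge0 (p 0 1); nra.
- exact: sqnormc_ge0.
move=> k; rewrite -sqnormcX -sqnormcM.
have b1 := bound 1 k p sqnormc1 Dp.
have b2 : - B <= im (F p * quo p ^+ k).
  have := bound (- 1) k p _ Dp; rewrite mulN1r imN => H.
  by rewrite lerNl; apply: H; rewrite /sqnormc reN imN /= oppr0 expr0n addr0 sqrrN expr1n.
have b3 : re (F p * quo p ^+ k) <= B.
  have := bound (Complex 0 1) k p _ Dp; rewrite imM /= mul0r mul1r add0r; apply.
  by rewrite /sqnormc /= expr0n add0r expr1n.
have b4 : - B <= re (F p * quo p ^+ k).
  have := bound (Complex 0 (- 1)) k p _ Dp; rewrite imM /= mul0r mulN1r add0r => H.
  by rewrite lerNl; apply: H; rewrite /sqnormc /= expr0n add0r sqrrN expr1n.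
move: b1; rewrite mul1r /sqnormc => b1.
move: b1 b2 b3 b4; move: (re _) (im _) => a b; nra.
Qed.

End Unique.

(** * Holomorphic maps of the half-disk that respect arc and diameter *)

Section Mobius.
Context (R : realType).
Local Notation pt := 'rV[R]_2.
Local Notation C := R[i].
Local Notation re := (@complex.Re R).
Local Notation im := (@complex.Im R).
Context (f f1 f2 f3 : pt -> C).
Hypothesis df : forall p, half_disk p -> cderiv f p (f1 p).
Hypothesis df1 : forall p, open_half_disk p -> cderiv f1 p (f2 p).
Hypothesis df2 : forall p, open_half_disk p -> cderiv f2 p (f3 p).
Hypothesis re_diff0 : differentiable (fun q => re (f q)) 0.
Hypothesis im_diff0 : differentiable (fun q => im (f q)) 0.
Hypothesis cf : forall p, half_disk p -> ccont f p.
Hypothesis cf1 : forall p, half_disk p -> ccont f1 p.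
Hypothesis f1_neq0 : forall p, half_disk p -> f1 p != 0.
Hypothesis f_le1 : forall p, half_disk p -> sqnormc (f p) <= 1.
Hypothesis f_diam : forall p, diameter p -> re (f p) = 0.
Hypothesis f_arc : forall p, half_circle p -> 0 < p 0 0 ->
  sqnormc (f p) = 1 /\ exists m : R, zcoord p * f1 p = Complex m 0 * f p.
Hypothesis f10 : 0 < re (f1 0).

Let a := im (f 0).
Let ia : C := Complex 0 a.

Lemma half_disk0 : half_disk (0 : pt).
Proof. by rewrite /half_disk /= !mxE expr0n /= addr0; split; lra. Qed.

Lemma diameter_half_disk (p : pt) : diameter p -> half_disk p.
Proof.
move=> [p0 /andP[p1 p2]]; rewrite /half_disk /= p0 expr0n add0r; split => //; nra.
Qed.

(** As [re f] vanishes along the diameter, so does its derivative in [y], which is [- im f1]; the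
    endpoints follow by continuity. *)
Lemma mobius_diam_deriv_real p : diameter p -> im (f1 p) = 0.
Proof.
have open_diam (q : pt) : q 0 0 = 0 -> -1 < q 0 1 < 1 -> im (f1 q) = 0.
  move=> q0 /andP[q1 q2].
  have Dq : half_disk q by apply: diameter_half_disk; split; rewrite ?q0 // !ltW.
  have [_ _ d3 _] := df Dq.
  apply/eqP; rewrite -oppr_eq0; apply/eqP.
  apply: (is_derive_unique_line d3 (is_derive_cst 0 q (basis_vec R 1))).
  have S1 : \forall s \near (0 : R), `|s| < 1 - q 0 1 by apply: nbhs0_lt; lra.
  have S2 : \forall s \near (0 : R), `|s| < q 0 1 + 1 by apply: nbhs0_lt; lra.
  near=> s; apply: f_diam; rewrite basis_vec1E /diameter /= !mxE /= q0 mulr0 addr0 mulr1.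
  have s1 : `|s| < 1 - q 0 1 by near: s; exact: S1.
  have s2 : `|s| < q 0 1 + 1 by near: s; exact: S2.
  split => //; move: s1 s2; rewrite !ltr_norml => /andP[? ?] /andP[? ?].
  by apply/andP; split; lra.
move=> Dp; have Hp := diameter_half_disk Dp; case: Dp => p0 /andP[p1 p2].
apply: (@ray_eq0 R (fun q => im (f1 q)) p (- p)); first by case: (cf1 Hp).
move=> s /andP[s0 s1]; apply: open_diam; rewrite !mxE ?p0 ?oppr0 ?mulr0 ?addr0 //.
by apply/andP; split; nra.
Unshelve. all: by end_near.
Qed.

Lemma mobius_center : f 0 = ia.
Proof.
apply: complexP => //=; apply: f_diam; split; rewrite mxE //.
by apply/andP; split; lra.
Qed.

(** If [a] were 1 or -1, the bound [|f| <= 1] would make 0 an extremum of [im f] along the diameter,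
    and the derivative [re (f1 0)] would vanish. *)
Lemma mobius_center_lt1 : -1 < a < 1.
Proof.
have a2 : a ^+ 2 <= 1.
  by have := f_le1 half_disk0; rewrite mobius_center /sqnormc /= expr0n add0r.
have [_ _ _ d4] := df half_disk0.
have E0 : 0 *: basis_vec R 1 + 0 = 0 :> pt by rewrite scale0r add0r.
have d4' : is_derive (0 : R) 1 (fun s => im (f (s *: basis_vec R 1 + 0))) (re (f1 0)).
  by apply: (is_derive_line (g := fun q => im (f q))); rewrite E0.
have inD (s : R) : -1 < s < 1 -> half_disk (s *: basis_vec R 1 + 0 : pt).
  move=> /andP[s1 s2]; apply: diameter_half_disk.
  rewrite basis_vec1E /diameter /= !mxE /= mulr0 addr0 mulr1 addr0; split => //.
  by rewrite !ltW.
have bnd (s : R) : -1 < s < 1 -> -1 <= im (f (s *: basis_vec R 1 + 0)) <= 1.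
  move=> /inD /f_le1; rewrite /sqnormc => H.
  have : im (f (s *: basis_vec R 1 + 0)) ^+ 2 <= 1.
    by apply: le_trans H; rewrite lerDr sqr_ge0.
  by move: (im _) => y y2; apply/andP; split; nra.
have d (s : R) : s \in `]-1, 1[ -> derivable (fun s : R => im (f (s *: basis_vec R 1 + 0)) : R) s 1.
  rewrite in_itv /= => s1; have [_ _ _ d5] := df (inD s s1).
  by have [] := is_derive_line d5.
have N11 : (-1 : R) <= 1 by lra.
have in0 : (0 : R) \in `]-1, 1[ by rewrite in_itv /=; apply/andP; split; lra.
rewrite !lt_neqAle; apply/andP; split; apply/andP; split.
- apply/negP => /eqP a1.
  have := @derive1_at_min _ _ _ _ _ N11 d in0.
  case=> [t|_ dv].
    by rewrite in_itv /= => /bnd /andP[+ _]; rewrite E0 -/a -a1.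
  by case: d4' => _; rewrite dv => H; move: f10; rewrite -H ltxx.
- nra.
- apply/negP => /eqP a1.
  have := @derive1_at_max _ _ _ _ _ N11 d in0.
  case=> [t|_ dv].
    by rewrite in_itv /= => /bnd /andP[_ +]; rewrite E0 -/a a1.
  by case: d4' => _; rewrite dv => H; move: f10; rewrite -H ltxx.
- nra.
Qed.

(** The value at 0 of the function [W] introduced below, since [1 + ia * ia = 1 - a ^+ 2]. *)
Let kappa : R := 1 - a ^+ 2.

Lemma mobius_kappa_gt0 : 0 < kappa.
Proof. by have /andP[? ?] := mobius_center_lt1; rewrite /kappa; nra. Qed.

Let W p : C := 1 + ia * f p.

Lemma mobius_W_neq0 p : half_disk p -> W p != 0.
Proof.
move=> /f_le1; rewrite /sqnormc => fp; apply/negP => /eqP /(congr1 re).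
rewrite /W reD reM /= mul0r sub0r => H.
have /andP[a1 a2] := mobius_center_lt1.
have y2 : im (f p) ^+ 2 <= 1 by apply: le_trans fp; rewrite lerDr sqr_ge0.
have : (a * im (f p)) ^+ 2 <= a ^+ 2 by rewrite exprMn ler_piMr ?sqr_ge0.
have -> : a * im (f p) = 1 by lra.
have := mobius_kappa_gt0; rewrite /kappa expr1n; lra.
Qed.

Lemma zcoord_eq0 (p : pt) : zcoord p = 0 -> p = 0.
Proof.
move=> [p0 p1]; rewrite -(row2K p) p0 p1.
by apply/rowP => i; rewrite !mxE; case: ifP.
Qed.

Lemma zcoord0 : zcoord (0 : pt) = 0.
Proof. by rewrite /zcoord !mxE. Qed.

(** Difference quotient of [f] at 0, completed by the derivative. As 0 lies on the boundary of the
    half-disk, continuity there is not a matter of removable singularities. *)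
Let h p : C := if p == 0 then f1 0 else (f p - f 0) * (zcoord p)^-1.

Lemma mobius_hE p : h p * zcoord p = f p - ia.
Proof.
rewrite /h; case: eqVneq => [->|p0]; first by rewrite zcoord0 mulr0 mobius_center subrr.
rewrite mobius_center divfK //; apply: contra p0 => /eqP z0.
exact/eqP/zcoord_eq0.
Qed.

(** The real first-order expansion of [f] at 0, whose linear part is multiplication by [f1 0], is
    divided by [z]. The remainder is small against the sup norm of [q], which is at most [|z|];
    [e / 2] is allotted to each of its two components. *)
Lemma mobius_h_ccont0 : ccont h 0.
Proof.
have Ev (q : pt) : q = q 0 0 *: basis_vec R 0 + q 0 1 *: basis_vec R 1.
  by rewrite -row2_basisE row2K.
have D0 := half_disk0.
have [d1 d2 d3 d4] := df D0.
have lin (g : pt -> R) (q : pt) gx gy : differentiable g 0 ->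
    is_derive 0 (basis_vec R 0) g gx -> is_derive 0 (basis_vec R 1) g gy ->
    'd g 0 q = q 0 0 * gx + q 0 1 * gy.
  move=> dg [_ <-] [_ <-]; rewrite {1}(Ev q) linearD !linearZ /=.
  by rewrite -!deriveE.
have approx (g : pt -> R) gx gy (e : R) : 0 < e -> differentiable g 0 ->
    is_derive 0 (basis_vec R 0) g gx -> is_derive 0 (basis_vec R 1) g gy ->
    \forall q \near (0 : pt), `|g q - g 0 - (q 0 0 * gx + q 0 1 * gy)| <= e * `|q|.
  move=> e0 dg gx' gy'; have := diff_locally dg => /eqaddoP /(_ _ e0).
  apply: filterS => q; rewrite -(lin g q gx gy dg gx' gy').
  have -> : g q - g 0 - 'd g 0 q = (g \o shift 0 - (cst (g 0) + 'd g 0)) q.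
    by rewrite /= !fctE /= addr0 opprD addrA.
  by [].
have key (e : R) : 0 < e -> \forall q \near (0 : pt), 
   `|re (h q) - re (f1 0)| <= e /\ `|im (h q) - im (f1 0)| <= e.
  move=> e0; have e2 : 0 < e / 2 by rewrite divr_gt0.
  near=> q.
  have A1 : `|re (f q) - re (f 0) - (q 0 0 * re (f1 0) + q 0 1 * - im (f1 0))| <= e / 2 * `|q|.
    by near: q; exact: approx.
  have A2 : `|im (f q) - im (f 0) - (q 0 0 * im (f1 0) + q 0 1 * re (f1 0))| <= e / 2 * `|q|.
    by near: q; exact: approx.
  rewrite /h; case: eqVneq => [_|q0]; first by rewrite !subrr normr0 ltW.
  set x := q 0 0 in A1 A2 *; set y := q 0 1 in A1 A2 *.
  set r1 := _ - _ - _ in A1; set r2 := _ - _ - _ in A2.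
  have Nz : 0 < x ^+ 2 + y ^+ 2.
    rewrite lt_neqAle eq_sym addr_ge0 ?sqr_ge0 // andbT.
    apply: (@sqnormc_neq0 R (zcoord q)); apply: contra q0 => /eqP z0.
    exact/eqP/zcoord_eq0.
  have nx : `|x| <= `|q|.
    by rewrite [leRHS]/Num.norm /= mx_normrE; exact: (@le_bigmax _ R _ 0 (fun i : 'I_1 * 'I_2 => `|q i.1 i.2|) (0, 0)).
  have ny : `|y| <= `|q|.
    by rewrite [leRHS]/Num.norm /= mx_normrE; exact: (@le_bigmax _ R _ 0 (fun i : 'I_1 * 'I_2 => `|q i.1 i.2|) (0, 1)).
  have nq : `|q| ^+ 2 <= x ^+ 2 + y ^+ 2.
    have : `|q| = `|x| \/ `|q| = `|y|.
      have [[i j] Hq] := mx_norm_neq0 (x := q) ltac:(by rewrite -[mx_norm q]/(`|q|) normr_eq0).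
      rewrite -[mx_norm q]/(`|q|) /= (ord1 i) in Hq.
      case: j Hq => [[|[|//]] Hj] Hq; [left|right]; rewrite Hq; congr (`|q 0 _|); exact: val_inj.
    by case=> ->; rewrite real_normK ?num_real // ?lerDl ?lerDr sqr_ge0.
  have bnd s t : `|s| <= `|q| -> `|t| <= `|q| ->
      `|(r1 * s + r2 * t) / (x ^+ 2 + y ^+ 2)| <= e.
    move=> hs ht; rewrite normrM normfV (gtr0_norm Nz) ler_pdivrMr //.
    apply: le_trans (ler_normD _ _) _; rewrite !normrM.
    have h1 : `|r1| * `|s| <= (e / 2 * `|q|) * `|q| by exact: ler_pM.
    have h2 : `|r2| * `|t| <= (e / 2 * `|q|) * `|q| by exact: ler_pM.
    have h3 : e * `|q| ^+ 2 <= e * (x ^+ 2 + y ^+ 2) by rewrite ler_pM2l.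
    rewrite expr2 in h3; lra.
  have Nz' := lt0r_neq0 Nz.
  split.
  - have -> : re ((f q - f 0) / zcoord q) - re (f1 0) = (r1 * x + r2 * y) / (x ^+ 2 + y ^+ 2).
      rewrite reM reD imD reN imN reV imV /= -/x -/y /r1 /r2; field.
      by rewrite Nz'.
    exact: bnd.
  - have -> : im ((f q - f 0) / zcoord q) - im (f1 0) = (r1 * - y + r2 * x) / (x ^+ 2 + y ^+ 2).
      rewrite imM reD imD reN imN reV imV /= -/x -/y /r1 /r2; field.
      by rewrite Nz'.
    by apply: bnd; rewrite ?normrN.
have h0 : h 0 = f1 0 by rewrite /h eqxx.
split.
- refine (@continuous_at_dist R 'rV[R]_2 (fun q => re (h q)) 0 (re (f1 0)) _ _).
    by rewrite h0.
  by move=> e e0; apply: filterS (key e e0) => q [].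
- refine (@continuous_at_dist R 'rV[R]_2 (fun q => im (h q)) 0 (im (f1 0)) _ _).
    by rewrite h0.
  by move=> e e0; apply: filterS (key e e0) => q [].
Unshelve. all: by end_near.
Qed.

Lemma mobius_h_near (p : pt) : p != 0 ->
  \forall q \near p, (f q + - 1 * ia) * (zcoord q)^-1 = h q.
Proof.
move=> p0; have nz : \forall q \near p, q != 0 := near_neq0 p0.
apply: filterS nz => q q0; rewrite /h mulN1r.
by rewrite (negbTE q0) mobius_center.
Qed.

Lemma ccont_near (F G : pt -> C) p : (\forall q \near p, F q = G q) -> ccont F p -> ccont G p.
Proof.
move=> FG [c1 c2]; have E := nbhs_singleton FG; split; rewrite /prop_for /continuous_at -E.
- have H : {near p, (fun q => re (F q)) =1 (fun q => re (G q))}.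
    by apply: filterS FG => q ->.
  exact: cvg_trans (near_eq_cvg H) c1.
- have H : {near p, (fun q => im (F q)) =1 (fun q => im (G q))}.
    by apply: filterS FG => q ->.
  exact: cvg_trans (near_eq_cvg H) c2.
Qed.

Lemma zcoord_neq0 (p : pt) : p != 0 -> zcoord p != 0.
Proof. by apply: contra => /eqP /zcoord_eq0 ->. Qed.

Lemma mobius_h_ccont p : half_disk p -> ccont h p.
Proof.
move=> Dp; have [->|p0] := eqVneq p 0; first exact: mobius_h_ccont0.
apply: ccont_near (mobius_h_near p0) _.
apply: ccontM; first by apply: ccontD; [exact: cf|exact: ccont_cst].
by apply: ccontV; [exact: zcoord_neq0|exact: ccont_zcoord].
Qed.

Lemma open_half_disk_neq0 (p : pt) : open_half_disk p -> p != 0.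
Proof.
by move=> [_ p0]; apply/eqP => E; move: p0; rewrite E mxE ltxx.
Qed.

Lemma hol2_near F G : (forall p : pt, open_half_disk p -> \forall q \near p, F q = G q :> C) ->
  hol2 F -> hol2 G.
Proof.
move=> FG [F1 [F2 hF]]; exists F1, F2 => p op; have [h1 h2] := hF p op.
by split => //; apply: cderiv_near h1; exact: FG.
Qed.

Lemma hol2_f : hol2 f.
Proof.
exists f1, f2 => p op; split; [|exact: df1].
by apply: df; exact: open_half_disk_sub.
Qed.

Lemma hol2_h : hol2 h.
Proof.
apply: (@hol2_near (fun q => (f q + - 1 * ia) * (zcoord q)^-1)).
  by move=> p /open_half_disk_neq0; exact: mobius_h_near.
apply: hol2M; first by apply: hol2D; [exact: hol2_f|exact: hol2_cst].
by apply: hol2V => [p /open_half_disk_neq0/zcoord_neq0 //|]; exact: hol2_zcoord.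
Qed.

(** The quotient [(f - i a)(1 + i a f) / (z f')], with [z] absorbed into [h] so that it makes sense
    at 0. *)
Let T p : C := h p * (W p * (f1 p)^-1).

Lemma hol2_W : hol2 W.
Proof.
apply: hol2D; first exact: hol2_cst.
by apply: hol2M; [exact: hol2_cst|exact: hol2_f].
Qed.

Lemma ccont_W p : half_disk p -> ccont W p.
Proof.
move=> Dp; apply: ccontD; first exact: ccont_cst.
by apply: ccontM; [exact: ccont_cst|exact: cf].
Qed.

Lemma mobius_T_hol2 : hol2 T.
Proof.
apply: hol2M; first exact: hol2_h.
apply: hol2M; first exact: hol2_W.
apply: hol2V; first by move=> p op; apply: f1_neq0; exact: open_half_disk_sub.
by exists f2, f3 => p op; split; [exact: df1|exact: df2].
Qed.

Lemma mobius_T_ccont p : half_disk p -> ccont T p.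
Proof.
move=> Dp; apply: ccontM; first exact: mobius_h_ccont.
apply: ccontM; first exact: ccont_W.
by apply: ccontV; [exact: f1_neq0|exact: cf1].
Qed.

Lemma mobius_T0 : T 0 = Complex kappa 0.
Proof.
rewrite /T /h eqxx /W mobius_center mulrC -mulrA mulVf ?mulr1; last exact: f1_neq0 half_disk0.
by apply: complexP; rewrite ?reD ?imD ?reM ?imM /= /kappa; ring.
Qed.

Lemma mobius_T_real p : half_disk p -> ~ open_half_disk p -> im (T p) = 0.
Proof.
move=> Dp np; have [->|p0] := eqVneq p 0; first by rewrite mobius_T0.
have z0 := zcoord_neq0 p0.
have ET : T p * (zcoord p * f1 p) = (f p - ia) * W p.
  rewrite -mobius_hE /T; have := f1_neq0 Dp; set F1 := f1 p => F10.
  by rewrite mulrACA mulfVK //; ring.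
move: (T p) ET => t ET.
case: (Dp) => pn px.
have [p00|p00] := eqVneq (p 0 0) 0.
  (* On the diameter [zcoord p] and [f p - ia] are imaginary while [W p] and [f1 p] are real, so the
     real part of [ET] isolates [im t]. *)
  have dp : diameter p.
    by rewrite /diameter /= p00; split => //; move: pn; rewrite p00 expr0n add0r => ?;
      apply/andP; split; nra.
  have f1E : im (f1 p) = 0 := mobius_diam_deriv_real dp.
  have fE := f_diam dp.
  have y0 : p 0 1 != 0.
    by apply: contra p0 => /eqP y0; apply/eqP/zcoord_eq0; rewrite /zcoord p00 y0.
  have r0 : re (f1 p) != 0.
    by apply: contra (f1_neq0 Dp) => /eqP r0; apply/eqP; apply: complexP.
  move/(congr1 re): ET; rewrite !(reM, imM, reD, imD, reN, imN) /= p00 f1E fE.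
  move=> H; have : im (t) * (p 0 1 * re (f1 p)) = 0.
    by move: H; rewrite !(mul0r, mulr0, add0r, addr0, subr0, sub0r, oppr0); lra.
  by move/eqP; rewrite mulf_eq0 mulf_eq0 (negbTE y0) (negbTE r0) !orbF => /eqP.
have px0 : 0 < p 0 0 by rewrite lt_neqAle eq_sym p00.
have cp : half_circle p.
  split => //; apply/eqP; rewrite eq_le pn leNgt; apply/negP => q1; exact: np.
have [fn [m mE]] := f_arc cp px0.
have fE0 : f p != 0.
  by apply/eqP => f0; move: fn; rewrite f0 sqnormc0 => /eqP; rewrite eq_sym oner_eq0.
have m0 : m != 0.
  apply/eqP => m0; have := mulf_neq0 z0 (f1_neq0 Dp).
  by rewrite mE m0 -[Complex 0 0]/(0 : C) mul0r eqxx.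
(* |f| = 1 gives [f - ia = f * conj (1 + ia f)]. *)
have EW : t * Complex m 0 = Complex (sqnormc (W p)) 0.
  apply: (mulIf fE0); rewrite -mulrA -mE ET.
  rewrite /sqnormc in fn *; apply: complexP;
    rewrite /W !(reM, imM, reD, imD, reN, imN) /=.
  - rewrite !(mul0r, mulr0, add0r, addr0, subr0, sub0r, oppr0).
    move: (re (f p)) (im (f p)) fn => X Y XY.
    have -> : X * (1 - a * Y) - (Y - a) * (a * X) = X * (1 - 2 * a * Y + a ^+ 2) by ring.
    have -> : ((1 - a * Y) ^+ 2 + (a * X) ^+ 2) = 1 - 2 * a * Y + a ^+ 2 * (X ^+ 2 + Y ^+ 2) by ring.
    by rewrite XY; ring.
  - rewrite !(mul0r, mulr0, add0r, addr0, subr0, sub0r, oppr0).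
    move: (re (f p)) (im (f p)) fn => X Y XY.
    have -> : X * (a * X) + (Y - a) * (1 - a * Y) = a * (X ^+ 2 + Y ^+ 2) + Y - a * Y * 0 - a - a * (2 * Y ^+ 2) + a ^+ 2 * Y by ring.
    have -> : ((1 - a * Y) ^+ 2 + (a * X) ^+ 2) = 1 - 2 * a * Y + a ^+ 2 * (X ^+ 2 + Y ^+ 2) by ring.
    by rewrite XY; ring.
move/(congr1 im): EW; rewrite imM /= mulr0 add0r => /eqP.
by rewrite mulf_eq0 (negbTE m0) orbF => /eqP.
Qed.

(** Constancy holds first off the diameter, then by density everywhere, in particular at 0, where
    the value is [kappa]. *)
Lemma mobius_T_const p : half_disk p -> T p = Complex kappa 0.
Proof.
have Tc q : half_disk q -> 0 < q 0 0 -> T q = T (row2 1 0).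
  apply: hol2_real_boundary_const; first exact: mobius_T_hol2.
  - by move=> r /mobius_T_ccont[].
  - by move=> r /mobius_T_ccont[].
  - exact: mobius_T_real.
have To q : open_half_disk q -> T q = T (row2 1 0).
  by move=> oq; apply: Tc; [exact: open_half_disk_sub|case: oq].
have TD q : half_disk q -> T q = T (row2 1 0).
  by move=> Dq; apply: (half_disk_dense_eq Dq (mobius_T_ccont Dq) (ccont_cst _ _)).
by move=> Dp; rewrite TD // -(TD 0) ?mobius_T0 //; exact: half_disk0.
Qed.

Lemma mobius_ode p : half_disk p -> (f p - ia) * W p = Complex kappa 0 * (zcoord p * f1 p).
Proof.
move=> Dp; rewrite -(mobius_T_const Dp) -mobius_hE /T.
have := f1_neq0 Dp; set F1 := f1 p => F10.
by rewrite mulrACA mulfVK //; ring.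
Qed.

(* [h / W] is constant: its derivative vanishes by the differential equation. *)
Lemma mobius_h p : half_disk p -> h p = W p.
Proof.
pose k p := h p * (W p)^-1.
have ck q : half_disk q -> ccont k q.
  move=> Dq; apply: ccontM; first exact: mobius_h_ccont.
  by apply: ccontV; [exact: mobius_W_neq0|exact: ccont_W].
have dk q : open_half_disk q -> cderiv k q 0.
  move=> oq; have Dq := open_half_disk_sub oq; have q0 := open_half_disk_neq0 oq.
  have z0 := zcoord_neq0 q0; have W0 := mobius_W_neq0 Dq.
  apply: (@cderiv_near _ (fun r => ((f r + - 1 * ia) * (zcoord r)^-1) * (W r)^-1)).
    by apply: filterS (mobius_h_near q0) => r ->.
  have dW : cderiv W q (0 + (0 * f q + ia * f1 q)).
    apply: cderivD; first exact: cderiv_cst.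
    by apply: cderivM; [exact: cderiv_cst|exact: df].
  have dz := cderivV z0 (cderiv_zcoord q).
  have dfa : cderiv (fun r => f r + - 1 * ia) q (f1 q + 0).
    by apply: cderivD; [exact: df|exact: cderiv_cst].
  apply: cderiv_eq (cderivM (cderivM dfa dz) (cderivV W0 dW)) _.
  have E := mobius_ode Dq.
  have kE : Complex kappa 0 = 1 + ia ^+ 2.
    by rewrite expr2; apply: complexP; rewrite !(reD, imD, reM, imM) /= /kappa; ring.
  rewrite kE in E; move: E W0 z0; rewrite /W.
  move: (f q) (f1 q) (zcoord q) ia => F F1 z A E W0 z0.
  have -> : (((F1 + 0) / z + (F + - 1 * A) * (- 1 * (z^-1 / z))) / (1 + A * F) +
     (F + - 1 * A) / z * (- (0 + (0 * F + A * F1)) * ((1 + A * F)^-1 / (1 + A * F)))) =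
     ((1 + A ^+ 2) * (z * F1) - (F - A) * (1 + A * F)) / (z ^+ 2 * (1 + A * F) ^+ 2).
    by field; rewrite W0 z0.
  by rewrite E subrr mul0r.
have kc q : half_disk q -> 0 < q 0 0 -> k q = k (row2 1 0).
  by apply: (cderiv_const dk) => r Dr _; exact: ck.
have kD q : half_disk q -> k q = k (row2 1 0).
  move=> Dq; apply: (half_disk_dense_eq Dq (ck q Dq) (ccont_cst _ _)) => r orr.
  by apply: kc; [exact: open_half_disk_sub|case: orr].
set c := k (row2 1 0) in kc kD.
have hc q : half_disk q -> h q = c * W q.
  by move=> Dq; rewrite -(kD q Dq) /k divfK //; exact: mobius_W_neq0.
(* This equation at 0 shows that [c] is real and positive, as [f1 0] is. At the point 1, where
   [|f| = 1] implies [|f - i a| = |1 + i a f|], the modulus of [c] is seen to be 1. *)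
have c0 : f1 0 = c * Complex kappa 0.
  have := hc 0 half_disk0; rewrite {1}/h eqxx => ->; congr (c * _).
  rewrite /W mobius_center.
  by apply: complexP; rewrite !(reD, imD, reM, imM) /= /kappa; ring.
have kp := mobius_kappa_gt0.
have im_c : im c = 0.
  have := mobius_diam_deriv_real (p := 0); rewrite c0 imM /= mulr0 add0r.
  move=> H; have /eqP : im c * kappa = 0.
    by apply: H; split; rewrite mxE //; apply/andP; split; lra.
  by rewrite mulf_eq0 (gt_eqF kp) orbF => /eqP.
have re_c : 0 < re c.
  by move: f10; rewrite c0 reM /= mulr0 subr0 pmulr_lgt0.
have D1 : half_disk (row2 1 0 : pt).
  by rewrite /half_disk /= row2E0 row2E1; split; lra.
have [n1 _] : sqnormc (f (row2 1 0)) = 1 /\ exists m : R, zcoord (row2 1 0) * f1 (row2 1 0) = Complex m 0 * f (row2 1 0).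
  apply: f_arc; last by rewrite row2E0.
  by rewrite /half_circle /= row2E0 row2E1; split; lra.
have z1 : zcoord (row2 1 0 : pt) = 1 by rewrite /zcoord row2E0 row2E1.
have Nc : sqnormc c * sqnormc (W (row2 1 0)) = sqnormc (W (row2 1 0)).
  rewrite -sqnormcM -hc // -[h _]mulr1 -z1 mobius_hE.
  move: n1; rewrite /sqnormc /W !(reD, imD, reM, imM, reN, imN) /=.
  move: (re _) (im _) => X Y XY.
  have -> : (X - 0) ^+ 2 + (Y - a) ^+ 2 = X ^+ 2 + Y ^+ 2 - 2 * a * Y + a ^+ 2 by ring.
  have -> : (1 + (0 * X - a * Y)) ^+ 2 + (0 + (0 * Y + a * X)) ^+ 2 =
    1 - 2 * a * Y + a ^+ 2 * (X ^+ 2 + Y ^+ 2) by ring.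
  by rewrite XY; ring.
have W1 : sqnormc (W (row2 1 0)) != 0 by apply/sqnormc_neq0/mobius_W_neq0.
have : sqnormc c = 1 by apply: (mulIf W1); rewrite Nc mul1r.
rewrite /sqnormc im_c expr0n addr0 => c2.
have c1 : c = 1 by apply: complexP => //=; nra.
by move=> Dp; rewrite hc // c1 mul1r.
Qed.

Lemma mobius_eq p : half_disk p ->
  f p * (1 - ia * zcoord p) = zcoord p + ia.
Proof.
move=> Dp; have := mobius_hE p; rewrite mobius_h // /W => E.
have -> : zcoord p + ia = (1 + ia * f p) * zcoord p + ia - ia * f p * zcoord p by ring.
by rewrite E; ring.
Qed.

(** One inclusion uses [re f |1 - i a z|^2 = (1 - a^2) x]; for the other, the inverse of the Moebius
    map is the same map with [- a] in place of [a]. *)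
Lemma mobius_image : [set f p | p in half_disk] =
  [set w : C | sqnormc w <= 1 /\ 0 <= re w].
Proof.
have kp := mobius_kappa_gt0.
have /andP[a1 a2] := mobius_center_lt1.
apply/seteqP; split => [_ [p Dp <-]|w [w1 w0]] /=.
  split; first exact: f_le1.
  have E := mobius_eq Dp; case: (Dp) => pn p0.
  have n0 : sqnormc (1 - ia * zcoord p) != 0.
    apply: sqnormc_neq0; apply/negP => /eqP /(congr1 re).
    rewrite reD reN reM /= mul0r sub0r opprK => H.
    have : (a * p 0 1) ^+ 2 <= a ^+ 2.
      by rewrite exprMn ler_piMr ?sqr_ge0 //; have := sqr_ge0 (p 0 0); lra.
    have -> : a * p 0 1 = - 1 by lra.
    by move: kp; rewrite /kappa sqrrN expr1n; lra.
  have np : 0 < sqnormc (1 - ia * zcoord p) by rewrite lt_neqAle eq_sym n0 sqnormc_ge0.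
  have : re (f p) * sqnormc (1 - ia * zcoord p) = p 0 0 * kappa.
    move: (congr1 re E) (congr1 im E).
    rewrite /sqnormc /kappa !(reD, imD, reM, imM, reN, imN) /=.
    move: (re (f p)) (im (f p)) (p 0 0) (p 0 1) => X Y x y E1 E2.
    have e1 : X * (1 + a * y) + Y * (a * x) = x by move: E1; lra.
    have e2 : X * - (a * x) + Y * (1 + a * y) = y + a by move: E2; lra.
    have -> : X * ((1 + - (0 * x - a * y)) ^+ 2 + (0 + - (0 * y + a * x)) ^+ 2) =
      (X * (1 + a * y) + Y * (a * x)) * (1 + a * y) -
      (X * - (a * x) + Y * (1 + a * y)) * (a * x) by ring.
    by rewrite e1 e2; ring.
  by move=> H; rewrite -(pmulr_lge0 _ np) H mulr_ge0 // ltW.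
pose V := 1 + ia * w.
have V0 : V != 0.
  apply/negP => /eqP /(congr1 re); rewrite reD reM /= mul0r sub0r => H.
  have : (a * im w) ^+ 2 <= a ^+ 2.
    by rewrite exprMn ler_piMr ?sqr_ge0 //; move: w1; rewrite /sqnormc; have := sqr_ge0 (re w); lra.
  have -> : a * im w = 1 by lra.
  by move: kp; rewrite /kappa expr1n; lra.
have Vp : 0 < sqnormc V by rewrite lt_neqAle eq_sym sqnormc_ge0 andbT; exact: sqnormc_neq0.
pose z := (w - ia) / V.
have zV : z * V = w - ia by rewrite /z divfK.
pose p : pt := row2 (re z) (im z).
have zp : zcoord p = z by apply: complexP; rewrite /= ?row2E0 ?row2E1.
have Dp : half_disk p.
  rewrite /half_disk /= row2E0 row2E1; split.
    rewrite -/(sqnormc z) -(ler_pM2r Vp) -sqnormcM zV mul1r.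
    move: w1; rewrite /V /sqnormc !(reD, imD, reM, imM, reN, imN) /=.
    move: (re w) (im w) => X Y w1; rewrite -subr_ge0.
    (* The identity [|1 + i a w|^2 - |w - i a|^2 = (1 - a^2)(1 - |w|^2)]. *)
    rewrite [leRHS](_ : _ = (1 - a ^+ 2) * (1 - (X ^+ 2 + Y ^+ 2))); last by ring.
    by rewrite mulr_ge0 // subr_ge0 //; move: kp; rewrite /kappa subr_gt0 => /ltW.
  rewrite /z reM reV imV -/(sqnormc V).
  rewrite [leRHS](_ : _ = (re (w - ia) * re V + im (w - ia) * im V) / sqnormc V); last by ring.
  apply: divr_ge0; last exact: ltW.
  rewrite /V !(reD, imD, reM, imM, reN, imN) /=.
  rewrite [leRHS](_ : _ = (1 - a ^+ 2) * re w); last by ring.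
  by rewrite mulr_ge0 // ltW.
exists p => //.
have := mobius_eq Dp; rewrite zp => E.
(* This number is [1 + ia * ia], that is [kappa], the common factor cancelled at the end. *)
have kc0 : 1 - ia * ia * - 1 != 0.
  apply/negP => /eqP /(congr1 re); rewrite !(reD, reM, imM, reN, imN) /=.
  by move: kp; rewrite /kappa; nra.
have E1 : (1 - ia * z) * V = 1 + ia * ia.
  by rewrite mulrBl mul1r -mulrA zV /V; ring.
have E2 : (z + ia) * V = w * (1 + ia * ia).
  by rewrite mulrDl zV /V; ring.
have : f p * ((1 - ia * z) * V) = (z + ia) * V by rewrite mulrA E.
rewrite E1 E2 => /mulIf; apply.
by move: kc0; rewrite mulrN1 opprK.
Qed.

End Mobius.

(** * Free boundary minimal half-disks *)

Lemma sum_ord2 (V : nmodType) (F : 'I_2 -> V) : \sum_(a < 2) F a = F 0 + F 1.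
Proof.
rewrite big_ord_recl big_ord1; congr (F _ + F _); exact: val_inj.
Qed.

Lemma ex_eq (T : Type) (x : T) : exists y, y = x.
Proof. by exists x. Qed.

Lemma sum_scalar_mx2 (K : pzRingType) (V : lmodType K) (c : K) (F : 'I_2 -> 'I_2 -> V) :
  \sum_(a < 2) \sum_(b < 2) (c%:M : 'M[K]_2) a b *: F a b = c *: (F 0 0 + F 1 1).
Proof.
by rewrite !sum_ord2 !mxE /= !mulr1n !mulr0n !scale0r addr0 add0r scalerDr.
Qed.

Lemma sum_scalar_mx2_outer (K : pzRingType) (V : lmodType K) (c : K) (g : 'I_2 -> K) (h : 'I_2 -> V) :
  \sum_(a < 2) \sum_(b < 2) ((c%:M : 'M[K]_2) a b * g a) *: h b =
  c *: (g 0 *: h 0 + g 1 *: h 1).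
Proof.
by rewrite !sum_ord2 !mxE /= !mulr1n !mulr0n !mul0r !scale0r addr0 add0r scalerDr !scalerA.
Qed.

Section SumDerive.
Context (R : realType) (V : normedModType R) (I : Type) (r : seq I).
Implicit Types (g : I -> V -> R).

Lemma is_derive_mulc (g : V -> R) p v c d : is_derive p v g d ->
  is_derive p v (fun q => c * g q) (c * d).
Proof. by move=> dg; exact: is_deriveZ. Qed.

Lemma is_derive_bigsum g p v (d : I -> R) : (forall i, is_derive p v (g i) (d i)) ->
  is_derive p v (fun q => \sum_(i <- r) g i q) (\sum_(i <- r) d i).
Proof.
move=> dg; elim: r => [|i s IHs].
  under [X in is_derive _ _ X]eq_fun do rewrite big_nil.
  by rewrite big_nil; exact: is_derive_cst.
under [X in is_derive _ _ X]eq_fun do rewrite big_cons.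
by rewrite big_cons; exact: is_deriveD.
Qed.

Lemma differentiable_bigsum g p : (forall i, differentiable (g i) p) ->
  differentiable (fun q => \sum_(i <- r) g i q) p.
Proof.
move=> dg; elim: r => [|i s IHs].
  rewrite (_ : (fun q => _) = cst 0); first exact: differentiable_cst.
  by apply/funext => q; rewrite big_nil.
rewrite (_ : (fun q => _) = g i \+ (fun q => \sum_(i <- s) g i q)).
  exact: differentiableD.
by apply/funext => q; rewrite big_cons.
Qed.

End SumDerive.

Section Arc.
Context (R : realType).
Local Notation pt := 'rV[R]_2.

(** Chain rule along the rotation [t |-> e^(it) p], whose velocity at [t = 0] is the given tangent
    vector. The condition [0 < p 0 0] keeps the rotated point in the right half-plane for small
    [t]. *)
Lemma arc_derive_eq0 (g : pt -> R) (p : pt) d : half_circle p -> 0 < p 0 0 ->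
  differentiable g p ->
  (forall q, half_circle q -> 0 < q 0 0 -> g q = 0) ->
  is_derive p (row2 (- p 0 1) (p 0 0)) g d -> d = 0.
Proof.
move=> [pn _] p0 dg g0 [_ <-].
set x := p 0 0 in pn p0 *; set y := p 0 1 in pn *.
pose c (t : R) : pt := row2 (x * cos t - y * sin t) (y * cos t + x * sin t).
have c0 : c 0 = p.
  by rewrite /c cos0 sin0 !mulr1 !mulr0 subr0 addr0 row2K.
have d0 : is_derive (0 : R) 1 (fun t => x * cos t - y * sin t) (- y).
  apply: is_derive_eq (is_deriveB (is_deriveZ x (is_derive_cos 0))
    (is_deriveZ y (is_derive_sin 0))) _.
  by rewrite cos0 sin0 /GRing.scale /=; ring.
have d1 : is_derive (0 : R) 1 (fun t => y * cos t + x * sin t) x.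
  apply: is_derive_eq (is_deriveD (is_deriveZ y (is_derive_cos 0))
    (is_deriveZ x (is_derive_sin 0))) _.
  by rewrite cos0 sin0 /GRing.scale /=; ring.
have cE j : (fun t => c t 0 j) = if j == 0 then (fun t => x * cos t - y * sin t)
    else (fun t => y * cos t + x * sin t).
  by apply/funext => t; rewrite /c mxE; case: ifP.
have dc : derivable c 0 1.
  by apply/derivable_mxP => i j; rewrite (ord1 i) cE; case: ifP => _; [case: d0|case: d1].
have c'0 : 'D_1 c 0 = row2 (- y) x.
  rewrite derive_mx //; apply/matrixP => i j; rewrite (ord1 i) !mxE cE.
  by case: ifP => _; [case: d0|case: d1].
have dc' : differentiable c 0 by apply/derivable1_diffP.
have dgc : differentiable g (c 0) by rewrite c0.
rewrite deriveE // -c'0 deriveE //.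
suff : 'd g (c 0) ('d c 0 1) = 0 by rewrite c0.
rewrite -[LHS]/(('d g (c 0) \o 'd c 0) 1) -diff_comp // -deriveE; last first.
  exact: differentiable_comp.
have xc : \forall t \near (0 : R), 0 < x * cos t - y * sin t.
  have cx : {for (0 : R), continuous (fun t : R => x * cos t - y * sin t)}.
    by apply: differentiable_continuous; apply/derivable1_diffP; case: d0.
  apply: (cvgr_gt (x * cos 0 - y * sin 0) cx).
  by rewrite cos0 sin0 mulr1 mulr0 subr0.
rewrite (near_eq_derive (g := cst 0)) ?derive_cst //.
near=> t; rewrite /= g0 //.
- split; last by rewrite row2E0 ltW //; near: t; exact: xc.
  rewrite row2E0 row2E1 -pn.
  have -> : (x * cos t - y * sin t) ^+ 2 + (y * cos t + x * sin t) ^+ 2 =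
    (x ^+ 2 + y ^+ 2) * (cos t ^+ 2 + sin t ^+ 2) by ring.
  by rewrite cos2Dsin2 mulr1.
- by rewrite row2E0; near: t; exact: xc.
Unshelve. all: by end_near.
Qed.

End Arc.

(* Locked because comparing two different derivatives by unfolding is
   prohibitively slow. *)
HB.lock Definition coord_derive (R : realType) (n : nat)
    (f : 'rV[R]_2 -> 'rV[R]_n) (vs : seq 'rV[R]_2) (k : 'I_n) (q : 'rV[R]_2) : R :=
  foldr (fun v g => 'D_v g) f vs q 0 k.

(** * One conformal minimal face: harmonicity and the condition on the arc *)

Section Face.
Context (R : realType) (n : nat).
Local Notation pt := 'rV[R]_2.
Local Notation C := R[i].
Local Notation re := (@complex.Re R).
Local Notation im := (@complex.Im R).
Local Notation ex := (basis_vec R 0).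
Local Notation ey := (basis_vec R 1).
Context (f : pt -> 'rV[R]_n) (U : set pt).
Hypothesis openU : open U.
Hypothesis DU : half_disk `<=` U.
Hypothesis smU : smooth_on U f.
Hypothesis conf : forall p, half_disk p -> conformal_at f p.
Hypothesis H0 : forall p, half_disk p -> mean_curvature_vector f p = 0.
Hypothesis f_sphere : forall p, half_circle p ->
    unit_sphere (f p) /\
    forall eta : 'rV[R]_n, half_circle_conormal f p eta ->
      normal_to_sphere_at (f p) eta.

Local Notation pd := (coord_derive f).

Lemma near_U q : U q -> \forall r \near q, U r.
Proof. by move=> Uq; apply: open_nbhs_nbhs. Qed.

Lemma near_open (q : pt) : open_half_disk q -> \forall r \near q, open_half_disk r.
Proof.
by move=> oq; apply: open_nbhs_nbhs; split => //; exact: open_half_disk_open.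
Qed.

Lemma open_U q : open_half_disk q -> U q.
Proof. by move=> /open_half_disk_sub /DU. Qed.

Lemma pd_diff vs k q : U q -> differentiable (pd vs k) q.
Proof.
move=> Uq; rewrite (_ : pd vs k = (fun N : 'rV[R]_n => N 0 k) \o
  (foldr (fun v g => 'D_v g) f vs)); last by rewrite coord_derive.unlock.
by apply: differentiable_comp; [exact: smU|exact: differentiable_coord].
Qed.

Lemma pd_cont vs k q : U q -> {for q, continuous (pd vs k)}.
Proof. by move=> Uq; apply: differentiable_continuous; exact: pd_diff. Qed.

Lemma pd_derive vs k q v : U q -> is_derive q v (pd vs k) (pd (v :: vs) k q).
Proof.
move=> Uq; rewrite coord_derive.unlock.
apply: is_derive_coord; apply: derivableP.
by apply: diff_derivable; exact: smU.
Qed.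

Lemma pd_swap vs k q v w : U q -> pd (v :: w :: vs) k q = pd (w :: v :: vs) k q.
Proof.
move=> Uq; have nU := near_U Uq.
apply: (@derive_comm R _ (pd vs k) (pd (w :: vs) k) (pd (v :: vs) k) q w v).
- by apply: filterS nU => r Ur; exact: pd_diff.
- by apply: filterS nU => r Ur; exact: pd_derive.
- by apply: filterS nU => r Ur; exact: pd_derive.
- exact: pd_diff.
- exact: pd_diff.
- exact: pd_derive.
- exact: pd_derive.
Qed.

Lemma pd_dir vs k q a b : U q ->
  pd (row2 a b :: vs) k q = a * pd (ex :: vs) k q + b * pd (ey :: vs) k q.
Proof.
move=> Uq.
have E v : pd (v :: vs) k q = 'd (pd vs k) q v.
  by rewrite -deriveE; [case: (pd_derive vs k v Uq)|exact: pd_diff].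
by rewrite !E row2_basisE linearD !linearZ.
Qed.

Lemma pd_diffE q v k : U q -> 'd f q v 0 k = pd [:: v] k q.
Proof. by move=> Uq; rewrite coord_derive.unlock /= deriveE //; exact: (smU [::]). Qed.

Lemma pd0E k p : pd [::] k p = f p 0 k.
Proof. by rewrite coord_derive.unlock. Qed.

Lemma pd2E v w k p : 'D_v ('D_w f) p 0 k = pd [:: v; w] k p.
Proof. by rewrite coord_derive.unlock. Qed.

Lemma dot_basis (a b : 'I_2) : dot (basis_vec R a) (basis_vec R b) = (a == b)%:R.
Proof.
rewrite /dot (bigD1 a) //= !mxE eqxx /= eqxx mul1r big1 ?addr0 //.
by move=> i ia; rewrite !mxE (negbTE ia) andbF mul0r.
Qed.

Lemma pd_conformal p : half_disk p -> exists2 l : R, 0 < l &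
  [/\ \sum_k pd [:: ex] k p * pd [:: ex] k p = l ^+ 2,
      \sum_k pd [:: ey] k p * pd [:: ey] k p = l ^+ 2 &
      \sum_k pd [:: ex] k p * pd [:: ey] k p = 0].
Proof.
move=> Dp; have [l l0 cl] := conf Dp; exists l => //.
have E a b : \sum_k pd [:: basis_vec R a] k p * pd [:: basis_vec R b] k p =
    l ^+ 2 * (a == b)%:R.
  rewrite -dot_basis -cl /dot; apply: eq_bigr => k _.
  by rewrite !pd_diffE //; exact: DU.
split.
- by rewrite E mulr1.
- by rewrite E mulr1.
- by rewrite E mulr0.
Qed.

Lemma is_derive_open_eq0 (g : pt -> R) p v d : open_half_disk p ->
  (forall q, open_half_disk q -> g q = 0) -> is_derive p v g d -> d = 0.
Proof.
move=> op g0 [_ <-].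
by rewrite (near_eq_derive (g := cst 0)) ?derive_cst //; apply: filterS (near_open op) => q /g0.
Qed.

(** Conformality forces the Laplacian of [u] to be normal to the surface: the derivative of
    [|u_x|^2 - |u_y|^2 = 0] in one variable is combined with that of [u_x . u_y = 0] in the
    other. *)
Lemma pd_laplace_tangent p : open_half_disk p ->
  \sum_k pd [:: ex] k p * (pd [:: ex; ex] k p + pd [:: ey; ey] k p) = 0 /\
  \sum_k pd [:: ey] k p * (pd [:: ex; ex] k p + pd [:: ey; ey] k p) = 0.
Proof.
move=> op; have Up := open_U op.
have dE v : \sum_k (pd [:: ex] k p * pd [:: v; ex] k p -
                    pd [:: ey] k p * pd [:: v; ey] k p) = 0.
  pose G q := \sum_k pd [:: ex] k q * pd [:: ex] k q - \sum_k pd [:: ey] k q * pd [:: ey] k q.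
  have G0 q : open_half_disk q -> G q = 0.
    move=> oq; have Dq := open_half_disk_sub oq.
    have [l _ [e1 e2 _]] := pd_conformal Dq.
    by rewrite /G e1 e2 subrr.
  have dsq w : is_derive p v (fun q => \sum_k pd [:: w] k q * pd [:: w] k q)
      (\sum_k (pd [:: w] k p * pd [:: v; w] k p + pd [:: w] k p * pd [:: v; w] k p)).
    apply: (@is_derive_bigsum _ _ _ _ (fun k q => pd [:: w] k q * pd [:: w] k q)) => k.
    exact: is_deriveM (pd_derive [:: w] k v Up) (pd_derive [:: w] k v Up).
  have := is_derive_open_eq0 op G0 (is_deriveB (dsq ex) (dsq ey)).
  rewrite !big_split /= sumrN.
  move: (\sum_k pd [:: ex] k p * _) (\sum_k pd [:: ey] k p * _) => s t; lra.
have dF v : \sum_k (pd [:: ex] k p * pd [:: v; ey] k p +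
                    pd [:: ey] k p * pd [:: v; ex] k p) = 0.
  apply: (@is_derive_open_eq0 (fun q => \sum_k pd [:: ex] k q * pd [:: ey] k q) p v) => //.
    by move=> q /open_half_disk_sub /pd_conformal [l _ [_ _]].
  apply: (@is_derive_bigsum _ _ _ _ (fun k q => pd [:: ex] k q * pd [:: ey] k q)) => k.
  exact: is_deriveM (pd_derive [:: ex] k v Up) (pd_derive [:: ey] k v Up).
split.
- transitivity (\sum_k (pd [:: ex] k p * pd [:: ex; ex] k p - pd [:: ey] k p * pd [:: ex; ey] k p) +
     \sum_k (pd [:: ex] k p * pd [:: ey; ey] k p + pd [:: ey] k p * pd [:: ey; ex] k p)).
    rewrite -big_split /=; apply: eq_bigr => k _.
    by rewrite (pd_swap [::] k ex ey Up); ring.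
  by rewrite dE dF addr0.
- transitivity (\sum_k (pd [:: ex] k p * pd [:: ex; ey] k p + pd [:: ey] k p * pd [:: ex; ex] k p) -
     \sum_k (pd [:: ex] k p * pd [:: ey; ex] k p - pd [:: ey] k p * pd [:: ey; ey] k p)).
    rewrite -sumrB /=; apply: eq_bigr => k _.
    by rewrite (pd_swap [::] k ex ey Up); ring.
  by rewrite dE dF subr0.
Qed.

(** In a conformal chart the mean curvature vector is [l^-2] times the normal part of the Laplacian,
    and the tangential part is already known to vanish; the boundary is reached by density. *)
Lemma pd_harmonic p k : half_disk p -> pd [:: ex; ex] k p + pd [:: ey; ey] k p = 0.
Proof.
move=> Dp; apply: (@half_disk_dense R (fun q => pd [:: ex; ex] k q + pd [:: ey; ey] k q)) => //.
  by apply: continuousD; apply: pd_cont; exact: DU.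
move=> {Dp} {}p op; have Dp := open_half_disk_sub op; have Up := DU Dp.
have [t1 t2] := pd_laplace_tangent op.
have [l l0 cl] := conf Dp.
have F1 : first_fundamental_form f p = (l ^+ 2)%:M.
  by apply/matrixP => a b; rewrite !mxE cl dot_basis mulr_natr.
have I1 : invmx (first_fundamental_form f p) = (l ^- 2)%:M by rewrite F1 invmx_scalar.
have [fx fxE] := ex_eq ('d f p ex : 'rV[R]_n).
have [fy fyE] := ex_eq ('d f p ey : 'rV[R]_n).
have [vx vxE] := ex_eq ('D_ex ('D_ex f) p).
have [vy vyE] := ex_eq ('D_ey ('D_ey f) p).
have normE v : normal_part f p v = v - l ^- 2 *: (dot v fx *: fx + dot v fy *: fy).
  rewrite /normal_part I1 fxE fyE.
  by congr (_ - _); exact: (sum_scalar_mx2_outer _ (fun a => dot v ('d f p (basis_vec R a)))).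
have HE : l ^- 2 *: (normal_part f p vx + normal_part f p vy) = 0.
  rewrite vxE vyE -[RHS](H0 Dp) /mean_curvature_vector I1; apply/esym.
  exact: (sum_scalar_mx2 _ (second_fundamental_form f p)).
rewrite (normE vx) (normE vy) in HE.
have dxE (v : 'rV[R]_n) : dot v fx = \sum_i pd [:: ex] i p * v 0 i.
  by apply: eq_bigr => i _; rewrite fxE pd_diffE // mulrC.
have dyE (v : 'rV[R]_n) : dot v fy = \sum_i pd [:: ey] i p * v 0 i.
  by apply: eq_bigr => i _; rewrite fyE pd_diffE // mulrC.
have vxk i : vx 0 i = pd [:: ex; ex] i p.
  rewrite vxE; exact: pd2E.
have vyk i : vy 0 i = pd [:: ey; ey] i p.
  rewrite vyE; exact: pd2E.
have hx : dot vx fx + dot vy fx = 0.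
  rewrite !dxE -big_split /= -[RHS]t1; apply: eq_bigr => i _.
  by rewrite vxk vyk mulrDr.
have hy : dot vx fy + dot vy fy = 0.
  rewrite !dyE -big_split /= -[RHS]t2; apply: eq_bigr => i _.
  by rewrite vxk vyk mulrDr.
rewrite -vxk -vyk.
have := congr1 (fun w : 'rV[R]_n => w 0 k) HE.
have -> : dot vy fx = - dot vx fx by apply/eqP; rewrite -addr_eq0 addrC hx.
have -> : dot vy fy = - dot vx fy by apply/eqP; rewrite -addr_eq0 addrC hy.
rewrite !mxE => H.
have l2 : l ^- 2 != 0 by rewrite invr_neq0 // expf_neq0 // lt0r_neq0.
by apply: (mulfI l2); rewrite mulr0 -[RHS]H; ring.
Qed.

(** Provides one of the Cauchy-Riemann equations for every [Y i]; the other is the symmetry of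
    second derivatives. *)
Lemma pd_harmonic_iter i p k : open_half_disk p ->
  pd [:: ex, ex & nseq i ex] k p + pd [:: ey, ey & nseq i ex] k p = 0.
Proof.
elim: i p => [|i IHi] p op; first by apply: pd_harmonic; exact: open_half_disk_sub.
have Up := open_U op.
apply: (is_derive_open_eq0 op IHi (v := ex)) => /=.
(* Two exchanges: the inner one holds near [p] and may be differentiated, the outer one is made at
   [p]. *)
have -> : pd [:: ey, ey, ex & nseq i ex] k p = pd [:: ex, ey, ey & nseq i ex] k p.
  have [_ <-] := pd_derive [:: ey, ex & nseq i ex] k ey Up.
  rewrite (near_eq_derive (g := pd [:: ex, ey & nseq i ex] k)).
    by have [_ ->] := pd_derive [:: ex, ey & nseq i ex] k ey Up; exact: pd_swap.
  by apply: filterS (near_U Up) => q Uq; exact: pd_swap.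
exact: is_deriveD (pd_derive _ k ex Up) (pd_derive _ k ex Up).
Qed.

(* [Y 0 = u_x - i u_y], and [Y i] is its [i]-th complex derivative. *)
Definition Y i (k : 'I_n) (q : pt) : C :=
  Complex (pd (ex :: nseq i ex) k q) (- pd (ey :: nseq i ex) k q).

Lemma ccont_Y i k q : U q -> ccont (Y i k) q.
Proof.
move=> Uq; split => /=; first exact: pd_cont.
by apply: continuousN; exact: pd_cont.
Qed.

Lemma cderiv_Y i k p : open_half_disk p -> cderiv (Y i k) p (Y i.+1 k p).
Proof.
move=> op; have Up := open_U op; split => /=.
- exact: pd_derive.
- by rewrite pd_swap //; apply: is_deriveN; exact: pd_derive.
- by rewrite opprK; exact: pd_derive.
- have -> : pd [:: ex, ex & nseq i ex] k p = - pd [:: ey, ey & nseq i ex] k p.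
    by apply/eqP; rewrite -addr_eq0 pd_harmonic_iter.
  by apply: is_deriveN; exact: pd_derive.
Qed.

Lemma hol2_Y i k : hol2 (Y i k).
Proof. by exists (Y i.+1 k), (Y i.+2 k) => p op; split; exact: cderiv_Y. Qed.

Lemma re_sum (I : Type) (r : seq I) (F : I -> C) : re (\sum_(i <- r) F i) = \sum_(i <- r) re (F i).
Proof. by elim: r => [|i r IH]; rewrite ?big_nil // !big_cons reD IH. Qed.

Lemma im_sum (I : Type) (r : seq I) (F : I -> C) : im (\sum_(i <- r) F i) = \sum_(i <- r) im (F i).
Proof. by elim: r => [|i r IH]; rewrite ?big_nil // !big_cons imD IH. Qed.

(** Conformality in complex form: [Y . Y = |u_x|^2 - |u_y|^2 - 2 i u_x . u_y]. *)
Lemma Y_isotropic p : half_disk p -> \sum_k Y 0 k p * Y 0 k p = 0.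
Proof.
move=> /pd_conformal [l _ [e1 e2 e3]]; apply: complexP.
- rewrite re_sum; under eq_bigr do rewrite reM /= mulrNN.
  by rewrite sumrB e1 e2 subrr.
- rewrite im_sum; under eq_bigr do rewrite imM /= mulrN mulNr [X in _ - X]mulrC -opprD -mulr2n -mulNrn.
  by rewrite sumrMnl sumrN e3 oppr0 mul0rn.
Qed.

Lemma Y_isotropic' p : half_disk p -> \sum_k Y 0 k p * Y 1 k p = 0.
Proof.
move=> Dp; apply: (@half_disk_dense_eq R (fun p => \sum_k Y 0 k p * Y 1 k p) (fun=> 0) p Dp) => [||q oq].
- by apply: ccont_sum => k; apply: ccontM; apply: ccont_Y; exact: DU.
- exact: ccont_cst.
have dY : cderiv (fun q => \sum_k Y 0 k q * Y 0 k q) q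
    (\sum_k (Y 1 k q * Y 0 k q + Y 0 k q * Y 1 k q)).
  by apply: cderiv_sum => k; apply: cderivM; exact: cderiv_Y.
have z r : open_half_disk r -> \sum_k Y 0 k r * Y 0 k r = 0.
  by move=> /open_half_disk_sub; exact: Y_isotropic.
have [d1 d2 _ _] := dY.
have e1 := is_derive_open_eq0 oq (fun r orr => congr1 re (z r orr)) d1.
have e2 := is_derive_open_eq0 oq (fun r orr => congr1 im (z r orr)) d2.
have : \sum_k (Y 1 k q * Y 0 k q + Y 0 k q * Y 1 k q) = 0 by apply: complexP.
under eq_bigr do rewrite mulrC -mulr2n.
by rewrite sumrMnl => /eqP; rewrite mulrn_eq0 /= => /eqP.
Qed.

(** By conformality [du (p / l)] is the outward unit conormal at a point of the arc; orthogonality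
    to the sphere makes it a multiple of [f p]. *)
Lemma arc_radial p : half_circle p -> exists2 m : R, m != 0 & forall k,
  p 0 0 * pd [:: ex] k p + p 0 1 * pd [:: ey] k p = m * f p 0 k.
Proof.
move=> cp; have Dp : half_disk p by case: cp => pn p0; split => //; rewrite pn.
have Up := DU Dp.
have [l l0 cl] := conf Dp.
have [fs fn] := f_sphere cp.
have pn : dot p p = 1 by rewrite /dot sum_ord2 -!expr2; case: cp.
have pE v : 'd f p v = v 0 0 *: 'd f p ex + v 0 1 *: 'd f p ey.
  by rewrite -{1}(row2K v) row2_basisE linearD !linearZ.
have ff : dot (f p) (f p) = 1.
  move: fs; rewrite /unit_sphere /= /enorm => /(congr1 (fun x => x ^+ 2)).
  by rewrite expr1n sqr_sqrtr // sumr_ge0 // => i _; rewrite -expr2 sqr_ge0.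
pose eta := 'd f p (l^-1 *: p).
have dotZl (c : R) m' (v w : 'rV[R]_m') : dot (c *: v) w = c * dot v w.
  by rewrite /dot mulr_sumr; apply: eq_bigr => i _; rewrite mxE mulrA.
have dotZr (c : R) m' (v w : 'rV[R]_m') : dot v (c *: w) = c * dot v w.
  by rewrite /dot mulr_sumr; apply: eq_bigr => i _; rewrite mxE mulrCA.
have l0' := lt0r_neq0 l0.
have nE : normal_to_sphere_at (f p) eta.
  apply: fn; split.
  - rewrite /enorm /eta cl dotZl dotZr pn mulr1.
    by rewrite -expr2 -exprMn mulfV // expr1n sqrtr1.
  - rewrite /eta cl dotZl /dot sum_ord2 row2E0 row2E1; ring.
  - exists (l^-1 *: p) => //.
    by rewrite dotZl pn mulr1 invr_gt0.
(* The part of [eta] tangent to the sphere serves as test vector in the free boundary condition, and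
   it turns out to be orthogonal to itself. *)
pose w := eta - dot eta (f p) *: f p.
have dotBl m' (u v w' : 'rV[R]_m') : dot (u - v) w' = dot u w' - dot v w'.
  by rewrite /dot -sumrB; apply: eq_bigr => i _; rewrite !mxE mulrBl.
have dotC m' (u v : 'rV[R]_m') : dot u v = dot v u.
  by apply: eq_bigr => i _; rewrite mulrC.
have wf : dot w (f p) = 0 by rewrite dotBl dotZl ff mulr1 subrr.
have we := nE w wf.
have ww : dot w w = 0.
  by rewrite {2}/w [dot w _]dotC dotBl dotZl dotC we [dot (f p) w]dotC wf mulr0 subrr.
have w0 k : eta 0 k = dot eta (f p) * f p 0 k.
  apply/eqP; rewrite -subr_eq0 -sqrf_eq0.
  have := ww; rewrite /dot => /eqP; rewrite psumr_eq0.
    by move=> /allP /(_ k); rewrite mem_index_enum => /(_ isT) /=; rewrite !mxE -expr2.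
  by move=> i _; rewrite -expr2 sqr_ge0.
have ee : dot eta eta = 1.
  rewrite /eta cl dotZl dotZr pn mulr1.
  by rewrite -expr2 -exprMn mulfV // expr1n.
exists (l * dot eta (f p)).
  apply: mulf_neq0 => //; apply/eqP => d0.
  move: ee; rewrite /dot big1; first by move/eqP; rewrite eq_sym oner_eq0.
  by move=> i _; rewrite w0 d0 !mul0r.
move=> k; rewrite -mulrA -w0 /eta linearZ mxE mulrA mulfV // mul1r pE !mxE !pd_diffE //.
Qed.

Lemma sphere_sum p : half_circle p -> \sum_k f p 0 k ^+ 2 = 1.
Proof.
move=> cp; have [fs _] := f_sphere cp.
move: fs; rewrite /unit_sphere /= /enorm => /(congr1 (fun x => x ^+ 2)).
rewrite expr1n sqr_sqrtr /dot => [<-|]; first by apply: eq_bigr => i _; rewrite expr2.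
by rewrite sumr_ge0 // => i _; rewrite -expr2 sqr_ge0.
Qed.

(* On the arc [z Y = u_r - i u_t], and [z^2 Y'] is the sum of a multiple of it
   and of the (real) normal part of the second derivative [u_rr]. *)
Lemma arc_second p : half_circle p -> 0 < p 0 0 -> exists s : C, forall k,
  im (zcoord p ^+ 2 * Y 1 k p - s * (zcoord p * Y 0 k p)) = 0.
Proof.
move=> cp p0.
have circ_D (q : pt) : half_circle q -> half_disk q.
  by case=> qn q0; split => //; rewrite qn.
have Up := DU (circ_D p cp).
pose rad k (q : pt) := q 0 0 * pd [:: ex] k q + q 0 1 * pd [:: ey] k q.
(* Since [|u| = 1] on the arc, the factor in [u_r = m u] is [u_r . u], an expression that can be
   differentiated. *)
pose M q := \sum_k rad k q * pd [::] k q.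
have rad0 q k : half_circle q -> rad k q - M q * pd [::] k q = 0.
  move=> cq; have [m m0 hm] := arc_radial cq.
  have -> : M q = m.
    rewrite /M -[RHS]mulr1 -(sphere_sum cq) mulr_sumr; apply: eq_bigr => l _.
    by rewrite /rad hm pd0E -mulrA.
  by rewrite /rad hm pd0E subrr.
have Mp : M p != 0.
  have [m m0 hm] := arc_radial cp.
  rewrite (_ : M p = m) // /M -[RHS]mulr1 -(sphere_sum cp) mulr_sumr; apply: eq_bigr => l _.
  by rewrite /rad hm pd0E -mulrA.
pose t : pt := row2 (- p 0 1) (p 0 0).
have dx : is_derive p t (fun q : pt => q 0 0) (- p 0 1).
  by apply: is_derive_eq (is_derive_coordE _ _ _) _; rewrite row2E0.
have dy : is_derive p t (fun q : pt => q 0 1) (p 0 0).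
  by apply: is_derive_eq (is_derive_coordE _ _ _) _; rewrite row2E1.
have drad k : is_derive p t (rad k)
   (p 0 0 *: pd [:: t; ex] k p + pd [:: ex] k p *: - p 0 1 +
    (p 0 1 *: pd [:: t; ey] k p + pd [:: ey] k p *: p 0 0)).
  exact: is_deriveD (is_deriveM dx (pd_derive [:: ex] k t Up)) (is_deriveM dy (pd_derive [:: ey] k t Up)).
have [dM hM] : exists dM, is_derive p t M dM.
  eexists; apply: (@is_derive_bigsum _ _ _ _ (fun k q => rad k q * pd [::] k q)) => k.
  exact: is_deriveM (drad k) (pd_derive [::] k t Up).
have diff_rad k : differentiable (rad k) p.
  have d1 : differentiable ((fun q : pt => q 0 0) * pd [:: ex] k) p.
    by apply: differentiableM; [exact: differentiable_coord|exact: pd_diff].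
  have d2 : differentiable ((fun q : pt => q 0 1) * pd [:: ey] k) p.
    by apply: differentiableM; [exact: differentiable_coord|exact: pd_diff].
  exact: differentiableD d1 d2.
have diff_M : differentiable M p.
  by apply: (@differentiable_bigsum _ _ _ _ (fun k q => rad k q * pd [::] k q)) => k; apply: differentiableM => //; exact: pd_diff.
have key k := arc_derive_eq0 cp p0
  (differentiableB (diff_rad k) (differentiableM diff_M (pd_diff [::] k Up)))
  (fun q cq _ => rad0 q k cq)
  (is_deriveB (drad k) (is_deriveM hM (pd_derive [::] k t Up))).
(* Differentiating [u_r = M u] along the arc gives [im (z^2 Y') = - (M - 1) u_t - dM u] with
   [u = u_r / M]. As [z Y = u_r - i u_t], this is the imaginary part of [s z Y] for the present
   [s]. *)
exists (Complex (M p - 1) (- (dM / M p))) => k.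
have := key k; rewrite /GRing.scale /= /t !pd_dir //.
have := rad0 p k cp; rewrite /rad.
have := pd_harmonic k (circ_D p cp).
rewrite [pd [:: ex; ey] k p]pd_swap //.
rewrite ?expr2 ?(reD, imD, reN, imN, reM, imM) /=.
move: (pd [:: ex] k p) (pd [:: ey] k p) (pd [:: ex; ex] k p) (pd [:: ey; ex] k p)
  (pd [:: ey; ey] k p) (pd [::] k p) (p 0 0) (p 0 1) (M p) Mp
  => X Yv A B D u x y m m0 harm hrad hk.
have DE : D = - A by lra.
rewrite DE in hk.
have u_E : u = (x * X + y * Yv) / m.
  by apply: (mulIf m0); rewrite divfK //; lra.
have hB : - (2 * x * y * A) + (x * x - y * y) * B + (m - 1) * (y * X - x * Yv)  = dM * u.
  by lra.
have -> : (x * x - y * y) * - B + (x * y + y * x) * A -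
  ((m - 1) * (x * - Yv + y * X) + - (dM / m) * (x * X - y * - Yv)) =
  - (- (2 * x * y * A) + (x * x - y * y) * B + (m - 1) * (y * X - x * Yv)) +
  dM * ((x * X + y * Yv) / m) by field.
by rewrite hB u_E; ring.
Qed.

(** Here [N = z^2 Y' - s z Y]. In the sum of its squares the terms with [Y . Y] and [Y . Y'] drop
    out by isotropy. *)
Lemma arc_quartic p : half_circle p -> 0 < p 0 0 -> exists (s : C) (N : 'I_n -> R),
  (forall k, zcoord p ^+ 2 * Y 1 k p = s * (zcoord p * Y 0 k p) + Complex (N k) 0) /\
  \sum_k (zcoord p ^+ 2 * Y 1 k p) ^+ 2 = Complex (\sum_k N k ^+ 2) 0.
Proof.
move=> cp p0; have [s hs] := arc_second cp p0.
have Dp : half_disk p by case: cp => pn px; split => //; rewrite pn.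
set z := zcoord p in hs *.
pose N k := re (z ^+ 2 * Y 1 k p - s * (z * Y 0 k p)).
have hN k : z ^+ 2 * Y 1 k p = s * (z * Y 0 k p) + Complex (N k) 0.
  rewrite (_ : Complex (N k) 0 = z ^+ 2 * Y 1 k p - s * (z * Y 0 k p)).
    by rewrite addrCA subrr addr0.
  by apply: complexP => //=; rewrite hs.
exists s, N; split => //.
have i1 := Y_isotropic Dp; have i2 := Y_isotropic' Dp.
have -> : Complex (\sum_k N k ^+ 2) 0 = \sum_k (Complex (N k) 0) ^+ 2 :> C.
  apply: complexP; first by rewrite re_sum; apply: eq_bigr => k _; rewrite /= mulr0 subr0.
  by rewrite [LHS]/= im_sum big1 // => k _; rewrite /= mulr0 mul0r addr0.
have NE k : Complex (N k) 0 = z ^+ 2 * Y 1 k p - s * (z * Y 0 k p).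
  by rewrite hN addrC addKr.
transitivity (\sum_k (Complex (N k) 0) ^+ 2 - (s * z) ^+ 2 * (\sum_k Y 0 k p * Y 0 k p)
   + 2 * s * z ^+ 3 * (\sum_k Y 0 k p * Y 1 k p)); last first.
  by rewrite i1 i2 !mulr0 subr0 addr0.
rewrite !mulr_sumr -sumrB -big_split /=; apply: eq_bigr => k _.
by rewrite NE; ring.
Qed.

(** * Flatness of a face whose quartic differential vanishes on the arc *)

Section Flat.
Hypothesis quartic0 : forall p, half_circle p -> 0 < p 0 0 ->
  \sum_k (zcoord p ^+ 2 * Y 1 k p) ^+ 2 = 0.

(** The real vector [N] has norm zero on the arc, so [Y'] is a multiple of [Y] there. The 2 by 2
    minors of [Y] and [Y'] are holomorphic and vanish on the arc, hence everywhere. *)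
Lemma Y_parallel p k l : open_half_disk p -> Y 0 k p * Y 1 l p = Y 0 l p * Y 1 k p.
Proof.
move=> op; apply/eqP; rewrite -subr_eq0 -mulN1r; apply/eqP.
move: p op; apply: (@hol2_arc_unique R (fun p => Y 0 k p * Y 1 l p + - 1 * (Y 0 l p * Y 1 k p))).
- apply: hol2D; first by apply: hol2M; exact: hol2_Y.
  by apply: hol2M; [exact: hol2_cst|apply: hol2M; exact: hol2_Y].
- move=> p /DU Up; apply: ccontD; first by apply: ccontM; exact: ccont_Y.
  by apply: ccontM; [exact: ccont_cst|apply: ccontM; exact: ccont_Y].
move=> p cp p0; have [s [N [hN hS]]] := arc_quartic cp p0.
rewrite quartic0 // in hS.
have N0 i : N i = 0.
  have /esym/eqP := congr1 re hS; rewrite /= psumr_eq0 => [|j _]; last exact: sqr_ge0.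
  by move=> /allP /(_ i); rewrite mem_index_enum sqrf_eq0 => /(_ isT)/eqP.
have z0 : zcoord p != 0.
  by apply/eqP => /(congr1 re) /= z0; rewrite z0 ltxx in p0.
have E i : zcoord p * Y 1 i p = s * Y 0 i p.
  apply: (mulfI z0); rewrite mulrA -expr2 hN N0 addr0; ring.
apply: (mulfI z0); rewrite mulr0 mulN1r mulrBr.
rewrite [X in X - _]mulrCA [X in _ - X]mulrCA !E; ring.
Qed.

Lemma Y_norm_neq0 p : half_disk p -> \sum_k sqnormc (Y 0 k p) != 0.
Proof.
move=> /pd_conformal [l l0 [e1 e2 _]].
rewrite /sqnormc /=; under eq_bigr do rewrite sqrrN !expr2.
by rewrite big_split /= e1 e2 lt0r_neq0 // addr_gt0 // exprn_gt0.
Qed.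

Lemma continuous_bigsum (I : Type) (r : seq I) (g : I -> pt -> R) p :
  (forall i, {for p, continuous (g i)}) ->
  {for p, continuous (fun q => \sum_(i <- r) g i q)}.
Proof.
move=> cg; elim: r => [|i r IHr].
  under [X in {for _, continuous X}]eq_fun do rewrite big_nil.
  exact: cst_continuous.
under [X in {for _, continuous X}]eq_fun do rewrite big_cons.
exact: continuousD.
Qed.

(* As [Y' = rho Y], the quotient [|w.Y|^2 / |Y|^2] is constant. *)
Lemma Y_linear_relation (w : 'I_n -> C) p : half_disk p ->
  \sum_k w k * Y 0 k 0 = 0 -> \sum_k w k * Y 0 k p = 0.
Proof.
pose A q := \sum_k w k * Y 0 k q; pose A' q := \sum_k w k * Y 1 k q.
pose T q := \sum_k sqnormc (Y 0 k q).
pose r q : C := Complex (sqnormc (A q) / T q) 0.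
have cA q : half_disk q -> ccont A q.
  move=> /DU Uq; apply: ccont_sum => k; apply: ccontM; [exact: ccont_cst|exact: ccont_Y].
have cr q : half_disk q -> ccont r q.
  move=> Dq; split => /=; last exact: cst_continuous.
  apply: continuousM; first by apply: continuous_sqnormc; exact: cA.
  apply: continuousV; first exact: Y_norm_neq0.
  by apply: continuous_bigsum => k; apply: continuous_sqnormc; apply: ccont_Y; exact: DU.
have dA q : open_half_disk q -> cderiv A q (A' q).
  move=> oq; apply: cderiv_sum => k.
  by apply: cderiv_eq (cderivM (cderiv_cst _ _) (cderiv_Y 0 k oq)) _; rewrite mul0r add0r.
(* The function [A = w . Y] has the same logarithmic derivative as each component of [Y]; the form
   with products allows for components that vanish. *)
have par q k : open_half_disk q -> A q * Y 1 k q = A' q * Y 0 k q.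
  move=> oq; rewrite !mulr_suml; apply: eq_bigr => l _.
  by rewrite -!mulrA Y_parallel // [Y 0 k q * _]mulrC.
have dsq (F : pt -> C) q v a b : is_derive q v (fun q => re (F q)) a ->
    is_derive q v (fun q => im (F q)) b ->
    is_derive q v (fun q => sqnormc (F q)) (2 * (re (F q) * a + im (F q) * b)).
  move=> ha hb; apply: is_derive_eq (is_deriveD (is_deriveX 2 ha) (is_deriveX 2 hb)) _.
  by rewrite /GRing.scale /= expr1; ring.
(* Equal logarithmic derivatives of [|A|^2] and of all [|Y_k|^2] make the quotient stationary. *)
have dquot q v a (b : 'I_n -> R) : half_disk q ->
    is_derive q v (fun q => sqnormc (A q)) a ->
    (forall k, is_derive q v (fun q => sqnormc (Y 0 k q)) (b k)) ->
    (forall k, a * sqnormc (Y 0 k q) = sqnormc (A q) * b k) ->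
    is_derive q v (fun q => sqnormc (A q) / T q) 0.
  move=> Dq ha hb hab; have T0 := Y_norm_neq0 Dq.
  apply: is_derive_eq (is_deriveM ha (is_derive_inv T0 (is_derive_bigsum _ hb))) _.
  rewrite -/(T q) in T0 *; rewrite /GRing.scale /=.
  have E : sqnormc (A q) * \sum_k b k = a * T q.
    by rewrite /T !mulr_sumr; apply: eq_bigr => k _; rewrite hab.
  rewrite mulrCA E; field.
  by rewrite T0.
have dr q : open_half_disk q -> cderiv r q 0.
  move=> oq; have Dq := open_half_disk_sub oq; have [a1 a2 a3 a4] := dA q oq.
  have hY k := cderiv_Y 0 k oq.
  split; rewrite /= ?oppr0; try exact: is_derive_cst.
  - have hb k : is_derive q ex (fun q => sqnormc (Y 0 k q))
       (2 * (re (Y 0 k q) * re (Y 1 k q) + im (Y 0 k q) * im (Y 1 k q))).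
      by have [b1 b2 _ _] := hY k; exact: dsq b1 b2.
    apply: (dquot _ _ _ _ Dq (dsq _ _ _ _ _ a1 a2) hb) => k.
    have := congr1 re (par q k oq); have := congr1 im (par q k oq).
    rewrite /sqnormc !reM !imM.
    move: (re (A q)) (im (A q)) (re (A' q)) (im (A' q)) (re (Y 0 k q)) (im (Y 0 k q))
      (re (Y 1 k q)) (im (Y 1 k q)) => x y x' y' c d c' d' E1 E2.
    transitivity (2 * ((x * c - y * d) * (x' * c - y' * d) + (x * d + y * c) * (x' * d + y' * c))).
      by ring.
    by rewrite -E1 -E2; ring.
  - have hb k : is_derive q ey (fun q => sqnormc (Y 0 k q))
       (2 * (re (Y 0 k q) * - im (Y 1 k q) + im (Y 0 k q) * re (Y 1 k q))).
      by have [_ _ b1 b2] := hY k; exact: dsq b1 b2.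
    apply: (dquot _ _ _ _ Dq (dsq _ _ _ _ _ a3 a4) hb) => k.
    have := congr1 re (par q k oq); have := congr1 im (par q k oq).
    rewrite /sqnormc !reM !imM.
    move: (re (A q)) (im (A q)) (re (A' q)) (im (A' q)) (re (Y 0 k q)) (im (Y 0 k q))
      (re (Y 1 k q)) (im (Y 1 k q)) => x y x' y' c d c' d' E1 E2.
    transitivity (2 * ((x * c - y * d) * - (x' * d + y' * c) + (x * d + y * c) * (x' * c - y' * d))).
      by ring.
    by rewrite -E1 -E2; ring.
have rc q : half_disk q -> r q = r (row2 1 0).
  move=> Dq; apply: (half_disk_dense_eq Dq (cr q Dq) (ccont_cst _ _)) => t ot.
  apply: (cderiv_const dr); last by case: ot.
    by move=> s Ds _; exact: cr.
  exact: open_half_disk_sub.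
move=> Dp A0; have : r p = r 0 by rewrite !rc //; exact: half_disk0.
rewrite /r; have -> : A 0 = 0 by [].
rewrite sqnormc0 mul0r => -[] /eqP; rewrite mulf_eq0 invr_eq0 (negbTE (Y_norm_neq0 Dp)) orbF.
by move=> /eqP /sqnormc_eq0.
Qed.

(** * Coordinates in the tangent plane at the center *)

Section Plane.
Context (l : R).
Hypothesis l_gt0 : 0 < l.
Hypothesis norm_ex : \sum_k pd [:: ex] k 0 * pd [:: ex] k 0 = l ^+ 2.
Hypothesis norm_ey : \sum_k pd [:: ey] k 0 * pd [:: ey] k 0 = l ^+ 2.
Hypothesis dot_exy : \sum_k pd [:: ex] k 0 * pd [:: ey] k 0 = 0.

(** An orthonormal frame of the tangent plane at the center; [X] and [Z] are the coordinates of the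
    orthogonal projection of [f] to that plane. *)
Let b k : R := l^-1 * pd [:: ex] k 0.
Let d k : R := l^-1 * pd [:: ey] k 0.
Let X q : R := \sum_k b k * f q 0 k.
Let Z q : R := \sum_k d k * f q 0 k.

Let l_neq0 : l != 0. Proof. exact: lt0r_neq0. Qed.

Lemma plane_bb : \sum_k b k * b k = 1.
Proof.
rewrite -[RHS](mulfV (expf_neq0 2 l_neq0)) -{1}norm_ex mulr_suml.
by apply: eq_bigr => k _; rewrite /b; field.
Qed.

Lemma plane_dd : \sum_k d k * d k = 1.
Proof.
rewrite -[RHS](mulfV (expf_neq0 2 l_neq0)) -{1}norm_ey mulr_suml.
by apply: eq_bigr => k _; rewrite /d; field.
Qed.

Lemma plane_bd : \sum_k b k * d k = 0.
Proof.
transitivity ((\sum_k pd [:: ex] k 0 * pd [:: ey] k 0) / l ^+ 2); last by rewrite dot_exy mul0r.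
by rewrite mulr_suml; apply: eq_bigr => k _; rewrite /b /d; field.
Qed.

Lemma plane_ex0 k : pd [:: ex] k 0 = l * b k.
Proof. by rewrite /b mulrA mulfV // mul1r. Qed.

Lemma plane_ey0 k : pd [:: ey] k 0 = l * d k.
Proof. by rewrite /d mulrA mulfV // mul1r. Qed.

(** The vector [b - i d] is isotropic and [Y] equals [l (b - i d)] at the center. So [b - i d]
    annihilates [Y] there and therefore everywhere; the real and imaginary parts of this relation
    are the Cauchy-Riemann equations of [X + i Z]. *)
Lemma plane_CR p : half_disk p ->
  \sum_k d k * pd [:: ey] k p = \sum_k b k * pd [:: ex] k p /\
  \sum_k d k * pd [:: ex] k p = - \sum_k b k * pd [:: ey] k p.
Proof.
move=> Dp.
have reE q : re (\sum_k Complex (b k) (- d k) * Y 0 k q) =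
    \sum_k b k * pd [:: ex] k q - \sum_k d k * pd [:: ey] k q.
  by rewrite re_sum -sumrB; apply: eq_bigr => k _; rewrite reM /= mulrNN.
have imE q : im (\sum_k Complex (b k) (- d k) * Y 0 k q) =
    - (\sum_k b k * pd [:: ey] k q + \sum_k d k * pd [:: ex] k q).
  rewrite im_sum -big_split -sumrN; apply: eq_bigr => k _.
  by rewrite imM /= mulrN mulNr opprD.
have : \sum_k Complex (b k) (- d k) * Y 0 k p = 0.
  apply: (Y_linear_relation Dp); apply: complexP.
  - rewrite reE; under eq_bigr do rewrite plane_ex0 mulrCA.
    under [X in _ - X]eq_bigr do rewrite plane_ey0 mulrCA.
    by rewrite -!mulr_sumr plane_bb plane_dd subrr.
  - rewrite imE; under eq_bigr do rewrite plane_ey0 mulrCA.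
    under [X in - (_ + X)]eq_bigr do rewrite plane_ex0 mulrCA [d _ * _]mulrC.
    by rewrite -!mulr_sumr plane_bd !mulr0 addr0 oppr0.
move=> H; have := congr1 re H; have := congr1 im H; rewrite reE imE /=.
by move=> h1 h2; split; lra.
Qed.

(** Matrix of the orthogonal projection to the complement of the span of [b] and [d]. *)
Let w k i : R := (i == k)%:R - b k * b i - d k * d i.

Lemma plane_projE k (g : 'I_n -> R) : \sum_i w k i * g i =
  g k - b k * (\sum_i b i * g i) - d k * (\sum_i d i * g i).
Proof.
rewrite !mulr_sumr.
have -> : g k = \sum_i (i == k)%:R * g i.
  rewrite (bigD1 k) //= eqxx mul1r big1 ?addr0 // => i ik.
  by rewrite (negbTE ik) mul0r.
by rewrite -!sumrB; apply: eq_bigr => i _; rewrite /w; ring.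
Qed.

Lemma plane_pd k p : half_disk p ->
  \sum_i w k i * pd [:: ex] i p = 0 /\ \sum_i w k i * pd [:: ey] i p = 0.
Proof.
move=> Dp.
have reE q : re (\sum_i Complex (w k i) 0 * Y 0 i q) = \sum_i w k i * pd [:: ex] i q.
  by rewrite re_sum; apply: eq_bigr => i _; rewrite reM /= mul0r subr0.
have imE q : im (\sum_i Complex (w k i) 0 * Y 0 i q) = - \sum_i w k i * pd [:: ey] i q.
  by rewrite im_sum -sumrN; apply: eq_bigr => i _; rewrite imM /= mul0r addr0 mulrN.
have wb : \sum_i w k i * b i = 0.
  rewrite plane_projE plane_bb; under [X in _ - _ * X]eq_bigr do rewrite mulrC.
  by rewrite plane_bd; ring.
have wd : \sum_i w k i * d i = 0 by rewrite plane_projE plane_bd plane_dd; ring.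
have : \sum_i Complex (w k i) 0 * Y 0 i p = 0.
  apply: (Y_linear_relation Dp); apply: complexP.
  - rewrite reE; under eq_bigr do rewrite plane_ex0 mulrCA.
    by rewrite -mulr_sumr wb mulr0.
  - rewrite imE; under eq_bigr do rewrite plane_ey0 mulrCA.
    by rewrite -mulr_sumr wd mulr0 oppr0.
move=> H; have := congr1 re H; have := congr1 im H; rewrite reE imE /=.
by move=> h1 h2; split => //; lra.
Qed.

(** The normal component [rho] has zero gradient, so it is constant. At the point 1 the radial
    equation reads [u_x = m f] with [m] nonzero, and [u_x] has no normal component; so the constant
    is 0 and the plane passes through the origin. *)
Lemma plane_f p k : half_disk p -> f p 0 k = X p * b k + Z p * d k.
Proof.
move=> Dp; pose rho q : R := \sum_i w k i * pd [::] i q.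
have rhoE q : rho q = f q 0 k - X q * b k - Z q * d k.
  rewrite /rho plane_projE pd0E [b k * _]mulrC [d k * _]mulrC.
  by congr (_ - _ * _ - _ * _); apply: eq_bigr => i _; rewrite pd0E.
have drho q v : U q -> is_derive q v rho (\sum_i w k i * pd [:: v] i q).
  move=> Uq; apply: (@is_derive_bigsum _ _ _ _ (fun i q => w k i * pd [::] i q)) => i.
  have di := is_derive_mulc (w k i) (pd_derive [::] i v Uq).
  refine di.
have crho q : half_disk q -> {for q, continuous rho}.
  move=> /DU Uq; apply: (continuous_bigsum (g := fun i q => w k i * pd [::] i q)) => i.
  by apply: continuousM; [exact: cst_continuous|exact: pd_cont].
suff : rho p = 0 by rewrite rhoE; lra.
have rho1 : rho (row2 1 0) = 0.
  have c1 : half_circle (row2 1 0 : pt).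
    by rewrite /half_circle /= row2E0 row2E1; split; lra.
  have [m m0 hm] := arc_radial c1.
  have D1 : half_disk (row2 1 0 : pt).
    by rewrite /half_disk /= row2E0 row2E1; split; lra.
  apply: (mulfI m0); rewrite mulr0.
  transitivity (\sum_i w k i * pd [:: ex] i (row2 1 0)); last exact: (plane_pd k D1).1.
  rewrite /rho mulr_sumr.
  apply: eq_bigr => i _; rewrite pd0E mulrCA -hm row2E0 row2E1; ring.
apply: (half_disk_dense Dp (crho p Dp)) => q oq.
pose F q : C := Complex (rho q) 0.
suff : F q = F (row2 1 0) by case; rewrite rho1.
apply: (@cderiv_const R F); last by case: oq.
- move=> s os; have Ds := open_half_disk_sub os; have Us := DU Ds.
  have [h1 h2] := plane_pd k Ds.
  split; rewrite /= ?oppr0; try exact: is_derive_cst.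
    by rewrite -h1; exact: drho.
  by rewrite -h2; exact: drho.
- by move=> s Ds _; split; [exact: crho|exact: cst_continuous].
- exact: open_half_disk_sub.
Qed.

Lemma plane_norm p : half_disk p -> X p ^+ 2 + Z p ^+ 2 = \sum_k f p 0 k ^+ 2.
Proof.
move=> Dp.
have E (x z : R) : x ^+ 2 + z ^+ 2 = \sum_k (x * b k + z * d k) ^+ 2.
  transitivity (x ^+ 2 * (\sum_k b k * b k) + 2 * x * z * (\sum_k b k * d k)
     + z ^+ 2 * (\sum_k d k * d k)).
    by rewrite plane_bb plane_bd plane_dd; ring.
  by rewrite !mulr_sumr -!big_split /=; apply: eq_bigr => k _; ring.
by rewrite E; apply: eq_bigr => k _; rewrite plane_f.
Qed.

Hypothesis f_ball : forall p, half_disk p -> closed_unit_ball (f p).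
Hypothesis X_diam : forall p, diameter p -> X p = 0.

Lemma plane_image : f @` half_disk =
  [set \row_k (q 0 0 * b k + q 0 1 * d k) | q in half_disk].
Proof.
pose fc q : C := Complex (X q) (Z q).
(* The complex derivative of [X + i Z] is [X_x - i X_y = b . Y], and [fi i] is its [i]-th
   derivative. *)
pose fi i q : C := \sum_k Complex (b k) 0 * Y i k q.
have dfi i p : open_half_disk p -> cderiv (fi i) p (fi i.+1 p).
  move=> op; apply: cderiv_sum => k.
  by apply: cderiv_eq (cderivM (cderiv_cst _ _) (cderiv_Y i k op)) _; rewrite mul0r add0r.
have re1 p : re (fi 0 p) = \sum_k b k * pd [:: ex] k p.
  by rewrite re_sum; apply: eq_bigr => k _; rewrite reM /= mul0r subr0.
have im1 p : im (fi 0 p) = - \sum_k b k * pd [:: ey] k p.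
  by rewrite im_sum -sumrN; apply: eq_bigr => k _; rewrite imM /= mul0r addr0 mulrN.
have comb_d (c : 'I_n -> R) p v : U p ->
    is_derive p v (fun q => \sum_k c k * f q 0 k) (\sum_k c k * pd [:: v] k p).
  move=> Up; under [F in is_derive _ _ F]eq_fun do under eq_bigr do rewrite -pd0E.
  apply: (@is_derive_bigsum _ _ _ _ (fun k q => c k * pd [::] k q)) => k.
  have dk := is_derive_mulc (c k) (pd_derive [::] k v Up).
  refine dk.
have comb_diff (c : 'I_n -> R) p : U p -> differentiable (fun q => \sum_k c k * f q 0 k) p.
  move=> Up; rewrite (_ : (fun q => _) = (fun q => \sum_k c k * pd [::] k q)).
    apply: (@differentiable_bigsum _ _ _ _ (fun k q => c k * pd [::] k q)) => k.
    by apply: differentiableM; [exact: differentiable_cst|exact: pd_diff].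
  by apply/funext => q; apply: eq_bigr => k _; rewrite pd0E.
have img : [set fc p | p in half_disk] = [set z : C | sqnormc z <= 1 /\ 0 <= re z].
  apply: (@mobius_image R fc (fi 0) (fi 1) (fi 2)).
  - move=> p Dp; have Up := DU Dp; have [c1 c2] := plane_CR Dp.
    split; rewrite /= ?re1 ?im1.
    + exact: comb_d.
    + by rewrite -c2; exact: comb_d.
    + by rewrite opprK; exact: comb_d.
    + by rewrite -c1; exact: comb_d.
  - exact: dfi.
  - exact: dfi.
  - by apply: comb_diff; apply: DU; exact: half_disk0.
  - by apply: comb_diff; apply: DU; exact: half_disk0.
  - move=> p /DU Up; split => /=; apply: differentiable_continuous; exact: comb_diff.
  - move=> p /DU Up; apply: ccont_sum => k; apply: ccontM; [exact: ccont_cst|exact: ccont_Y].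
  (* If the derivative vanished, [u_x] would have zero component in the plane, and it has none
     outside, contrary to the positive conformal factor. *)
  - move=> p Dp; apply/negP => /eqP f0.
    have [l' l'0 [e1 _ _]] := pd_conformal Dp.
    have [_ c2] := plane_CR Dp.
    have z k : pd [:: ex] k p = 0.
      have := (plane_pd k Dp).1; rewrite plane_projE c2 -im1 -re1 f0 /= !mulr0 !subr0.
      by [].
    move: e1; rewrite big1 => [/esym/eqP|k _]; last by rewrite z mulr0.
    by rewrite expf_eq0 /= gt_eqF.
  - move=> p Dp; rewrite /sqnormc /= plane_norm //.
    have := f_ball Dp; rewrite /closed_unit_ball /= /enorm => H.
    have s0 : 0 <= \sum_k f p 0 k ^+ 2 by rewrite sumr_ge0 // => k _; exact: sqr_ge0.
    have -> : \sum_k f p 0 k ^+ 2 = dot (f p) (f p).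
      by apply: eq_bigr => k _; rewrite expr2.
    move: s0; have -> : \sum_k f p 0 k ^+ 2 = dot (f p) (f p).
      by apply: eq_bigr => k _; rewrite expr2.
    by move=> s0; rewrite -(sqr_sqrtr s0) expr_le1 // sqrtr_ge0.
  - exact: X_diam.
  - move=> p cp p0; have Dp : half_disk p by case: cp => pn px; split => //; rewrite pn.
    split; first by rewrite /sqnormc /= plane_norm // sphere_sum.
    have [m m0 hm] := arc_radial cp; have [c1 c2] := plane_CR Dp.
    have comb (c : 'I_n -> R) : p 0 0 * (\sum_k c k * pd [:: ex] k p) +
        p 0 1 * (\sum_k c k * pd [:: ey] k p) = m * \sum_k c k * f p 0 k.
      rewrite !mulr_sumr -big_split; apply: eq_bigr => k _ /=.
      by rewrite mulrCA [X in _ + X]mulrCA -mulrDr hm mulrCA.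
    exists m; apply: complexP; rewrite !(reM, imM) re1 im1 /= mul0r.
    + by rewrite subr0 -(comb b); ring.
    + by rewrite addr0 -(comb d) c1 c2; ring.
  - rewrite re1; under eq_bigr do rewrite plane_ex0 mulrCA.
    by rewrite -mulr_sumr plane_bb mulr1.
apply/seteqP; split => [_ [p Dp <-]|_ [q [qn q0] <-]].
- have : [set fc p | p in half_disk] (fc p) by exists p.
  rewrite img => -[n1 n2]; exists (row2 (X p) (Z p)).
    by rewrite /half_disk /= row2E0 row2E1.
  by apply/rowP => k; rewrite !mxE /= plane_f.
- have : [set z : C | sqnormc z <= 1 /\ 0 <= re z] (Complex (q 0 0) (q 0 1)) by [].
  rewrite -img => -[p Dp [x1 x2]]; exists p => //.
  by apply/rowP => k; rewrite mxE plane_f // x1 x2.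
Qed.

End Plane.
End Flat.
End Face.

(** * The three faces *)

Lemma sum_ord3 (V : nmodType) (F : 'I_3 -> V) : \sum_(j < 3) F j = F 0 + F 1 + F 2.
Proof.
rewrite !big_ord_recl big_ord0 addr0 addrA.
by congr (F _ + F _ + F _); exact: val_inj.
Qed.

Lemma ord3P (i : 'I_3) : [\/ i = 0, i = 1 | i = 2].
Proof.
by case: i => [[|[|[|//]]] Hi]; [constructor 1|constructor 2|constructor 3]; exact: val_inj.
Qed.

(** For the Gram matrix of three unit vectors with sum zero, the column sums are three linear
    equations for the three distinct off-diagonal entries; the solution is the cosine of 120
    degrees. *)
Lemma balanced_triple (R : realFieldType) (G : 'I_3 -> 'I_3 -> R) :
  (forall i, G i i = 1) -> (forall i j, G i j = G j i) ->
  (forall j, \sum_(i < 3) G i j = 0) ->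
  forall i j, i != j -> G i j = - 2^-1.
Proof.
move=> diag sym sum0 i j.
have := sum0 0; have := sum0 1; have := sum0 2; rewrite !sum_ord3 !diag.
rewrite (sym 1 0) (sym 2 0) (sym 2 1) => h2 h1 h0.
by case: (ord3P i) (ord3P j) => -> [] -> //= _; rewrite ?(sym 1 0) ?(sym 2 0) ?(sym 2 1); lra.
Qed.

Section Cone.
Context (R : realType) (n : nat).
Local Notation pt := 'rV[R]_2.
Local Notation C := R[i].
Local Notation re := (@complex.Re R).
Local Notation im := (@complex.Im R).
Local Notation ex := (basis_vec R 0).
Local Notation ey := (basis_vec R 1).
Context (u : 'I_3 -> pt -> 'rV[R]_n) (U : 'I_3 -> set pt).
Hypothesis openU : forall j, open (U j).
Hypothesis DU : forall j, half_disk `<=` U j.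
Hypothesis smU : forall j, smooth_on (U j) (u j).
Hypothesis conf : forall j p, half_disk p -> conformal_at (u j) p.
Hypothesis H0 : forall j p, half_disk p -> mean_curvature_vector (u j) p = 0.
Hypothesis f_sphere : forall j p, half_circle p ->
    unit_sphere (u j p) /\
    forall eta : 'rV[R]_n, half_circle_conormal (u j) p eta ->
      normal_to_sphere_at (u j p) eta.
Hypothesis agree : agree_on_diameter u.
Hypothesis conormals : forall (p : pt) (tau : 'I_3 -> 'rV[R]_n), diameter p ->
  (forall j, diameter_conormal (u j) p (tau j)) -> \sum_(j < 3) tau j = 0.

Local Notation pd j := (coord_derive (u j)).

(** The endpoints are removed so that identities along the diameter can be differentiated in [y];
    continuity recovers the corners where they matter. *)
Definition inner_diameter (p : pt) : Prop := p 0 0 = 0 /\ -1 < p 0 1 < 1.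

Lemma inner_diameterW p : inner_diameter p -> diameter p.
Proof. by move=> [p0 /andP[? ?]]; split => //; rewrite !ltW. Qed.

Lemma inner_diameter_D p : inner_diameter p -> half_disk p.
Proof. by move=> /inner_diameterW /diameter_half_disk. Qed.

Lemma inner_diameter0 : inner_diameter 0.
Proof. by rewrite /inner_diameter !mxE; split => //; apply/andP; split; lra. Qed.

Lemma inner_diameter_near p : inner_diameter p ->
  \forall s \near (0 : R), inner_diameter (s *: ey + p).
Proof.
move=> [p0 /andP[p1 p2]].
have S1 : \forall s \near (0 : R), `|s| < 1 - p 0 1 by apply: nbhs0_lt; lra.
have S2 : \forall s \near (0 : R), `|s| < p 0 1 + 1 by apply: nbhs0_lt; lra.
near=> s; rewrite basis_vec1E /inner_diameter !mxE /= p0 mulr0 addr0 mulr1.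
have : `|s| < 1 - p 0 1 by near: s; exact: S1.
have : `|s| < p 0 1 + 1 by near: s; exact: S2.
rewrite !ltr_norml => /andP[? ?] /andP[? ?].
by split => //; apply/andP; split; lra.
Unshelve. all: by end_near.
Qed.

Lemma pd_agree_ey vs i j k p :
  (forall q, inner_diameter q -> pd i vs k q = pd j vs k q) ->
  inner_diameter p -> pd i (ey :: vs) k p = pd j (ey :: vs) k p.
Proof.
move=> Hq dp; have Dp := inner_diameter_D dp.
apply: (is_derive_unique_line (pd_derive (@smU i) vs k ey (DU i Dp))
  (pd_derive (@smU j) vs k ey (DU j Dp))).
by apply: filterS (inner_diameter_near dp) => s; exact: Hq.
Qed.

Lemma pd0_agree i j k p : inner_diameter p -> pd i [::] k p = pd j [::] k p.
Proof. by move=> /inner_diameterW dp; rewrite !pd0E (agree i j). Qed.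

Lemma pd1_agree i j k p : inner_diameter p -> pd i [:: ey] k p = pd j [:: ey] k p.
Proof. by apply: pd_agree_ey => q; exact: pd0_agree. Qed.

Lemma pd2_agree i j k p : inner_diameter p -> pd i [:: ey; ey] k p = pd j [:: ey; ey] k p.
Proof. by apply: pd_agree_ey => q; exact: pd1_agree. Qed.

(** The length [|u_y|] is common to the faces, since they agree along the diameter, and conformality
    passes it on to [|u_x|]. *)
Lemma diameter_metric p : inner_diameter p -> exists2 l : R, 0 < l & forall j,
  [/\ \sum_k pd j [:: ex] k p * pd j [:: ex] k p = l ^+ 2,
      \sum_k pd j [:: ey] k p * pd j [:: ey] k p = l ^+ 2 &
      \sum_k pd j [:: ex] k p * pd j [:: ey] k p = 0].
Proof.
move=> dp; have Dp := inner_diameter_D dp.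
have [l l0 [e1 e2 e3]] := pd_conformal (DU 0) (@smU 0) (@conf 0) Dp.
exists l => // j.
have [m m0 [f1 f2 f3]] := pd_conformal (DU j) (@smU j) (@conf j) Dp.
have ml : m ^+ 2 = l ^+ 2.
  by rewrite -f2 -e2; apply: eq_bigr => k _; rewrite !(pd1_agree j 0 k dp).
by split; rewrite ?f1 ?f2 ?f3.
Qed.

(* The conormal of each face is [- u_x / |u_x|], with the same [|u_x| = |u_y|]
   for the three faces. *)
Lemma sum_pd_ex k p : inner_diameter p -> \sum_(j < 3) pd j [:: ex] k p = 0.
Proof.
move=> dp; have Dp := inner_diameter_D dp.
have [l l0 hl] := diameter_metric dp.
have l0' := lt0r_neq0 l0.
pose tau j : 'rV[R]_n := - l^-1 *: 'd (u j) p ex.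
have dot1 j : dot ('d (u j) p ex) ('d (u j) p ex) = l ^+ 2.
  have [<- _ _] := hl j; apply: eq_bigr => i _.
  by rewrite !(pd_diffE (@smU j)) //; exact: DU.
have dot2 j : dot ('d (u j) p ex) ('d (u j) p ey) = 0.
  have [_ _ <-] := hl j; apply: eq_bigr => i _.
  by rewrite !(pd_diffE (@smU j)) //; exact: DU.
have tauE j : diameter_conormal (u j) p (tau j).
  rewrite /diameter_conormal; split.
  - rewrite /enorm (_ : dot _ _ = l^-1 ^+ 2 * dot ('d (u j) p ex) ('d (u j) p ex)).
      by rewrite dot1 -exprMn mulVf // expr1n sqrtr1.
    by rewrite /dot mulr_sumr; apply: eq_bigr => i _; rewrite !mxE; ring.
  - rewrite -basis_vec1E (_ : dot _ _ = - l^-1 * dot ('d (u j) p ex) ('d (u j) p ey)).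
      by rewrite dot2 mulr0.
    by rewrite /dot mulr_sumr; apply: eq_bigr => i _; rewrite !mxE; ring.
  - exists (- l^-1 *: ex); last by rewrite linearZ.
    rewrite [ltRHS](_ : _ = l^-1) ?invr_gt0 //.
    by rewrite basis_vec0E /dot sum_ord2 !mxE /=; ring.
have := conormals (inner_diameterW dp) tauE => /(congr1 (fun v : 'rV[R]_n => v 0 k)).
rewrite summxE mxE => H; apply/eqP.
have : - l^-1 * \sum_(j < 3) pd j [:: ex] k p = 0.
  rewrite -[RHS]H mulr_sumr; apply: eq_bigr => j _.
  by rewrite mxE (pd_diffE (@smU j)) //; exact: DU.
by move/eqP; rewrite mulf_eq0 oppr_eq0 invr_eq0 (negbTE l0').
Qed.

Lemma sum_pd_ey_ex k p : inner_diameter p -> \sum_(j < 3) pd j [:: ey; ex] k p = 0.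
Proof.
move=> dp; have Dp := inner_diameter_D dp.
have dS : is_derive p ey (fun q => \sum_(j < 3) pd j [:: ex] k q)
    (\sum_(j < 3) pd j [:: ey; ex] k p).
  apply: (@is_derive_bigsum _ _ _ _ (fun j q => pd j [:: ex] k q)) => j.
  exact: (pd_derive (@smU j) [:: ex] k ey (DU j Dp)).
apply: (is_derive_unique_line dS (is_derive_cst 0 p ey)).
by apply: filterS (inner_diameter_near dp) => s; exact: sum_pd_ex.
Qed.

Let Phi p : C := \sum_(j < 3) \sum_k (zcoord p ^+ 2 * Y (u j) 1 k p) ^+ 2.

Lemma Phi_hol2 : hol2 Phi.
Proof.
apply: hol2_sum => j; apply: hol2_sum => k; apply: hol2X.
apply: hol2M; first by apply: hol2X; exact: hol2_zcoord.
exact: (hol2_Y (@openU j) (DU j) (@smU j) (@conf j) (@H0 j)).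
Qed.

Lemma Phi_ccont p : half_disk p -> ccont Phi p.
Proof.
move=> Dp; apply: ccont_sum => j; apply: ccont_sum => k; apply: ccontX.
apply: ccontM; first by apply: ccontX; exact: ccont_zcoord.
by apply: (ccont_Y (@smU j)); exact: DU.
Qed.

Lemma Phi_arc p : half_circle p -> 0 < p 0 0 -> exists N : 'I_3 -> 'I_n -> R,
  (forall j, \sum_k (zcoord p ^+ 2 * Y (u j) 1 k p) ^+ 2 = Complex (\sum_k N j k ^+ 2) 0) /\
  Phi p = Complex (\sum_(j < 3) \sum_k N j k ^+ 2) 0.
Proof.
move=> cp p0.
have H j : exists N : 'I_n -> R,
    \sum_k (zcoord p ^+ 2 * Y (u j) 1 k p) ^+ 2 = Complex (\sum_k N k ^+ 2) 0.
  have [s [N [_ HN]]] := arc_quartic (@openU j) (DU j) (@smU j) (@conf j) (@H0 j) (@f_sphere j) cp p0.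
  by exists N.
have [N HN] := choice H.
exists N; split => //; rewrite /Phi; under eq_bigr do rewrite HN.
by apply: complexP; rewrite ?re_sum ?im_sum //= big1.
Qed.

(** At [z = i y] the imaginary part of [(z^2 Y')^2] is [- 2 y^4 u_xx u_xy] in each coordinate. Here
    [u_xx = - u_yy] is the same for the three faces, and the [u_xy] have sum zero. *)
Lemma Phi_diameter p : inner_diameter p -> im (Phi p) = 0.
Proof.
move=> dp; have Dp := inner_diameter_D dp; have [p0 _] := dp.
rewrite /Phi im_sum; under eq_bigr do rewrite im_sum.
rewrite exchange_big big1 // => k _.
have E j : im ((zcoord p ^+ 2 * Y (u j) 1 k p) ^+ 2) =
    2 * p 0 1 ^+ 4 * pd 0 [:: ey; ey] k p * pd j [:: ey; ex] k p.
  have h : pd j [:: ex; ex] k p = - pd 0 [:: ey; ey] k p.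
    apply/eqP; rewrite -addr_eq0 -(pd2_agree j 0 k dp); apply/eqP.
    exact: (pd_harmonic (@openU j) (DU j) (@smU j) (@conf j) (@H0 j)).
  rewrite expr2 imM !expr2 !(reM, imM) /= p0 h; ring.
by under eq_bigr do rewrite E; rewrite -mulr_sumr sum_pd_ey_ex // mulr0.
Qed.

Lemma Phi_boundary p : half_disk p -> ~ open_half_disk p -> im (Phi p) = 0.
Proof.
move=> Dp np; have [pn px] := Dp.
have [p00|p00] := eqVneq (p 0 0) 0; last first.
  have px0 : 0 < p 0 0 by rewrite lt_neqAle eq_sym p00.
  have cp : half_circle p.
    split => //; apply/eqP; rewrite eq_le pn leNgt; apply/negP => q1; exact: np.
  by have [N [_ ->]] := Phi_arc cp px0.
have p1 : p 0 1 ^+ 2 <= 1 by move: pn; rewrite p00 expr0n add0r.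
apply: (@ray_eq0 R (fun q => im (Phi q)) p (- p)); first by case: (Phi_ccont Dp).
move=> s /andP[s0 s1]; apply: Phi_diameter; split.
  by rewrite !mxE p00; ring.
rewrite !mxE.
have y1 : -1 <= p 0 1 by nra.
have y2 : p 0 1 <= 1 by nra.
by apply/andP; split; nra.
Qed.

Lemma Phi_eq0 p : half_disk p -> Phi p = 0.
Proof.
have Pc q : half_disk q -> 0 < q 0 0 -> Phi q = Phi (row2 1 0).
  apply: hol2_real_boundary_const; first exact: Phi_hol2.
  - by move=> r /Phi_ccont[].
  - by move=> r /Phi_ccont[].
  - exact: Phi_boundary.
have PD q : half_disk q -> Phi q = Phi (row2 1 0).
  move=> Dq; apply: (half_disk_dense_eq Dq (Phi_ccont Dq) (ccont_cst _ _)) => r orr.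
  by apply: Pc; [exact: open_half_disk_sub|case: orr].
move=> Dp; rewrite PD // -(PD 0); last exact: half_disk0.
by rewrite /Phi big1 // => j _; rewrite big1 // => k _; rewrite zcoord0 expr0n mul0r expr0n.
Qed.

Lemma face_quartic0 j p : half_circle p -> 0 < p 0 0 ->
  \sum_k (zcoord p ^+ 2 * Y (u j) 1 k p) ^+ 2 = 0.
Proof.
move=> cp p0; have Dp : half_disk p by case: cp => pn px; split => //; rewrite pn.
have [N [HN HPhi]] := Phi_arc cp p0.
rewrite HN; have := Phi_eq0 Dp; rewrite HPhi => /(congr1 re) /= /eqP.
rewrite psumr_eq0 => [/allP /(_ j)|i _]; last by rewrite sumr_ge0 // => k _; exact: sqr_ge0.
by rewrite mem_index_enum => /(_ isT) /= /eqP ->.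
Qed.

Hypothesis f_ball : forall j p, half_disk p -> closed_unit_ball (u j p).

Lemma cone_faces : exists (b : 'I_3 -> 'rV[R]_n) (d : 'rV[R]_n),
  [/\ forall j, dot (b j) (b j) = 1, dot d d = 1, forall j, dot (b j) d = 0,
      \sum_(j < 3) b j = 0
    & forall j, u j @` half_disk = [set q 0 0 *: b j + q 0 1 *: d | q in half_disk]].
Proof.
have [l l0 hl] := diameter_metric inner_diameter0.
have l0' := lt0r_neq0 l0.
pose b j : 'rV[R]_n := \row_k (l^-1 * pd j [:: ex] k 0).
pose d : 'rV[R]_n := \row_k (l^-1 * pd 0 [:: ey] k 0).
have dE j k : l^-1 * pd j [:: ey] k 0 = d 0 k.
  by rewrite mxE (pd1_agree j 0 k inner_diameter0).
have bb j : dot (b j) (b j) = 1.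
  have [h _ _] := hl j; rewrite -(plane_bb l0 h) /dot; apply: eq_bigr => k _.
  by rewrite !mxE.
have dd : dot d d = 1.
  have [_ h _] := hl 0; rewrite -(plane_dd l0 h) /dot; apply: eq_bigr => k _.
  by rewrite !mxE.
have bd j : dot (b j) d = 0.
  have [_ _ h] := hl j; rewrite -(plane_bd l0 h) /dot; apply: eq_bigr => k _.
  by rewrite dE mxE.
have sb : \sum_(j < 3) b j = 0.
  apply/rowP => k; rewrite summxE mxE.
  under eq_bigr do rewrite mxE.
  by rewrite -mulr_sumr sum_pd_ex ?mulr0 //; exact: inner_diameter0.
exists b, d; split => // j.
pose X i p : R := \sum_k (l^-1 * pd i [:: ex] k 0) * u i p 0 k.
pose Z i p : R := \sum_k (l^-1 * pd i [:: ey] k 0) * u i p 0 k.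
have fE i p k : half_disk p -> u i p 0 k = X i p * b i 0 k + Z i p * d 0 k.
  move=> Dp; have [h1 h2 h3] := hl i.
  rewrite (plane_f (@openU i) (DU i) (@smU i) (@conf i) (@H0 i) (@f_sphere i)
    (@face_quartic0 i) l0 h1 h2 h3 k Dp) /= -/(X i p) -/(Z i p).
  by rewrite -(dE i k) [b i 0 k]mxE.
have dotC (v w : 'rV[R]_n) : dot v w = dot w v.
  by apply: eq_bigr => k _; rewrite mulrC.
(* A point of the common curve lies in the planes of two faces [i] and [i']. Comparing coordinates
   gives [X i = - X i' / 2] and the same with the roles exchanged, so both vanish. *)
have X0 p : diameter p -> X j p = 0.
  move=> dp; have Dp := diameter_half_disk dp.
  have XE i i' : X i p = X i' p * dot (b i') (b i).
    transitivity (X i' p * dot (b i') (b i) + Z i' p * dot d (b i)); last first.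
      by rewrite [dot d _]dotC bd mulr0 addr0.
    rewrite /X [LHS](_ : _ = \sum_k b i 0 k * u i p 0 k); last first.
      by apply: eq_bigr => k _; rewrite mxE.
    rewrite -/(X i' p) /dot !mulr_sumr -big_split; apply: eq_bigr => k _ /=.
    by rewrite (agree i i') // fE //; ring.
  have bs i : \sum_(i' < 3) dot (b i') (b i) = 0.
    rewrite /dot exchange_big big1 // => k _.
    rewrite -mulr_suml; have := congr1 (fun v : 'rV[R]_n => v 0 k) sb.
    by rewrite summxE mxE => ->; rewrite mul0r.
  have ne i i' : i != i' -> dot (b i) (b i') = - 2^-1.
    by apply: (balanced_triple (fun i => bb i) (fun i i' => dotC (b i) (b i'))).
  have [i' ij] : exists i' : 'I_3, i' != j.
    by case: (eqVneq j 0) => [->|j0]; [exists 1|exists 0; rewrite eq_sym].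
  have e1 := XE j i'; have e2 := XE i' j.
  rewrite ne // in e1; rewrite ne 1?eq_sym // in e2; lra.
have [h1 h2 h3] := hl j.
rewrite (plane_image (@openU j) (DU j) (@smU j) (@conf j) (@H0 j) (@f_sphere j)
    (@face_quartic0 j) l0 h1 h2 h3 (@f_ball j) X0).
apply: eq_imagel => q _; apply/rowP => k.
by rewrite !mxE (pd1_agree j 0 k inner_diameter0).
Qed.

End Cone.

(** * Rigid motions *)

Section Isometry.
Context (R : realType) (n : nat).
Local Notation V := 'rV[R]_n.
Implicit Types (v w x y : V).

Lemma dotC v w : dot v w = dot w v.
Proof. by apply: eq_bigr => i _; rewrite mulrC. Qed.

Lemma dotDl v w x : dot (v + w) x = dot v x + dot w x.
Proof. by rewrite /dot -big_split; apply: eq_bigr => i _; rewrite mxE mulrDl. Qed.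

Lemma dotZl (c : R) v w : dot (c *: v) w = c * dot v w.
Proof. by rewrite /dot mulr_sumr; apply: eq_bigr => i _; rewrite mxE mulrA. Qed.

Lemma dotDr v w x : dot x (v + w) = dot x v + dot x w.
Proof. by rewrite dotC dotDl ![dot x _]dotC. Qed.

Lemma dotZr (c : R) v w : dot v (c *: w) = c * dot v w.
Proof. by rewrite dotC dotZl dotC. Qed.

Lemma dotNl v w : dot (- v) w = - dot v w.
Proof. by rewrite -scaleN1r dotZl mulN1r. Qed.

Lemma dotNr v w : dot w (- v) = - dot w v.
Proof. by rewrite dotC dotNl dotC. Qed.

Definition dotE := (dotDl, dotDr, dotZl, dotZr, dotNl, dotNr).

Lemma dot_eq0 v : dot v v = 0 -> v = 0.
Proof.
move=> /eqP; rewrite psumr_eq0 => [/allP h|i _]; last by rewrite -expr2 sqr_ge0.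
apply/rowP => i; have := h i; rewrite mem_index_enum mxE => /(_ isT) /=.
by rewrite -expr2 sqrf_eq0 => /eqP.
Qed.

Definition linear_isometry (P : V -> V) : Prop :=
  (forall (a c : R) x y, P (a *: x + c *: y) = a *: P x + c *: P y) /\
  (forall x y, dot (P x) (P y) = dot x y).

Lemma linear_isometry_comp P Q : linear_isometry P -> linear_isometry Q ->
  linear_isometry (P \o Q).
Proof.
move=> [p1 p2] [q1 q2]; split=> [a c x y|x y] /=; first by rewrite q1 p1.
by rewrite p2 q2.
Qed.

(* For [v = 0] this is the identity, because division by [0] gives [0]. *)
Definition reflection v x : V := x - (2 * dot x v / dot v v) *: v.

Lemma reflection_isometry v : linear_isometry (reflection v).
Proof.
split=> [a c x y|x y]; rewrite /reflection.
  rewrite !dotE; apply/rowP => i; rewrite !mxE; ring.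
have [v0|v0] := eqVneq (dot v v) 0.
  by rewrite v0 invr0 !mulr0 !scale0r !subr0.
by rewrite !dotE [dot v y]dotC; field.
Qed.

Lemma reflection_fix v x : dot x v = 0 -> reflection v x = x.
Proof. by move=> xv; rewrite /reflection xv mulr0 mul0r scale0r subr0. Qed.

(** The mirror is the hyperplane orthogonal to [x - y], and it contains the midpoint of [x] and [y]
    because the norms agree; for [x = y] the map is the identity. *)
Lemma reflection_swap x y : dot x x = dot y y -> reflection (x - y) x = y.
Proof.
move=> xy; have [v0|v0] := eqVneq (dot (x - y) (x - y)) 0.
  by have /eqP := dot_eq0 v0; rewrite subr_eq0 => /eqP ->; rewrite /reflection subrr scaler0 subr0.
have E : 2 * dot x (x - y) = dot (x - y) (x - y).
  by rewrite !dotE -xy [dot y x]dotC; ring.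
by rewrite /reflection E mulfV // scale1r subKr.
Qed.

(** Three reflections, each carrying one vector to its target. The vectors already in place are
    fixed, because the equal inner products make them orthogonal to the normal of the next
    mirror. *)
Lemma isometry_three (b d g b' d' g' : V) :
  dot b b = dot b' b' -> dot d d = dot d' d' -> dot g g = dot g' g' ->
  dot b d = dot b' d' -> dot b g = dot b' g' -> dot d g = dot d' g' ->
  exists P, [/\ linear_isometry P, P b = b', P d = d' & P g = g'].
Proof.
move=> bb dd gg bd bg dg.
pose P1 := reflection (b - b').
have [_ i1] : linear_isometry P1 := reflection_isometry _.
have P1b : P1 b = b' by exact: reflection_swap.
pose P2 := reflection (P1 d - d').
have [_ i2] : linear_isometry P2 := reflection_isometry _.
have P2d : P2 (P1 d) = d' by apply: reflection_swap; rewrite i1.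
have P2b : P2 b' = b'.
  have E : dot b' (P1 d) = dot b' d' by rewrite -{1}P1b i1.
  by apply: reflection_fix; rewrite dotDr dotNr E subrr.
pose P3 := reflection (P2 (P1 g) - g').
have P3g : P3 (P2 (P1 g)) = g' by apply: reflection_swap; rewrite i2 i1.
have P3b : P3 b' = b'.
  have E : dot b' (P2 (P1 g)) = dot b' g' by rewrite -{1}P2b -{1}P1b i2 i1.
  by apply: reflection_fix; rewrite dotDr dotNr E subrr.
have P3d : P3 d' = d'.
  have E : dot d' (P2 (P1 g)) = dot d' g' by rewrite -{1}P2d i2 i1.
  by apply: reflection_fix; rewrite dotDr dotNr E subrr.
exists (P3 \o (P2 \o P1)); split => /=.
- by do 2?[apply: linear_isometry_comp]; exact: reflection_isometry.
- by rewrite P1b P2b P3b.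
- by rewrite P2d P3d.
- exact: P3g.
Qed.

Lemma linear_isometry_enorm P x y : linear_isometry P ->
  enorm (P x - P y) = enorm (x - y).
Proof.
move=> [lP iP]; have -> : P x - P y = P (x - y).
  have := lP 1 (- 1) x y; rewrite !scale1r !scaleN1r => ->.
  by [].
by rewrite /enorm iP.
Qed.

(** A natural number as index lets the three coordinate axes be named uniformly in [n]; an index
    beyond the dimension gives the zero vector. *)
Definition axis (c : nat) : V := \row_i (nat_of_ord i == c)%:R.

Lemma dot_axis c c' : (c < n)%N -> dot (axis c) (axis c') = (c == c')%:R.
Proof.
move=> cn; rewrite /dot (bigD1 (Ordinal cn)) //= !mxE /= eqxx mul1r big1 ?addr0 //.
move=> i ic; rewrite !mxE.
suff /negbTE -> : nat_of_ord i != c by rewrite mul0r.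
by apply: contra ic => /eqP ic; apply/eqP/val_inj.
Qed.

Lemma rotated_faceE theta p : rotated_face n theta p =
  (p 0 0 * cos theta) *: axis 0 + p 0 1 *: axis 1 + (p 0 0 * sin theta) *: axis 2.
Proof.
apply/rowP => -[i Hi]; rewrite !mxE /=.
by case: i Hi => [|[|[|i]]] Hi /=; rewrite ?nth_nil ?mulr1 ?mulr0 ?addr0 ?add0r.
Qed.

End Isometry.

(** For [t = 2 pi / 3] the angle [2 t] is [- t] modulo [2 pi], so [cos t] is a root of
    [2 c^2 - c - 1 = (c - 1)(2 c + 1)]; the root 1 is excluded by [sin t > 0]. *)
Lemma cos_2pi3 (R : realType) : cos (2 * pi / 3) = - 2^-1 :> R.
Proof.
set t : R := 2 * pi / 3.
have pi0 := pi_gt0 R.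
have s0 : 0 < sin t by apply: sin_gt0_pi; rewrite /t; lra.
have E : cos (t + t) = cos t.
  have -> : t + t = - t + pi *+ 2 by rewrite /t mulr2n; field.
  by rewrite cosD2pi cosN.
rewrite cosD in E.
have := cos2Dsin2 t => E2.
have : (cos t - 1) * (2 * cos t + 1) = 0 by nra.
move/eqP; rewrite mulf_eq0 => /orP[/eqP c1|/eqP c1]; last by lra.
have c : cos t = 1 by lra.
have ss : 0 < sin t * sin t by rewrite mulr_gt0.
by rewrite c in E; lra.
Qed.

Lemma sin_2pi3_sqr (R : realType) : sin (2 * pi / 3) ^+ 2 = 3 / 4 :> R.
Proof. by have := cos2Dsin2 (2 * pi / 3 : R); rewrite cos_2pi3; lra. Qed.

Theorem theorem1p1 (R : realType) (n : nat) (hn : (3 <= n)%N)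
    (u : 'I_3 -> 'rV[R]_2 -> 'rV[R]_n)
    (u_ball : maps_into u closed_unit_ball)
    (u_conformal : conformal_Ymap u)
    (u_minimal : minimal_immersion_Ymap u)
    (u_free_boundary : meets_sphere_orthogonally u) :
  congruent (Yimage u) (flat_Ycone R n).
Proof.
case: u_conformal => conf _; case: u_minimal => umin agree conormals.
have HU j : exists U : set 'rV[R]_2, [/\ open U, half_disk `<=` U & smooth_on U (u j)].
  by case: (umin j).
have [U hU] := choice HU.
have [b [d [bb dd bd sb img]]] : exists (b : 'I_3 -> 'rV[R]_n) (d : 'rV[R]_n),
  [/\ forall j, dot (b j) (b j) = 1, dot d d = 1, forall j, dot (b j) d = 0,
      \sum_(j < 3) b j = 0
    & forall j, u j @` half_disk = [set q 0 0 *: b j + q 0 1 *: d | q in half_disk]].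
  apply: (@cone_faces R n u U) => //.
  - by move=> j; case: (hU j).
  - by move=> j; case: (hU j).
  - by move=> j; case: (hU j).
  - by move=> j p Dp; case: (umin j) => _ /(_ p Dp) [].
pose s : R := sin (2 * pi / 3).
have s2 : s ^+ 2 = 3 / 4 by exact: sin_2pi3_sqr.
have s0 : s != 0 by rewrite -sqrf_eq0 s2; lra.
have b0E : b 2 = - b 0 - b 1.
  move: sb; rewrite sum_ord3 => /eqP; rewrite addrC addr_eq0 => /eqP ->.
  by rewrite opprD.
have b01 : dot (b 0) (b 1) = - 2^-1.
  by have := bb 2; rewrite b0E !dotE !bb [dot (b 1) _]dotC; lra.
(* Gram-Schmidt: since [b 0 . b 1 = - 1/2], the vector [b 1 + b 0 / 2] is orthogonal to [b 0] and
   has squared norm [3/4 = s^2]. *)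
pose g := s^-1 *: (b 1 + 2^-1 *: b 0).
have gg : dot g g = 1.
  rewrite /g !dotE !bb [dot (b 1) _]dotC b01.
  rewrite [LHS](_ : _ = (3 / 4) / s ^+ 2); last by field.
  by rewrite s2 mulfV //; lra.
have bg : dot (b 0) g = 0 by rewrite /g !dotE bb b01; ring.
have dg : dot d g = 0 by rewrite /g !dotE ![dot d _]dotC !bd; ring.
have n0 : (0 < n)%N by apply: leq_trans hn.
have n1 : (1 < n)%N by apply: leq_trans hn.
have [P [lP Pb Pd Pg]] : exists P, [/\ linear_isometry P, P (b 0) = axis R n 0,
    P d = axis R n 1 & P g = axis R n 2].
  by apply: isometry_three; rewrite !dot_axis ?bb ?dd ?gg ?bd ?bg ?dg.
have PL (a c : R) x y : P (a *: x + c *: y) = a *: P x + c *: P y by case: lP.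
have b1E : b 1 = (- 2^-1) *: b 0 + s *: g.
  by rewrite /g scalerA mulfV // scale1r scaleNr addrC addrK.
have b2E : b 2 = (- 2^-1) *: b 0 + (- s) *: g.
  rewrite b0E b1E; move: (g : 'rV[R]_n) (b 0) => g' b'.
  by apply/rowP => i; rewrite !mxE; field.
(* The isometry sends [b 0], [d], [g] to the first three axes, so the angle of [b j] in the plane of
   [b 0] and [g] becomes the rotation angle about the [y]-axis. *)
have face j theta : b j = cos theta *: b 0 + sin theta *: g ->
    P @` (u j @` half_disk) = rotated_face n theta @` half_disk.
  move=> bE; rewrite img image_comp; apply: eq_imagel => q _ /=.
  rewrite PL bE PL Pb Pd Pg rotated_faceE; apply/rowP => i; rewrite !mxE; ring.
exists P; first by move=> x y; exact: linear_isometry_enorm.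
have -> : Yimage u = u 0 @` half_disk `|` u 1 @` half_disk `|` u 2 @` half_disk.
  rewrite /Yimage; apply/seteqP; split => [x [j _ jx]|x].
    case: j jx => [[|[|[|//]]] Hj] jx; [left; left|left; right|right];
      congr (_ x) : jx; congr (u _ @` _); exact: val_inj.
  by case=> [[|]|] ?; [exists 0|exists 1|exists 2].
rewrite /flat_Ycone !image_setU (face 0 0) ?(face 1 (2 * pi / 3)) ?(face 2 (- (2 * pi / 3))) //.
- by rewrite cosN sinN cos_2pi3.
- by rewrite cos_2pi3.
- by rewrite cos0 sin0 scale1r scale0r addr0.
Qed.
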